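(* Let $\mu_0$ be a non-trivial probability measure on $\partial\mathbb{D}$ (i.e. its support is infinite) whose Verblunsky coefficients satisfy $$\sum_{n=0}^\infty|\alpha_{n+1}(d\mu_0)-\alpha_n(d\mu_0)|<\infty\qquad\text{and}\qquad\sum_{n=0}^\infty|\alpha_n(d\mu_0)|^2<\infty$$ (that is, $d\mu_0\in W_1(1)$ with $\ell^2$ Verblunsky coefficients). Let $m\ge1$, let $z_j=e^{i\omega_j}\in\partial\mathbb{D}$, $1\le j\le m$, be distinct points with $z_j\ne1$, let $\gamma_1,\dots,\gamma_m>0$ with $\sum_{j=1}^m\gamma_j<1$, and let $\mu_m$ be the probability measure $$d\mu_m=\Big(1-\sum_{j=1}^m\gamma_j\Big)d\mu_0+\sum_{j=1}^m\gamma_j\,\delta_{\omega_j},$$ where $\delta_{\omega_j}$ is the unit point mass at $z_j=e^{i\omega_j}$. Then $d\mu_m\in W_{m+1}(1,z_1,\dots,z_m)$, and for $n\ge1$ $$\alpha_n(d\mu_m)=\alpha_n(d\mu_0)+\sum_{j=1}^m\frac{\overline{z_j}^{\,n}c_j}{n}+E_n,$$ where $c_j=\overline{z_j}\,|D(z_j,d\mu_0)|^2D(z_j,d\mu_0)^{-2}$ are constants independent of the weights $\gamma_1,\dots,\gamma_m$ and of $n$, and $E_n=E_n(z_1,\dots,z_m,\gamma_1,\dots,\gamma_m)=o(1/n)$ as $n\to\infty$. Furthermore, for every $z\in\partial\mathbb{D}\setminus\{1,z_1,\dots,z_m\}$ the limit $\varphi_\infty^*(z,d\mu_m)=\lim_{n\to\infty}\varphi_n^*(z,d\mu_m)$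 exists, is continuous in $z$ on $\partial\mathbb{D}\setminus\{1,z_1,\dots,z_m\}$, and equals $$\Big(1-\sum_{j=1}^m\gamma_j\Big)^{-1/2}D(z,d\mu_0)^{-1}.$$
   Context: Notation: $\mathbb{D}=\{z\in\mathbb{C}:|z|<1\}$, $\partial\mathbb{D}=\{z\in\mathbb{C}:|z|=1\}$. For a probability measure $\mu$ on $\partial\mathbb{D}$ with infinite support, put $\langle f,g\rangle=\int_{\partial\mathbb{D}}\overline{f}\,g\,d\mu$ and $\|f\|=\langle f,f\rangle^{1/2}$. $\Phi_n(z)=\Phi_n(z,d\mu)$ is the monic polynomial of degree $n$ orthogonal to $1,z,\dots,z^{n-1}$ in $L^2(\partial\mathbb{D},d\mu)$, and $\varphi_n=\Phi_n/\|\Phi_n\|$. The reversed polynomials are $\Phi_n^*(z)=z^n\overline{\Phi_n(1/\overline{z})}$ and $\varphi_n^*=\Phi_n^*/\|\Phi_n\|$. The Verblunsky coefficients $\alpha_n=\alpha_n(d\mu)\in\mathbb{D}$, $n\ge0$, are the unique numbers such that $\Phi_{n+1}(z)=z\Phi_n(z)-\overline{\alpha_n}\,\Phi_n^*(z)$. Generalized bounded variation: for $\zeta_1,\dots,\zeta_p\in\partial\mathbb{D}$, $W_p(\zeta_1,\dots,\zeta_p)$ is the class of complex sequences $(\alpha_n)_{n\ge0}$ admitting a decomposition $\alpha_n=\sum_{k=1}^p\beta_{n,k}$ with $\beta_{n,k}\in\mathbb{C}$ and $\sum_{n=0}^\infty|\zeta_k\beta_{n+1,k}-\beta_{n,k}|<\infty$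 for each $1\le k\le p$. One writes $d\mu\in W_p(\zeta_1,\dots,\zeta_p)$ if the Verblunsky coefficients of $\mu$ form a sequence in this class. Szegő function: if $d\mu=w(\theta)\frac{d\theta}{2\pi}+d\mu_s$ with $\mu_s$ singular and $\sum_{j}|\alpha_j(d\mu)|^2<\infty$, then $\log w$ is integrable (Szegő's theorem) and $$D(z)=D(z,d\mu)=\exp\left(\frac1{4\pi}\int_0^{2\pi}\frac{e^{i\theta}+z}{e^{i\theta}-z}\log w(\theta)\,d\theta\right),\qquad z\in\mathbb{D},$$ is analytic on $\mathbb{D}$. For $z\in\partial\mathbb{D}$, $D(z,d\mu)$ denotes the boundary value $\lim_{r\uparrow1}D(rz,d\mu)$ (under the hypotheses on $\mu_0$ in the claim, this limit exists and is non-zero for every $z\in\partial\mathbb{D}\setminus\{1\}$). *)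

(* Defs.v *)
From HB Require Import structures.
From mathcomp Require Import all_boot all_order all_algebra.
From mathcomp Require Import all_classical all_reals all_analysis.
From mathcomp Require Import complex.

Set Implicit Arguments.
Unset Strict Implicit.
Unset Printing Implicit Defensive.

Import Order.TTheory GRing.Theory Num.Theory numFieldNormedType.Exports.

Local Open Scope classical_set_scope.
Local Open Scope complex_scope.
Local Open Scope ring_scope.

(* Throughout, [R[i]^o] is the complex plane with the topology of its norm;
   on it, [`|z|] is the modulus seen as an element of [R[i]], and [z^*%C] is
   complex conjugation. *)

(* The complex plane with its Borel sigma-algebra.  A measure on the unit
   circle is represented by a Borel measure on the plane carried by the
   circle. *)
Notation borelC R := (g_sigma_algebraType (@open (complex R)^o)).

Section circle.
Variable R : realType.
Local Notation C := (R[i]^o).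

Definition unit_circle : set C := [set z : C | `|z| = 1].

Definition expi (t : R) : C := cos t +i* sin t.

Definition cexp (z : C) : C := (expR (complex.Re z))%:C * expi (complex.Im z).

Definition cintegral d (T : measurableType d) (mu : {measure set T -> \bar R})
    (A : set T) (f : T -> C) : C :=
  (\int[mu]_(x in A) complex.Re (f x)) +i* (\int[mu]_(x in A) complex.Im (f x)).

Definition abs_summable (u : nat -> C) : Prop :=
  (\sum_(0 <= n <oo) (complex.Re `|u n|)%:E < +oo)%E.

Definition square_summable (u : nat -> C) : Prop :=
  (\sum_(0 <= n <oo) (complex.Re `|u n| ^+ 2)%:E < +oo)%E.

Definition msupport (mu : {measure set (borelC R) -> \bar R}) : set C :=
  [set z | forall U : set C, open U -> U z -> (0 < mu U)%E].

Definition nontrivial (mu : {measure set (borelC R) -> \bar R}) : Prop :=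
  infinite_set (msupport mu).

End circle.

Section opuc.
Variable R : realType.
Local Notation C := (R[i]^o).
Variable mu : {measure set (borelC R) -> \bar R}.

Definition inner (f g : C -> C) : C :=
  cintegral mu (@unit_circle R) (fun z => (f z)^*%C * g z).

Definition L2norm (f : C -> C) : C := sqrtC (inner f f).

Definition monic_orthogonal (n : nat) (p : {poly C}) : Prop :=
  [/\ p \is monic, size p = n.+1 &
      forall k, (k < n)%N -> inner (fun z => z ^+ k) (fun z => p.[z]) = 0].

Definition Phi (n : nat) : {poly C} := xget 0 [set p | monic_orthogonal n p].

End opuc.

Definition reverse_poly (R : realType) (n : nat) (p : {poly R[i]^o}) :
    {poly R[i]^o} :=
  \poly_(i < n.+1) (p`_(n - i))^*%C.

Lemma reverse_polyE (R : realType) (n : nat) (p : {poly R[i]^o}) (z : R[i]^o) :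
  (size p <= n.+1)%N -> z != 0 ->
  (reverse_poly n p).[z] = z ^+ n * (p.[(z^*%C)^-1])^*%C.
Proof.
move=> sp z0; rewrite /reverse_poly horner_poly (horner_coef_wide _ sp).
rewrite rmorph_sum mulr_sumr (reindex_inj rev_ord_inj) /=.
apply: eq_bigr => i _; rewrite subSS (subKn (leq_ord i)).
rewrite rmorphM rmorphXn /= fmorphV /= conjcK mulrCA; congr (_ * _).
by rewrite exprB ?leq_ord ?unitfE// exprVn.
Qed.

Section opuc_bis.
Variable R : realType.
Local Notation C := (R[i]^o).
Variable mu : {measure set (borelC R) -> \bar R}.

Definition Phi_star (n : nat) : {poly C} := reverse_poly n (Phi mu n).

Definition phi_star (n : nat) (z : C) : C :=
  (Phi_star n).[z] / L2norm mu (fun x => (Phi mu n).[x]).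

Definition phi_star_oo (z : C) : C := lim (phi_star n z @[n --> \oo]).

Definition verblunsky (n : nat) : C :=
  xget 0 [set a : C | Phi mu n.+1 = 'X * Phi mu n - a^*%C *: Phi_star n].

Local Notation period := (`[0%R, (2 * pi)%R]%classic : set R).

(* d mu = w(theta) d theta / (2 pi) + d mus, with mus singular with respect to
   arclength. *)
Definition lebesgue_decomposition (w : R -> R)
    (mus : {measure set (borelC R) -> \bar R}) : Prop :=
  [/\ measurable_fun period w,
      forall t, 0 <= w t,
      (exists N : set (borelC R), [/\ measurable N, mus (~` N) = 0%E &
        lebesgue_measure (period `&` @expi R @^-1` N) = 0%E]) &
      forall A : set (borelC R), measurable A ->
        (mu A = \int[lebesgue_measure]_(t in period `&` @expi R @^-1` A)
                   (w t / (2 * pi))%:E + mus A)%E].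

(* The density is determined almost everywhere only; the Szego function below
   does not depend on the version that is chosen. *)
Definition ac_density : R -> R :=
  xget (fun=> 0) [set w | exists mus, lebesgue_decomposition w mus].

Definition szego (z : C) : C :=
  cexp (((4 * pi)^-1)%:C *
    cintegral lebesgue_measure period
      (fun t : R => (expi t + z) / (expi t - z) * (ln (ac_density t))%:C)).

Definition szego_boundary (z : C) : C :=
  lim (szego (r%:C * z) @[r --> (1 : R)^'-]).

End opuc_bis.

Definition gen_bounded_variation (R : realType) (p : nat)
    (zeta : p.-tuple R[i]^o) (alpha : nat -> R[i]^o) : Prop :=
  exists beta : nat -> 'I_p -> R[i]^o,
    (forall n, alpha n = \sum_(k < p) beta n k) /\
    (forall k, abs_summable (fun n => tnth zeta k * beta n.+1 k - beta n k)).

(* Main.v *)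
(* Write [P_n = Phi_n], [Q_n = Phi_n^*] and [N_n = ||Phi_n||^2] for the data of
   [mu0].  Summation by parts in the Szego recursion shows that [Q_n] converges,
   uniformly on the closed disk away from [1], to a function [Q] without zeros
   there.  The Bernstein-Szego weights [N_n / |Q_n|^2] have the moments of [mu0]
   up to order [n]; in the limit they identify [mu0], off the point [1], with the
   density [N / |Q|^2], and the Schwarz formula for [ln |Q_n|] gives
   [D = N^(1/2) / Q].

   All the masses are added at once.  With [g_j = gamma_j / (1 - sum gamma)] and
   [u_j = Phi_n(z_j, mum)],
     [Phi_n(x, mum) = P_n(x) - sum_j g_j u_j K_n(x, z_j)]
   where [K_n] is the Christoffel-Darboux kernel.  At the [z_k] this is a linear
   system for the [u_j] with bounded off-diagonal entries and diagonal entries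
   [1 + g_k K_n(z_k, z_k)], where [K_n(z_k, z_k) ~ n |Q(z_k)|^2 / N]; hence
   [g_k u_k = P_n(z_k) / K_n(z_k, z_k) + O(1/n^2)].  At [x = 0], with [n.+1] in
   place of [n], it reads
     [alpha_n(mum) = alpha_n(mu0) + sum_j g_j conj(u_j) Q_n(z_j) / N_n],
   and the leading part of the [j]-th term gives both [conj(z_j)^n c_j / n] and
   the bounded variation twisted by [z_j]. *)

Require Import Defs.
From HB Require Import structures.
From mathcomp Require Import all_boot all_order all_algebra.
From mathcomp Require Import all_classical all_reals all_analysis.
From mathcomp Require Import complex measurable_realfun ring lra.

Import Order.TTheory GRing.Theory Num.Theory numFieldNormedType.Exports.

Local Open Scope classical_set_scope.
Local Open Scope complex_scope.
Local Open Scope ring_scope.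

Set Implicit Arguments.
Unset Strict Implicit.
Unset Printing Implicit Defensive.

Arguments complex.conjc : simpl never.

(** The coefficients of [mu0] need not be absolutely summable, so the Szego recursion gives no
    convergence by itself. Multiplication by [z - 1] turns its oscillating sum into boundary terms
    plus sums of [|alpha_{k+1} - alpha_k|] and [|alpha_k|^2]: both summability hypotheses enter
    there, and so does the exclusion of [1]. Nothing is uniform near [1], where [mu0] may have an
    atom; hence moments are compared only against the factor [|z - 1|^2], and an atom goes to the
    singular part. The logarithms of the Bernstein-Szego weights [w_n] have no obvious dominating
    function. Their convergence in mean uses that the integral of [ln w_n] is [2 pi ln N_n], bounded
    below, and that [w_m / w_n] has mean at most 1 for [m >= n]; then [ln x <= x - 1], Fatou's lemma
    and a truncation suffice. Masses inserted one by one would leave the class of [mu0] after the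
    first; a single linear system relies on the bounds for [Q_n] of [mu0] alone. The weights drop
    out of the constants because [g_k K_n(z_k, z_k)] dominates the diagonal entry, so that the
    product [g_k u_k] forgets [g_k]. *)

Section modulus.
Variable R : realType.
Local Notation C := (R[i]^o).
Implicit Types x y z : C.

(** The norm of [R[i]] is an element of [R[i]]; its real copy can enter suprema, limits in [R] and
    linear arithmetic. *)
Definition cmod z : R := complex.Re `|z|.

Lemma normcmod z : `|z| = (cmod z)%:C.
Proof. by rewrite /cmod normc_def. Qed.

Lemma cmodE z : cmod z = Num.sqrt (complex.Re z ^+ 2 + complex.Im z ^+ 2).
Proof. by rewrite /cmod normc_def. Qed.

Lemma cmod_ge0 z : 0 <= cmod z.
Proof. by rewrite cmodE sqrtr_ge0. Qed.

Lemma cmod_sqr z : cmod z ^+ 2 = complex.Re z ^+ 2 + complex.Im z ^+ 2.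
Proof. by rewrite cmodE sqr_sqrtr// addr_ge0// sqr_ge0. Qed.

Lemma cmodM x y : cmod (x * y) = cmod x * cmod y.
Proof. by apply: complexI; rewrite rmorphM/= -!normcmod normrM. Qed.

Lemma cmodN x : cmod (- x) = cmod x.
Proof. by rewrite /cmod normrN. Qed.

Lemma cmodV x : cmod x^-1 = (cmod x)^-1.
Proof. by apply: complexI; rewrite fmorphV/= -!normcmod normfV. Qed.

Lemma cmodX x n : cmod (x ^+ n) = cmod x ^+ n.
Proof. by apply: complexI; rewrite rmorphXn/= -!normcmod normrX. Qed.

Lemma cmod_conj x : cmod x^*%C = cmod x.
Proof. by rewrite /cmod normcJ. Qed.

Lemma cmodD x y : cmod (x + y) <= cmod x + cmod y.
Proof. by rewrite -lecR rmorphD/= -!normcmod ler_normD. Qed.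

Lemma cmodB x y : cmod (x - y) <= cmod x + cmod y.
Proof. by rewrite -(cmodN y); exact: cmodD. Qed.

Lemma cmod_distC x y : cmod (x - y) = cmod (y - x).
Proof. by rewrite -cmodN opprB. Qed.

Lemma cmod0 : cmod 0 = 0.
Proof. by rewrite /cmod normr0. Qed.

Lemma cmod1 : cmod 1 = 1.
Proof. by rewrite /cmod normr1. Qed.

Lemma cmod_eq0 x : (cmod x == 0) = (x == 0).
Proof. by rewrite -(inj_eq (@complexI R)) -normcmod normr_eq0. Qed.

Lemma cmod_gt0 x : (0 < cmod x) = (x != 0).
Proof. by rewrite lt_def cmod_ge0 andbT cmod_eq0. Qed.

Lemma cmodR (r : R) : cmod r%:C = `|r|.
Proof. by rewrite cmodE/= expr0n addr0 sqrtr_sqr. Qed.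

Lemma cmod_nat n : cmod n%:R = n%:R.
Proof. by rewrite -(rmorph_nat (real_complex R)) cmodR normr_nat. Qed.

Lemma mul_conjc x : x * x^*%C = (cmod x ^+ 2)%:C.
Proof. by rewrite -sqr_normc normcmod rmorphXn. Qed.

Lemma ler_Re_cmod x : `|complex.Re x| <= cmod x.
Proof. by rewrite cmodE -sqrtr_sqr ler_wsqrtr// lerDl sqr_ge0. Qed.

Lemma ler_Im_cmod x : `|complex.Im x| <= cmod x.
Proof. by rewrite cmodE -sqrtr_sqr ler_wsqrtr// lerDr sqr_ge0. Qed.

Lemma cmod_le_ReIm x : cmod x <= `|complex.Re x| + `|complex.Im x|.
Proof.
rewrite -(ler_pXn2r (ltn0Sn 1)) ?nnegrE ?cmod_ge0 ?addr_ge0// cmod_sqr.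
rewrite sqrrD !real_normK ?num_real// -addrA lerD2l lerDr.
by rewrite mulrn_wge0// mulr_ge0.
Qed.

Lemma cmod_sum I (r : seq I) (P : pred I) (F : I -> C) :
  cmod (\sum_(i <- r | P i) F i) <= \sum_(i <- r | P i) cmod (F i).
Proof.
elim/big_ind2 : _ => //; first by rewrite cmod0.
by move=> a b c d ab cd; apply: (le_trans (cmodD _ _)); exact: lerD.
Qed.

Lemma unit_circleE z : unit_circle z <-> cmod z = 1.
Proof.
by rewrite /unit_circle/= normcmod; split=> [[]//|->].
Qed.

Lemma circle_conj z : cmod z = 1 -> z^*%C = z^-1.
Proof.
move=> z1; have z0 : z != 0 by rewrite -cmod_eq0 z1 oner_eq0.
by apply: (mulfI z0); rewrite mul_conjc z1 expr1n mulfV.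
Qed.

End modulus.

(** * The Szego recursion *)

Section real_series.
Variable R : realType.
Implicit Types (u : nat -> R) (M e : R).

Lemma summable_bounded u : (forall n, 0 <= u n) ->
  (\sum_(0 <= n <oo) (u n)%:E < +oo)%E ->
  exists M, forall n, \sum_(0 <= k < n) u k <= M.
Proof.
move=> u0 soo; pose s := (\sum_(0 <= n <oo) (u n)%:E)%E.
have s0 : (0 <= s)%E by apply: nneseries_ge0 => n _ _; rewrite lee_fin.
have sfin : s \is a fin_num by rewrite ge0_fin_numE.
exists (fine s) => n; rewrite -lee_fin fineK// -sumEFin.
by apply: nneseries_lim_ge => k _ _; rewrite lee_fin.
Qed.

Lemma bounded_summable u M : (forall n, 0 <= u n) ->
  (forall n, \sum_(0 <= k < n) u k <= M) ->
  (\sum_(0 <= n <oo) (u n)%:E < +oo)%E.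
Proof.
move=> u0 uM; apply: (@le_lt_trans _ _ M%:E); last by rewrite ltry.
apply: lime_le; first by apply: is_cvg_nneseries => k _ _; rewrite lee_fin.
by near=> n; rewrite sumEFin lee_fin.
Unshelve. all: end_near. Qed.

(** The Cauchy criterion: [n0] indexes a partial sum within [e] of the supremum of all partial
    sums. *)
Lemma bounded_tail u M : (forall n, 0 <= u n) ->
  (forall n, \sum_(0 <= k < n) u k <= M) ->
  forall e, 0 < e -> exists n0, forall n m, (n0 <= n <= m)%N ->
    \sum_(n <= k < m) u k <= e.
Proof.
move=> u0 uM e e0; pose A := range (fun n => \sum_(0 <= k < n) u k).
have ubA : has_ubound A by exists M => _ [n _ <-].
have supA : has_sup A.
  by split => //; exists 0, 0%N => //; rewrite big_geq.
have [_ [n0 _ <-] n0e] := sup_adherent e0 supA.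
exists n0 => n m /andP[n0n nm].
have mA : A (\sum_(0 <= k < m) u k) by exists m.
have := ub_le_sup ubA mA.
rewrite (big_cat_nat (leq0n n) nm) (big_cat_nat (leq0n n0) n0n) /=.
have : 0 <= \sum_(n0 <= k < n) u k by exact: sumr_ge0.
by move: n0e; lra.
Qed.

Lemma argmax_nat (f : nat -> R) n m : (n <= m)%N ->
  exists2 k, (n <= k <= m)%N & forall j, (n <= j <= m)%N -> f j <= f k.
Proof.
elim: m => [|m IH].
  by rewrite leqn0 => /eqP ->; exists 0%N => // j; rewrite leqn0 => /eqP ->.
rewrite leq_eqVlt => /predU1P[->|].
  by exists m.+1; rewrite ?leqnn// => j; rewrite -eqn_leq => /eqP ->.
rewrite ltnS => nm; have [k /andP[nk km] kmax] := IH nm.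
have [fk|fk] := leP (f m.+1) (f k).
  exists k; rewrite ?nk ?leqW// => j /andP[nj].
  rewrite leq_eqVlt => /predU1P[->//|jm]; apply: kmax; rewrite nj; exact: jm.
exists m.+1; rewrite ?leqnn ?leqW// => j /andP[nj].
rewrite leq_eqVlt => /predU1P[->//|jm]; apply: le_trans (ltW fk).
by apply: kmax; rewrite nj; exact: jm.
Qed.

End real_series.

Section szego_recursion.
Variable R : realType.
Local Notation C := (R[i]^o).
Variable al : nat -> C.
Implicit Types (a b : nat -> C) (z : C).

(* The values at [z] of the orthogonal polynomials and of their reversals. *)
Definition szego_rec z a b := [/\ a 0%N = 1, b 0%N = 1,
  (forall n, a n.+1 = z * a n - (al n)^*%C * b n) &
  (forall n, b n.+1 = b n - al n * z * a n)].

Hypothesis al_lt1 : forall n, cmod (al n) < 1.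

(** Up to the factor [1 - |al n|^2], a Szego step is an isometry of the indefinite form
    [|b|^2 - |a|^2], applied to the pair [(z a, b)]. *)
Lemma szego_rec_identity z a b n : szego_rec z a b ->
  cmod (b n.+1) ^+ 2 - cmod (a n.+1) ^+ 2 =
  (1 - cmod (al n) ^+ 2) * (cmod (b n) ^+ 2 - cmod z ^+ 2 * cmod (a n) ^+ 2).
Proof.
case=> _ _ aS bS.
(* In [C] each [|x|^2] becomes [x] times its conjugate, and the claim a polynomial identity in
   independent letters. *)
have toC (u v w x y t : R) :
    u%:C - v%:C = (1 - w%:C) * (x%:C - y%:C * t%:C) :> C ->
    u - v = (1 - w) * (x - y * t).
  by move=> H; apply: complexI; rewrite !(rmorphM, rmorphB, rmorph1).
apply: toC; rewrite -!mul_conjc.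
rewrite aS bS !(rmorphB, rmorphM) /= !conjcK.
move: (al n) (al n)^*%C (a n) (a n)^*%C (b n) (b n)^*%C z^*%C => u u' x x' y y' z'.
by ring.
Qed.

(** In the closed disk the identity preserves [|a| <= |b|]. If [b n.+1] vanished, then
    [|b n| <= |al n| |b n|], against [|al n| < 1]. *)
Lemma szego_rec_le z a b : szego_rec z a b -> cmod z <= 1 ->
  forall n, cmod (a n) <= cmod (b n) /\ 0 < cmod (b n).
Proof.
move=> rec z1; case: (rec) => a0 b0 aS bS.
elim=> [|n [IHle IHgt]]; first by rewrite a0 b0 cmod1.
have aln := al_lt1 n.
have al2 : 0 < 1 - cmod (al n) ^+ 2.
  by rewrite subr_gt0 expr_lt1// cmod_ge0.
have zab : cmod z * cmod (a n) <= cmod (b n).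
  by rewrite -[leRHS]mul1r ler_pM// cmod_ge0.
split.
  rewrite -(ler_pXn2r (ltn0Sn 1)) ?nnegrE ?cmod_ge0// -subr_ge0.
  rewrite (szego_rec_identity n rec) mulr_ge0 ?(ltW al2)// subr_ge0 -exprMn.
  by rewrite ler_pXn2r// nnegrE ?mulr_ge0 ?cmod_ge0.
rewrite cmod_gt0 bS subr_eq0; apply/eqP => bE.
have : cmod (b n) < cmod (b n); last by rewrite ltxx.
rewrite {1}bE -mulrA !cmodM; apply: (@le_lt_trans _ _ (cmod (al n) * cmod (b n))).
  by rewrite ler_wpM2l// cmod_ge0.
by rewrite gtr_pMl.
Qed.

(** One step of [(z - 1) b] is [- z al_k (z a_k - a_k)]; replacing [z a_k] by
    [a_{k+1} + conj(al_k) b_k] leaves the difference [a_{k+1} - a_k], which is summed by parts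
    against [al_k]. *)
Lemma szego_rec_parts z a b n m : szego_rec z a b -> (n <= m)%N ->
  (z - 1) * (b m - b n) + z * (al m * a m - al n * a n) =
  z * \sum_(n <= k < m) ((al k.+1 - al k) * a k.+1 - al k * (al k)^*%C * b k).
Proof.
case=> _ _ aS bS; elim: m => [|m IH].
  by rewrite leqn0 => /eqP ->; rewrite big_geq// !subrr !mulr0 addr0.
rewrite leq_eqVlt => /predU1P[->|]; first by rewrite big_geq// !subrr !mulr0 addr0.
rewrite ltnS => nm; rewrite big_nat_recr//= [RHS]mulrDr -IH// bS aS.
by ring.
Qed.

(** The total size of the coefficients in [szego_rec_parts]: boundary terms, variation, and
    squares. *)
Definition szego_err n m : R := cmod (al n) + cmod (al m) +
  \sum_(n <= k < m) (cmod (al k.+1 - al k) + cmod (al k) ^+ 2).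

Lemma szego_rec_dist z a b n m (M : R) :
  szego_rec z a b -> cmod z <= 1 -> (n <= m)%N ->
  (forall k, (n <= k <= m)%N -> cmod (b k) <= M) ->
  cmod (z - 1) * cmod (b m - b n) <= M * szego_err n m.
Proof.
move=> rec z1 nm bM.
have aM k : (n <= k <= m)%N -> cmod (a k) <= M.
  by move=> /bM; apply: le_trans; have [] := szego_rec_le rec z1 k.
have M0 : 0 <= M by rewrite (le_trans (cmod_ge0 (b m)))// bM// nm leqnn.
have -> : cmod (z - 1) * cmod (b m - b n) = cmod (
  z * \sum_(n <= k < m) ((al k.+1 - al k) * a k.+1 - al k * (al k)^*%C * b k)
  - z * (al m * a m - al n * a n)).
  by rewrite -(szego_rec_parts rec nm) addrK cmodM.
rewrite -mulrBr cmodM -[leRHS]mul1r.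
apply: ler_pM => //; rewrite ?cmod_ge0//.
rewrite /szego_err mulrDr [leRHS]addrC; apply: (le_trans (cmodB _ _)).
apply: lerD; last first.
  rewrite [leRHS]mulrDr [leRHS]addrC; apply: (le_trans (cmodB _ _)).
  rewrite !cmodM ![cmod (al _) * _]mulrC.
  by apply: lerD; rewrite ler_wpM2r// ?cmod_ge0// aM// ?leqnn ?nm.
apply: (le_trans (cmod_sum _ _ _)); rewrite mulr_sumr.
rewrite big_nat_cond [leRHS]big_nat_cond; apply: ler_sum => k.
rewrite andbT => /andP[nk km].
apply: (le_trans (cmodB _ _)); rewrite mulrDr !cmodM cmod_conj -expr2.
apply: lerD; rewrite mulrC ler_wpM2r// ?cmod_ge0 ?sqr_ge0//.
- by rewrite aM// km leqW.
- by rewrite bM// nk ltnW.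
Qed.

Hypothesis al_err : forall e : R, 0 < e ->
  exists n0, forall n m, (n0 <= n <= m)%N -> szego_err n m <= e.

(** Crude bounds, meant for the finitely many indices that precede the tail estimates. *)
Lemma szego_rec_growth z a b : szego_rec z a b -> cmod z <= 1 -> forall n,
  \prod_(0 <= k < n) (1 - cmod (al k)) <= cmod (b n) <= 2 ^+ n.
Proof.
move=> rec z1; case: (rec) => a0 b0 aS bS; elim=> [|n /andP[IHl IHu]].
  by rewrite big_geq// b0 cmod1 lexx.
have [ab _] := szego_rec_le rec z1 n.
have ua : cmod (al n * z * a n) <= cmod (al n) * cmod (b n).
  rewrite -mulrA cmodM ler_wpM2l ?cmod_ge0// cmodM -[leRHS]mul1r.
  by rewrite ler_pM// cmod_ge0.
have := al_lt1 n => al1; have := cmod_ge0 (al n) => alge0.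
rewrite big_nat_recr//= bS; apply/andP; split.
  have : cmod (b n) <= cmod (b n - al n * z * a n) + cmod (al n * z * a n).
    by rewrite (le_trans _ (cmodD _ _))// subrK.
  have : (\prod_(0 <= k < n) (1 - cmod (al k))) * (1 - cmod (al n))
     <= cmod (b n) * (1 - cmod (al n)) by rewrite ler_wpM2r// subr_ge0 ltW.
  by move: ua; nra.
apply: (le_trans (cmodB _ _)); rewrite exprS.
have := cmod_ge0 (b n) => bge0.
have : cmod (al n) * cmod (b n) <= cmod (b n) by rewrite ler_piMl// ltW.
by move: ua IHu; lra.
Qed.

(** [szego_rec_dist] bounds the differences of [b] by the maximum of [|b|] itself. Let [|b_k|] be
    the maximum over [[n0, n]]. With tail at most [d / 3], differences inside the window are at most
    [|b_k| / 3], so [|b_n| >= 2/3 |b_k|] and [|b_k| <= 3/2 |b_n0|]. The crude bounds at [n0] then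
    give both constants. *)
Lemma szego_rec_bounds (d : R) : 0 < d -> exists c B : R, 0 < c /\
  forall z a b, szego_rec z a b -> cmod z <= 1 -> d <= cmod (z - 1) ->
  forall n, c <= cmod (b n) <= B.
Proof.
move=> d0; have [|n0 n0P] := al_err (e := d / 3); first by rewrite divr_gt0.
pose p n := \prod_(0 <= k < n) (1 - cmod (al k)).
have p0 n : 0 < p n by apply: prodr_gt0 => k _; rewrite subr_gt0.
have pS n : p n.+1 <= p n.
  rewrite /p big_nat_recr//= ler_piMr ?(ltW (p0 n))//.
  by rewrite lerBlDr lerDl cmod_ge0.
have pmono n : (n <= n0)%N -> p n0 <= p n.
  move=> nn0; rewrite -(subnK nn0); elim: (n0 - n)%N => [|k]; first by rewrite add0n.
  by rewrite addSn; exact: le_trans.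
exists (2 / 3 * p n0), (3 / 2 * 2 ^+ n0); split; first by rewrite mulr_gt0.
move=> z a b rec z1 dz n.
have grow := szego_rec_growth rec z1.
have [nn0|n0n] := leqP n n0.
  have /andP[bl bu] := grow n; apply/andP; split.
    have := pmono n nn0; have := p0 n0; move: bl; rewrite -/(p n); lra.
  have : (2 : R) ^+ n <= 2 ^+ n0 by rewrite ler_eXn2l// ltr1n.
  move: bu; have : 0 <= 2 ^+ n :> R by []; lra.
have [k /andP[n0k kn] kmax] := argmax_nat (fun j => cmod (b j)) (ltnW n0n).
have key i j : (n0 <= i <= j)%N -> (j <= n)%N ->
    cmod (b j - b i) <= cmod (b k) / 3.
  move=> /andP[n0i ij] jn.
  have := szego_rec_dist rec z1 ij (M := cmod (b k)).
  move=> /(_ _)/wrap[].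
    move=> l /andP[il lj]; apply: kmax.
    by rewrite (leq_trans n0i il) (leq_trans lj jn).
  have ij0 := n0P i j; rewrite n0i ij in ij0; move/(_ isT) : ij0 => ij0 H.
  have : cmod (b k) * szego_err i j <= cmod (b k) * (d / 3).
    by rewrite ler_wpM2l// cmod_ge0.
  move=> /(le_trans H){}H.
  rewrite -(ler_pM2l d0) [leRHS]mulrCA; apply: le_trans H.
  by rewrite ler_wpM2r// cmod_ge0.
have d1 := key _ _ (introT andP (conj n0k kn)) (leqnn n).
have d2 := key n0 k; rewrite leqnn n0k in d2; move/(_ isT kn) : d2 => d2.
have /andP[gl gu] := grow n0.
have t1 : cmod (b k) <= cmod (b n) + cmod (b n - b k).
  by rewrite (le_trans _ (cmodB (b n) (b n - b k)))// opprB addrC subrK.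
have t2 : cmod (b k) <= cmod (b n0) + cmod (b k - b n0).
  by rewrite (le_trans _ (cmodD _ _))// addrC subrK.
have t3 : cmod (b n0) <= cmod (b k).
  by apply: kmax; rewrite leqnn ltnW.
have t4 : cmod (b n) <= cmod (b k) by apply: kmax; rewrite leqnn ltnW.
rewrite -/(p n0) in gl.
by apply/andP; split; lra.
Qed.

(** The threshold depends on [d] and [e] only: this is uniform convergence away from [1]. *)
Lemma szego_rec_cauchy (d : R) : 0 < d -> forall e, 0 < e ->
  exists n0, forall z a b, szego_rec z a b -> cmod z <= 1 ->
  d <= cmod (z - 1) ->
  forall n m, (n0 <= n <= m)%N -> cmod (b m - b n) <= e.
Proof.
move=> d0 e e0; have [c [B [c0 bB]]] := szego_rec_bounds d0.
have B0 : 0 < `|B| + 1 by rewrite ltr_pwDr.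
have [|n0 n0P] := al_err (e := d * e / (`|B| + 1)).
  by rewrite divr_gt0// mulr_gt0.
exists n0 => z a b rec z1 dz n m nm.
have /andP[_ nm'] := nm.
have := szego_rec_dist rec z1 nm' (M := `|B| + 1).
move=> /(_ _)/wrap[].
  move=> k _; have /andP[_ bk] := bB _ _ _ rec z1 dz k.
  by rewrite (le_trans bk)// (le_trans (ler_norm B))// lerDl.
have := n0P _ _ nm; rewrite -(ler_pM2l B0) mulrCA mulfV ?gt_eqF// mulr1 => h1 h2.
have := le_trans h2 h1; rewrite -[leRHS]/(d * e) => h3.
rewrite -(ler_pM2l d0); apply: le_trans h3.
by rewrite ler_wpM2r// cmod_ge0.
Qed.

End szego_recursion.

(** * Orthogonal polynomials of a positive definite Toeplitz form *)

Section reverse.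
Variable R : realType.
Local Notation C := (R[i]^o).
Implicit Types (p q : {poly C}) (n i : nat).

Lemma coef_reverse n p i :
  (reverse_poly n p)`_i = if (i <= n)%N then (p`_(n - i))^*%C else 0.
Proof. by rewrite coef_poly ltnS. Qed.

Lemma size_reverse n p : (size (reverse_poly n p) <= n.+1)%N.
Proof. exact: size_poly. Qed.

Lemma reverseD n p q :
  reverse_poly n (p + q) = reverse_poly n p + reverse_poly n q.
Proof.
apply/polyP => i; rewrite coefD !coef_reverse coefD.
by case: ifP => _; rewrite ?addr0// rmorphD.
Qed.

Lemma reverseZ n (a : C) p :
  reverse_poly n (a *: p) = a^*%C *: reverse_poly n p.
Proof.
apply/polyP => i; rewrite coefZ !coef_reverse coefZ.
by case: ifP => _; rewrite ?mulr0// rmorphM.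
Qed.

Lemma reverseSX n p : reverse_poly n.+1 ('X * p) = reverse_poly n p.
Proof.
apply/polyP => i; rewrite !coef_reverse coefXM.
case: (ltngtP i n.+1) => [|ltni|->]; rewrite ?ltnS.
- by move=> le_in; rewrite le_in subn_eq0 ltnNge le_in subSn.
- by rewrite leqNgt ltnW.
- by rewrite subnn ltnn conjc0.
Qed.

Lemma reverseS n p : (size p <= n.+1)%N ->
  reverse_poly n.+1 p = 'X * reverse_poly n p.
Proof.
move=> sp; apply/polyP => i; rewrite coefXM !coef_reverse.
case: i => [|i] /=; first by rewrite subn0 nth_default// conjc0.
by rewrite ltnS subSS.
Qed.

Lemma reverseK n p : (size p <= n.+1)%N ->
  reverse_poly n (reverse_poly n p) = p.
Proof.
move=> sp; apply/polyP => i; rewrite !coef_reverse leq_subr.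
by case: leqP => [le_in|lt_ni]; [rewrite subKn// conjcK | rewrite nth_default// (leq_trans sp)].
Qed.

Lemma reverse0 : reverse_poly 0 (1 : {poly C}) = 1.
Proof.
apply/polyP => i; rewrite coef_reverse.
case: i => [|i]; first by rewrite leqnn subnn coef1 conjc1.
by rewrite ltn0 coef1.
Qed.

Lemma horner_reverse_circle n p (z : C) : (size p <= n.+1)%N -> cmod z = 1 ->
  (reverse_poly n p).[z] = z ^+ n * (p.[z])^*%C.
Proof.
move=> sp z1; have z0 : z != 0 by rewrite -cmod_eq0 z1 oner_eq0.
by rewrite (reverse_polyE sp z0) circle_conj// invrK.
Qed.

End reverse.

Section toeplitz_form.
Variable R : realType.
Local Notation C := (R[i]^o).
Implicit Types (p q r : {poly C}) (a : C) (n i j k : nat).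
Implicit Types (F G : {poly C} -> {poly C} -> C).

(** Stated for abstract forms, linear in the second argument, because it is applied to [mu0], to the
    perturbed measure and to the Bernstein-Szego weights. Shift invariance is all that remains of
    the fact that a measure lives on the circle. *)
Definition toeplitz F := [/\
  forall p a q r, F p (a *: q + r) = a * F p q + F p r,
  forall p q, F q p = (F p q)^*%C &
  forall p q, F ('X * p) ('X * q) = F p q].

Definition posdef F := forall p, p != 0 -> 0 < complex.Re (F p p).

Section form.
Variable F : {poly C} -> {poly C} -> C.
Hypothesis FT : toeplitz F.

Let Flin p a q r : F p (a *: q + r) = a * F p q + F p r.
Proof. by case: FT => H _ _; exact: H. Qed.

Lemma form_conj p q : F q p = (F p q)^*%C.
Proof. by case: FT => _ H _; exact: H. Qed.

Lemma formX p q : F ('X * p) ('X * q) = F p q.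
Proof. by case: FT => _ _ H; exact: H. Qed.

Lemma form0r p : F p 0 = 0.
Proof.
have := Flin p 1 0 0; rewrite scale1r add0r mul1r => /(congr1 (fun x => x - F p 0)).
by rewrite subrr addrK.
Qed.

Lemma formDr p q r : F p (q + r) = F p q + F p r.
Proof. by have := Flin p 1 q r; rewrite scale1r mul1r. Qed.

Lemma formZr p a q : F p (a *: q) = a * F p q.
Proof. by have := Flin p a q 0; rewrite addr0 form0r addr0. Qed.

Lemma formBr p q r : F p (q - r) = F p q - F p r.
Proof. by rewrite -scaleN1r formDr formZr mulN1r. Qed.

Lemma formDl p q r : F (q + r) p = F q p + F r p.
Proof.
by rewrite form_conj formDr rmorphD/= -!(form_conj p).
Qed.

Lemma formZl p a q : F (a *: q) p = a^*%C * F q p.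
Proof. by rewrite form_conj formZr rmorphM/= -(form_conj p q). Qed.

Lemma form_sumr p (I : Type) (s : seq I) (P : pred I) (f : I -> {poly C}) :
  F p (\sum_(i <- s | P i) f i) = \sum_(i <- s | P i) F p (f i).
Proof. by apply: (big_morph (F p)); [exact: formDr|exact: form0r]. Qed.

Lemma form_expandr p q n : (size q <= n)%N ->
  F p q = \sum_(i < n) q`_i * F p 'X^i.
Proof.
move=> sq; have -> : q = \sum_(i < n) q`_i *: 'X^i.
  rewrite -poly_def; apply/polyP => i; rewrite coef_poly.
  by case: ltnP => // ni; rewrite nth_default// (leq_trans sq).
rewrite form_sumr; apply: eq_bigr => i _; rewrite formZr.
by rewrite -[in RHS]poly_def coef_poly ltn_ord.
Qed.

Lemma formXn i j k : F 'X^(i + k) 'X^(j + k) = F 'X^i 'X^j.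
Proof.
by elim: k => [|k IH]; rewrite ?addn0// !addnS !exprS formX.
Qed.

(** On the circle reversal is the antiunitary map [q -> z^n conj(q)], which exchanges [z^k] and
    [z^(n-k)]; here shift invariance plays that role. *)
Lemma form_reverse n k q : (k <= n)%N -> (size q <= n.+1)%N ->
  F 'X^k (reverse_poly n q) = (F 'X^(n - k) q)^*%C.
Proof.
move=> kn sq; rewrite (form_expandr _ (size_reverse n q)).
rewrite (form_expandr _ sq) rmorph_sum (reindex_inj rev_ord_inj) /=.
apply: eq_bigr => i _; have iN : (i <= n)%N by rewrite -ltnS.
rewrite rmorphM/= -form_conj coef_reverse subSS leq_subr subKn//.
congr (_ * _); rewrite -(formXn k (n - i) i) subnK//.
rewrite -(formXn i (n - k) k) subnK// addnC//.
Qed.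

Lemma form_lt p n q : (forall k, (k < n)%N -> F 'X^k p = 0) ->
  (size q <= n)%N -> F q p = 0.
Proof.
move=> pn sq; rewrite form_conj (form_expandr _ sq) big1 ?conjc0// => i _.
by rewrite form_conj pn// conjc0 mulr0.
Qed.

Definition orth n p := [/\ p \is monic, size p = n.+1 &
  forall k, (k < n)%N -> F 'X^k p = 0].

(** Both ['X * opoly m] and the reversal of [opoly m] are orthogonal to ['X^1, ..., 'X^m], so a
    single multiple of the latter corrects the pairing with [1]. Its denominator is the squared norm
    of [opoly m], by [orth_reverse1]. *)
Fixpoint opoly n : {poly C} := if n is m.+1 then
  'X * opoly m - (F 1 ('X * opoly m) / F 1 (reverse_poly m (opoly m)))
    *: reverse_poly m (opoly m) else 1.

Definition verb n : C :=
  (F 1 ('X * opoly n) / F 1 (reverse_poly n (opoly n)))^*%C.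

Definition opolyr n := reverse_poly n (opoly n).

Lemma opolyS n :
  opoly n.+1 = 'X * opoly n - (verb n)^*%C *: opolyr n.
Proof. by rewrite /verb conjcK. Qed.

Definition onorm2 n : R := complex.Re (F (opoly n) (opoly n)).

Lemma form_self p : F p p = (complex.Re (F p p))%:C.
Proof.
have := form_conj p p; case: (F p p) => x y [] /= yN.
by congr (_ +i* _); lra.
Qed.

Hypothesis Fpos : posdef F.

Lemma monic_sub_size n p q : p \is monic -> size p = n.+1 ->
  q \is monic -> size q = n.+1 -> (size (q - p)%R <= n)%N.
Proof.
move=> /monicP mp sp /monicP mq sq; apply/leq_sizeP => j.
rewrite leq_eqVlt coefB => /predU1P[<-|nj].
  by move: mp mq; rewrite !lead_coefE sp sq /= => -> ->; rewrite subrr.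
by rewrite !nth_default ?subr0 ?sp ?sq.
Qed.

Lemma orth_monic n p q : orth n p -> q \is monic -> size q = n.+1 ->
  F q p = F p p.
Proof.
move=> [mp sp op] mq sq; have -> : q = p + (q - p) by rewrite addrC subrK.
by rewrite formDl (form_lt op (monic_sub_size mp sp mq sq)) addr0.
Qed.

Lemma orth_unique n p q : orth n p -> orth n q -> p = q.
Proof.
move=> [mp sp op] [mq sq oq]; apply/eqP; rewrite -subr_eq0.
apply: contraT => /Fpos.
have spq := monic_sub_size mq sq mp sp.
by rewrite formBr (form_lt op spq) (form_lt oq spq) subrr ltxx.
Qed.

Lemma orth_reverse1 n p : orth n p ->
  F 1 (reverse_poly n p) = F p p.
Proof.
move=> op; have [mp sp _] := op.
have -> : 1 = 'X^0 :> {poly C} by rewrite expr0.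
rewrite form_reverse ?sp// subn0 (orth_monic op) ?monicXn ?size_polyXn//.
by rewrite -form_conj.
Qed.

Lemma orth_reverse n p k : orth n p -> (0 < k <= n)%N ->
  F 'X^k (reverse_poly n p) = 0.
Proof.
move=> [mp sp op] /andP[k0 kn]; rewrite form_reverse ?sp// op ?conjc0//.
by rewrite ltn_subrL k0 (leq_trans k0).
Qed.

Lemma orth_opoly n : orth n (opoly n).
Proof.
elim: n => [|n IH]; first by split; rewrite ?monic1 ?size_poly1.
have [mp sp op] := IH.
have Fpp : F (opoly n) (opoly n) != 0.
  rewrite form_self; apply/eqP => -[/eqP]; rewrite gt_eqF//.
  by apply: Fpos; exact: monic_neq0.
have sX : size ('X * opoly n) = n.+2 by rewrite mulrC size_mulX ?monic_neq0// sp.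
have sr : (size (opolyr n) <= n.+1)%N := size_reverse n _.
have sZ a : (size (a *: opolyr n)%R < size ('X * opoly n)%R)%N.
  by rewrite sX ltnS (leq_trans (size_scale_leq _ _)).
rewrite opolyS; split.
- rewrite monicE lead_coefDl ?size_polyN ?sZ//.
  by rewrite lead_coefM lead_coefX mul1r -monicE.
- by rewrite size_polyDl ?size_polyN ?sZ.
- case=> [_|k kn]; rewrite formBr formZr.
    rewrite expr0 /verb conjcK divfK ?subrr//.
    by rewrite (orth_reverse1 IH).
  by rewrite exprS formX op// -exprS orth_reverse// mulr0 subr0.
Qed.

Lemma size_opoly n : size (opoly n) = n.+1.
Proof. by have [] := orth_opoly n. Qed.

Lemma monic_opoly n : opoly n \is monic.
Proof. by have [] := orth_opoly n. Qed.

Lemma opoly_lead n : (opoly n)`_n = 1.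
Proof.
by have /monicP := monic_opoly n; rewrite lead_coefE size_opoly.
Qed.

Lemma opoly_lt n q : (size q <= n)%N -> F q (opoly n) = 0.
Proof. by have [_ _ op] := orth_opoly n; exact: form_lt. Qed.

Lemma opoly_self n : F (opoly n) (opoly n) = (onorm2 n)%:C.
Proof. exact: form_self. Qed.

Lemma onorm2_gt0 n : 0 < onorm2 n.
Proof. by apply: Fpos; rewrite monic_neq0// monic_opoly. Qed.

Lemma opolyrS n : opolyr n.+1 = opolyr n - verb n *: ('X * opoly n).
Proof.
rewrite {1}/opolyr opolyS -scaleN1r reverseD !reverseZ reverseSX.
rewrite rmorphN rmorph1 scaleN1r conjcK.
by rewrite [X in _ *: X]reverseS ?size_reverse// reverseK// size_opoly.
Qed.

(** Pythagoras in ['X * opoly n = opoly n.+1 + conj(verb n) opolyr n]: the two terms are orthogonal,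
    and the shift and the reversal both preserve the norm. *)
Lemma onorm2S n : onorm2 n.+1 = (1 - cmod (verb n) ^+ 2) * onorm2 n.
Proof.
apply: complexI; rewrite -opoly_self.
have E : 'X * opoly n = opoly n.+1 + (verb n)^*%C *: opolyr n.
  by rewrite opolyS subrK.
move: (verb n) E => v E.
have rr : F (opolyr n) (opolyr n) = (onorm2 n)%:C.
  rewrite -opoly_self -(orth_reverse1 (orth_opoly n)).
  rewrite [LHS]form_conj (form_expandr (opolyr n) (size_reverse n (opoly n))) big_ord_recl.
  rewrite big1 => [|i _].
    by rewrite addr0 coef_reverse subn0 leq0n opoly_lead rmorph1 mul1r expr0 -form_conj.
  rewrite form_conj (orth_reverse (orth_opoly n)) ?conjc0 ?mulr0//.
  by rewrite lift0/=.
have NE := formX (opoly n) (opoly n); rewrite E in NE.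
have rn : F (opolyr n) (opoly n.+1) = 0 by rewrite opoly_lt// size_reverse.
have nr : F (opoly n.+1) (opolyr n) = 0 by rewrite form_conj rn conjc0.
move: (opoly n.+1) rn nr NE (opoly_self n.+1) => P rn nr NE PE.
rewrite formDr !formDl !formZr !formZl rr rn nr !mulr0 addr0 add0r in NE.
rewrite conjcK opoly_self mulrA (mulrC v^*%C) mul_conjc in NE.
by rewrite rmorphM rmorphB rmorph1 /= mulrBl mul1r -[in X in X - _]NE addrK.
Qed.

Lemma verb_lt1 n : cmod (verb n) < 1.
Proof.
have := onorm2_gt0 n.+1; rewrite onorm2S pmulr_lgt0 ?onorm2_gt0// subr_gt0.
by rewrite -[ltRHS](expr1n _ 2) ltr_pXn2r// ?nnegrE ?cmod_ge0.
Qed.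

Lemma szego_rec_opoly z :
  szego_rec verb z (fun n => (opoly n).[z]) (fun n => (opolyr n).[z]).
Proof.
split=> [||n|n]; rewrite ?opolyS ?opolyrS.
- by rewrite hornerC.
- by rewrite /opolyr /= reverse0 hornerC.
- by rewrite hornerD hornerN hornerZ hornerM hornerX.
- by rewrite hornerD hornerN hornerZ hornerM hornerX mulrA.
Qed.

Lemma opolyr_circle n z : cmod z = 1 ->
  (opolyr n).[z] = z ^+ n * ((opoly n).[z])^*%C.
Proof. by move=> z1; rewrite horner_reverse_circle ?size_opoly. Qed.

Lemma opoly_circle n z : cmod z = 1 ->
  (opoly n).[z] = z ^+ n * ((opolyr n).[z])^*%C.
Proof.
move=> z1; rewrite opolyr_circle// rmorphM/= conjcK rmorphXn/= circle_conj//.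
by rewrite mulrA -exprMn mulfV ?expr1n ?mul1r// -cmod_eq0 z1 oner_eq0.
Qed.

Lemma opolyr0 n : (opolyr n).[0] = 1.
Proof.
by rewrite horner_coef0 coef_reverse subn0 leq0n opoly_lead rmorph1.
Qed.

Lemma opoly0 n : (opoly n.+1).[0] = - (verb n)^*%C.
Proof.
by rewrite opolyS hornerD hornerN hornerZ opolyr0 hornerM hornerX mul0r sub0r mulr1.
Qed.

(** The Christoffel-Darboux kernel, kept as a polynomial in its first variable so that it can be
    paired by [F]. *)
Definition cdker n (w : C) : {poly C} :=
  \sum_(k < n) (((opoly k).[w])^*%C / (onorm2 k)%:C) *: opoly k.

Lemma onorm2C_neq0 n : (onorm2 n)%:C != 0 :> C.
Proof. by rewrite -cmod_eq0 cmodR normr_eq0 gt_eqF ?onorm2_gt0. Qed.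

Lemma size_cdker n w : (size (cdker n w) <= n)%N.
Proof.
apply: (leq_trans (size_sum _ _ _)); apply/bigmax_leqP => k _.
by rewrite (leq_trans (size_scale_leq _ _))// size_opoly.
Qed.

Lemma cdkerS n w : cdker n.+1 w =
  cdker n w + (((opoly n).[w])^*%C / (onorm2 n)%:C) *: opoly n.
Proof. by rewrite /cdker big_ord_recr. Qed.

Lemma cdker_reproducing n w q : (size q <= n)%N -> F (cdker n w) q = q.[w].
Proof.
elim: n q => [|n IH] q.
  by rewrite leqn0 size_poly_eq0 => /eqP ->; rewrite form0r horner0.
move=> sq; set c := q`_n.
have sr : (size (q - c *: opoly n)%R <= n)%N.
  apply/leq_sizeP => j; rewrite leq_eqVlt coefB coefZ => /predU1P[<-|nj].
    by rewrite opoly_lead mulr1 subrr.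
  by rewrite !nth_default ?mulr0 ?subr0 ?size_opoly// (leq_trans sq).
have qE : q = (q - c *: opoly n) + c *: opoly n by rewrite subrK.
rewrite {1}qE formDr cdkerS !formDl IH// formZl [F (opoly n) (q - _)]form_conj.
rewrite opoly_lt// conjc0 mulr0 addr0 !formZr formZl opoly_lt ?size_cdker//.
have E : ((opoly n).[w]^*%C / (onorm2 n)%:C)^*%C * (onorm2 n)%:C = (opoly n).[w].
  by rewrite rmorphM fmorphV /= conjcK conjc_real divfK ?onorm2C_neq0.
rewrite mulr0 add0r opoly_self E.
by rewrite [in RHS]qE [RHS]hornerD hornerZ.
Qed.

Lemma onorm2SC n : (onorm2 n.+1)%:C =
  (1 - verb n * (verb n)^*%C) * (onorm2 n)%:C :> C.
Proof.
by rewrite onorm2S [LHS]rmorphM [X in X * _]rmorphB rmorph1 mul_conjc.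
Qed.

Lemma christoffel_darboux n z w : (cdker n w).[z] * (1 - z * w^*%C) =
  ((opolyr n).[z] * ((opolyr n).[w])^*%C - (opoly n).[z] * ((opoly n).[w])^*%C)
  / (onorm2 n)%:C.
Proof.
elim: n => [|n IH].
  rewrite /cdker big_ord0 horner0 mul0r /opolyr /= reverse0 !hornerC.
  by rewrite subrr mul0r.
rewrite cdkerS hornerD hornerZ mulrDl IH.
have [_ _ az bz] := szego_rec_opoly z; have [_ _ aw bw] := szego_rec_opoly w.
rewrite az bz aw bw onorm2SC.
have := onorm2C_neq0 n.+1; rewrite onorm2SC.
rewrite mulf_eq0 negb_or => /andP[]; move: (verb n) (onorm2 n)%:C => v N v0 N0.
rewrite !rmorphB !rmorphM/= !conjcK.
by field; rewrite N0.
Qed.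

(** In the Christoffel-Darboux formula at [0], the part with [opoly n] is cancelled by the extra
    term of degree [n]. This is the origin of the factor [conj(Q_n(z_j)) / N_n]. *)
Lemma cdker_at0 n w :
  (cdker n.+1 w).[0] = ((opolyr n).[w])^*%C / (onorm2 n)%:C.
Proof.
have := christoffel_darboux n 0 w; rewrite mul0r subr0 mulr1.
rewrite cdkerS hornerD => ->; rewrite hornerZ opolyr0 mul1r.
by field; rewrite onorm2C_neq0.
Qed.

Lemma cdker_conj n w z : ((cdker n w).[z])^*%C = (cdker n z).[w].
Proof.
rewrite /cdker !horner_sum rmorph_sum; apply: eq_bigr => k _.
rewrite !hornerZ !rmorphM fmorphV/= conjcK conjc_real.
by rewrite [RHS]mulrC mulrA mulrAC.
Qed.

Lemma cdker_diag n w : (cdker n w).[w] =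
  (\sum_(k < n) cmod (opoly k).[w] ^+ 2 / onorm2 k)%:C.
Proof.
rewrite /cdker horner_sum rmorph_sum; apply: eq_bigr => k _.
by rewrite hornerZ mulrAC (mulrC _^*%C) mul_conjc -fmorphV -rmorphM.
Qed.

End form.

Section extremal.
Variables F G : {poly C} -> {poly C} -> C.
Hypotheses (FT : toeplitz F) (Fpos : posdef F) (GT : toeplitz G).

(* Run downwards, the Szego recursion determines all the lower orthogonal
   polynomials; no positivity of [G] is needed. *)
Lemma toeplitz_determined n :
  (forall j, (j <= n)%N ->
    G 'X^j (opoly F n) = if j == n then (onorm2 F n)%:C else 0) ->
  forall k, (k <= n)%N -> forall j, (j <= k)%N ->
    G 'X^j (opoly F k) = if j == k then (onorm2 F k)%:C else 0.
Proof.
elim: n => [|n IH] Gn k.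
  by rewrite leqn0 => /eqP -> j; exact: Gn.
rewrite leq_eqVlt => /predU1P[->|]; first exact: Gn.
rewrite ltnS; apply: IH => j jn {k}.
have := onorm2SC FT Fpos n; have := onorm2C_neq0 FT Fpos n.+1.
(* The inverse Szego step: [opolyr F n] is eliminated from the two recursions. *)
have E : (1 - verb F n * (verb F n)^*%C) *: ('X * opoly F n) =
    opoly F n.+1 + (verb F n)^*%C *: opolyr F n.+1.
  rewrite opolyS opolyrS//.
  move: ('X * opoly F n) (opolyr F n) (verb F n) => P Q v.
  by rewrite scalerBr scalerA scalerBl scale1r addrA subrK mulrC.
have rz : G 'X^(j.+1) (opolyr F n.+1) = 0.
  rewrite (form_reverse GT) ?ltnS ?size_opoly// subSS Gn ?(leqW (leq_subr _ _))//.
  by rewrite ltn_eqF ?ltnS ?leq_subr// conjc0.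
have := Gn j.+1; rewrite ltnS => /(_ jn) Gj.
have := congr1 (G 'X^(j.+1)) E; rewrite formDr// !formZr// rz mulr0 addr0 Gj.
rewrite exprS formX// eqSS => H N0 NS.
rewrite NS mulf_eq0 negb_or in N0; case/andP: N0 => v0 _.
by apply: (mulfI v0); rewrite H; case: ifP => _; rewrite ?mulr0.
Qed.

(** [toeplitz_determined] gives agreement of [1] against every [opoly F k]; triangularity carries it
    to [1] against ['X^k], and shift invariance to all pairs of monomials. *)
Lemma toeplitz_moments n :
  (forall j, (j <= n)%N ->
    G 'X^j (opoly F n) = if j == n then (onorm2 F n)%:C else 0) ->
  forall p q, (size p <= n.+1)%N -> (size q <= n.+1)%N -> G p q = F p q.
Proof.
move=> Gn.
have GF k : (k <= n)%N -> G 1 (opoly F k) = F 1 (opoly F k).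
  move=> kn; have := toeplitz_determined Gn kn (leq0n k); rewrite expr0 => ->.
  case: k kn => [_|k kn]; first by rewrite eqxx -opoly_self.
  by rewrite ltn_eqF// opoly_lt// size_poly1.
have mom k : (k <= n)%N -> G 1 'X^k = F 1 'X^k.
  elim/ltn_ind: k => k IH kn.
  have sk : (size ('X^k - opoly F k)%R <= k)%N.
    by apply: monic_sub_size; rewrite ?monicXn ?size_polyXn ?monic_opoly ?size_opoly.
  have -> : 'X^k = ('X^k - opoly F k) + opoly F k by rewrite subrK.
  rewrite (formDr GT) (formDr FT) GF//; congr (_ + _).
  rewrite (form_expandr GT _ sk) (form_expandr FT _ sk).
  by apply: eq_bigr => i _; rewrite IH// (leq_trans (ltnW (ltn_ord i))).
have mom2 k l : (k <= n)%N -> (l <= n)%N -> G 'X^k 'X^l = F 'X^k 'X^l.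
  wlog kl : k l / (k <= l)%N.
    move=> W kn ln; have [kl|/ltnW lk] := leqP k l; first exact: W.
    by rewrite (form_conj GT) (form_conj FT) W.
  move=> kn ln; rewrite -[k]add0n -(subnK kl) (formXn GT) (formXn FT) expr0.
  by rewrite mom// (leq_trans (leq_subr _ _)).
move=> p q sp sq.
rewrite (form_expandr GT _ sq) (form_expandr FT _ sq); apply: eq_bigr => i _.
congr (_ * _); rewrite (form_conj GT) (form_conj FT); congr (_^*%C).
rewrite (form_expandr GT _ sp) (form_expandr FT _ sp); apply: eq_bigr => j _.
by rewrite mom2// -ltnS.
Qed.

End extremal.

Section perturbation.
Variables (F F1 : {poly C} -> {poly C} -> C) (m : nat).
Variables (z : 'I_m -> C) (c : R) (gamma : 'I_m -> R).
Hypotheses (FT : toeplitz F) (Fpos : posdef F).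
Hypotheses (F1T : toeplitz F1) (F1pos : posdef F1) (c0 : 0 < c).
Hypothesis F1E : forall p q, F1 p q = c%:C * F p q +
  \sum_(j < m) (gamma j)%:C * ((p.[z j])^*%C * q.[z j]).

(** The difference of the two monic polynomials has degree below [n], so its value at [x] is its
    pairing with the kernel. The kernel is [F1]-orthogonal to [opoly F1 n], which trades the
    [F]-pairing for point evaluations. *)
Lemma perturbed_opoly n x : (opoly F1 n).[x] = (opoly F n).[x] -
  \sum_(j < m) (gamma j / c)%:C * (opoly F1 n).[z j] * (cdker F n (z j)).[x].
Proof.
have cC : c%:C != 0 :> C by rewrite -cmod_eq0 cmodR normr_eq0 gt_eqF.
have sd : (size (opoly F1 n - opoly F n)%R <= n)%N.
  by apply: monic_sub_size; rewrite ?monic_opoly ?size_opoly.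
have key : (opoly F1 n).[x] - (opoly F n).[x] = F (cdker F n x) (opoly F1 n).
  rewrite -hornerN -hornerD -(cdker_reproducing FT Fpos x sd) formBr//.
  by rewrite [X in _ - X]opoly_lt ?subr0 ?size_cdker.
have := F1E (cdker F n x) (opoly F1 n); rewrite opoly_lt ?size_cdker// => /esym/eqP.
rewrite addr_eq0 -(subrK (opoly F n).[x] (opoly F1 n).[x]) key addrC => /eqP H.
congr (_ + _); apply: (mulfI cC); rewrite H mulrN mulr_sumr; congr (- _).
apply: eq_bigr => j _; rewrite rmorphM fmorphV/= cdker_conj.
by field.
Qed.

End perturbation.
End toeplitz_form.

(** * Complex-valued integrals *)

Section complex_integral.
Context {R : realType} {d : measure_display} {T : measurableType d}.
Local Notation C := (R[i]^o).
Variables (mu : {measure set T -> \bar R}) (A : set T).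
Hypotheses (mA : measurable A) (muA : (mu A < +oo)%E).
Implicit Types (f g : T -> C) (a : C) (h : T -> R).

Lemma ReD (x y : C) : complex.Re (x + y) = complex.Re x + complex.Re y.
Proof. by case: x y => [? ?] [? ?]. Qed.

Lemma ImD (x y : C) : complex.Im (x + y) = complex.Im x + complex.Im y.
Proof. by case: x y => [? ?] [? ?]. Qed.

Lemma Re_sum (I : Type) (s : seq I) (F : I -> C) :
  complex.Re (\sum_(i <- s) F i) = \sum_(i <- s) complex.Re (F i).
Proof. by apply: (big_morph (fun x : C => complex.Re x)) => //; exact: ReD. Qed.

Lemma Im_sum (I : Type) (s : seq I) (F : I -> C) :
  complex.Im (\sum_(i <- s) F i) = \sum_(i <- s) complex.Im (F i).
Proof. by apply: (big_morph (fun x : C => complex.Im x)) => //; exact: ImD. Qed.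

Lemma ReM (x y : C) : complex.Re (x * y) =
  complex.Re x * complex.Re y - complex.Im x * complex.Im y.
Proof. by case: x y => [? ?] [? ?]. Qed.

Lemma ImM (x y : C) : complex.Im (x * y) =
  complex.Re x * complex.Im y + complex.Im x * complex.Re y.
Proof. by case: x y => [? ?] [? ?]. Qed.

Lemma ReJ (x : C) : complex.Re x^*%C = complex.Re x.
Proof. by case: x => [? ?]. Qed.

Lemma ImJ (x : C) : complex.Im x^*%C = - complex.Im x.
Proof. by case: x => [? ?]. Qed.

Definition cintegrable f := mu.-integrable A (EFin \o (fun x => complex.Re (f x))) /\
  mu.-integrable A (EFin \o (fun x => complex.Im (f x))).

Definition cbounded f := [/\ measurable_fun A (fun x => complex.Re (f x)),
  measurable_fun A (fun x => complex.Im (f x)) &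
  exists M : R, forall x, A x -> cmod (f x) <= M].

Lemma cbounded_integrable f : cbounded f -> cintegrable f.
Proof.
case=> mRe mIm [M fM]; split; apply: measurable_bounded_integrable => //;
  exists M; (split; first exact: num_real) => N MN x Ax /=.
  by rewrite (le_trans (ler_Re_cmod _))// (le_trans (fM _ Ax))// ltW.
by rewrite (le_trans (ler_Im_cmod _))// (le_trans (fM _ Ax))// ltW.
Qed.

Lemma eq_cbounded f g : {in A, f =1 g} -> cbounded f -> cbounded g.
Proof.
move=> fg [mRe mIm [M fM]]; split.
- by apply: eq_measurable_fun mRe => x Ax /=; rewrite fg.
- by apply: eq_measurable_fun mIm => x Ax /=; rewrite fg.
- by exists M => x Ax; rewrite -fg ?inE//; exact: fM.
Qed.

Lemma cbounded_cst a : cbounded (fun=> a).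
Proof. by split; [exact: measurable_cst|exact: measurable_cst|exists (cmod a)]. Qed.

Lemma cboundedD f g : cbounded f -> cbounded g -> cbounded (fun x => f x + g x).
Proof.
move=> [mfR mfI [M fM]] [mgR mgI [N gN]]; split.
- rewrite (_ : (fun _ => _) = (fun x => complex.Re (f x)) \+ (fun x => complex.Re (g x))).
    exact: measurable_funD.
  by apply/funext => x /=; rewrite ReD.
- rewrite (_ : (fun _ => _) = (fun x => complex.Im (f x)) \+ (fun x => complex.Im (g x))).
    exact: measurable_funD.
  by apply/funext => x /=; rewrite ImD.
- by exists (M + N) => x Ax; rewrite (le_trans (cmodD _ _))// lerD ?fM ?gN.
Qed.

Lemma cboundedM f g : cbounded f -> cbounded g -> cbounded (fun x => f x * g x).
Proof.
move=> [mfR mfI [M fM]] [mgR mgI [N gN]]; split.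
- rewrite (_ : (fun _ => _) = ((fun x => complex.Re (f x)) \* (fun x => complex.Re (g x))) \-
    ((fun x => complex.Im (f x)) \* (fun x => complex.Im (g x)))).
    by apply: measurable_funB; exact: measurable_funM.
  by apply/funext => x /=; rewrite ReM.
- rewrite (_ : (fun _ => _) = ((fun x => complex.Re (f x)) \* (fun x => complex.Im (g x))) \+
    ((fun x => complex.Im (f x)) \* (fun x => complex.Re (g x)))).
    by apply: measurable_funD; exact: measurable_funM.
  by apply/funext => x /=; rewrite ImM.
- by exists (M * N) => x Ax; rewrite cmodM ler_pM ?cmod_ge0 ?fM ?gN.
Qed.

Lemma cboundedJ f : cbounded f -> cbounded (fun x => (f x)^*%C).
Proof.
move=> [mfR mfI [M fM]]; split.
- by rewrite (_ : (fun _ => _) = (fun x => complex.Re (f x)))//; apply/funext => x /=; rewrite ReJ.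
- rewrite (_ : (fun _ => _) = \- (fun x => complex.Im (f x))); first exact: measurable_funN.
  by apply/funext => x /=; rewrite ImJ.
- by exists M => x Ax; rewrite cmod_conj fM.
Qed.

Lemma cboundedX f n : cbounded f -> cbounded (fun x => f x ^+ n).
Proof.
move=> bf; elim: n => [|n IH].
  by under eq_fun do rewrite expr0; exact: cbounded_cst.
by under eq_fun do rewrite exprS; exact: cboundedM.
Qed.

Lemma cbounded_sum (I : Type) (s : seq I) (F : I -> T -> C) :
  (forall i, cbounded (F i)) -> cbounded (fun x => \sum_(i <- s) F i x).
Proof.
move=> bF; elim: s => [|i s IH].
  by under eq_fun do rewrite big_nil; exact: cbounded_cst.
by under eq_fun do rewrite big_cons; exact: cboundedD.
Qed.

Lemma cbounded_horner (p : {poly C}) f :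
  cbounded f -> cbounded (fun x => p.[f x]).
Proof.
move=> bf; under eq_fun do rewrite horner_coef.
by apply: cbounded_sum => i; apply: cboundedM; [exact: cbounded_cst|exact: cboundedX].
Qed.

Lemma eq_cintegral f g : {in A, f =1 g} -> cintegral mu A f = cintegral mu A g.
Proof.
move=> fg; congr (_ +i* _); apply: eq_Rintegral => x Ax; rewrite fg//.
Qed.

Lemma cintegralD f g : cintegrable f -> cintegrable g ->
  cintegral mu A (fun x => f x + g x) = cintegral mu A f + cintegral mu A g.
Proof.
move=> [fR fI] [gR gI]; rewrite /cintegral.
have -> (a b c d' : R) : (a +i* b) + (c +i* d') = (a + c) +i* (b + d') :> C by [].
rewrite -!RintegralD//; congr (_ +i* _); apply: eq_Rintegral => x _.
  by rewrite ReD.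
by rewrite ImD.
Qed.

Lemma cintegrableD f g : cintegrable f -> cintegrable g ->
  cintegrable (fun x => f x + g x).
Proof.
move=> [fR fI] [gR gI]; split.
  by apply: eq_integrable (integrableD mA fR gR) => // x _ /=; rewrite ReD.
by apply: eq_integrable (integrableD mA fI gI) => // x _ /=; rewrite ImD.
Qed.

Lemma cintegralZ a f : cintegrable f ->
  cintegral mu A (fun x => a * f x) = a * cintegral mu A f.
Proof.
move=> [fR fI]; rewrite /cintegral; case: a => a1 a2.
have -> (a b c d' : R) :
  (a +i* b) * (c +i* d') = (a * c - b * d') +i* (a * d' + b * c) :> C by [].
have iZ (r : R) h : mu.-integrable A (EFin \o h) ->
    mu.-integrable A (EFin \o (fun x => r * h x)).
  by move=> ih; apply: eq_integrable (integrableZl mA r ih).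
rewrite -!RintegralZl// -RintegralB// ?iZ// -RintegralD// ?iZ//.
by congr (_ +i* _); apply: eq_Rintegral => x _; rewrite ?ReM ?ImM.
Qed.

Lemma cintegrableZ a f : cintegrable f -> cintegrable (fun x => a * f x).
Proof.
move=> [fR fI]; case: a => a1 a2; split.
  apply: eq_integrable (integrableB mA (integrableZl mA a1 fR) (integrableZl mA a2 fI)) => //.
  by move=> x _ /=; rewrite ReM.
apply: eq_integrable (integrableD mA (integrableZl mA a1 fI) (integrableZl mA a2 fR)) => //.
by move=> x _ /=; rewrite ImM.
Qed.

Lemma cintegralB f g : cintegrable f -> cintegrable g ->
  cintegral mu A (fun x => f x - g x) = cintegral mu A f - cintegral mu A g.
Proof.
move=> fi gi; rewrite -[X in _ = _ - X]mul1r -mulNr -cintegralZ//.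
rewrite -cintegralD ?cintegralZ//; last exact: cintegrableZ.
by apply: eq_cintegral => x _; rewrite mulN1r.
Qed.

Lemma cintegralJ f : cintegrable f ->
  cintegral mu A (fun x => (f x)^*%C) = (cintegral mu A f)^*%C.
Proof.
move=> [fR fI]; rewrite /cintegral -[RHS]/(_ +i* _); congr (_ +i* _).
  by apply: eq_Rintegral => x _; rewrite ReJ.
rewrite -[RHS]mulN1r -RintegralZl//; apply: eq_Rintegral => x _.
by rewrite ImJ mulN1r.
Qed.

Lemma cintegral0 : cintegral mu A (fun=> 0) = 0.
Proof. by rewrite /cintegral /Rintegral !integral0. Qed.

Lemma cintegral_sum (I : Type) (s : seq I) (F : I -> T -> C) :
  (forall i, cintegrable (F i)) ->
  cintegrable (fun x => \sum_(i <- s) F i x) /\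
  cintegral mu A (fun x => \sum_(i <- s) F i x) = \sum_(i <- s) cintegral mu A (F i).
Proof.
move=> iF; elim: s => [|i s [IH1 IH2]].
  under eq_fun do rewrite big_nil; rewrite big_nil cintegral0; split => //.
  by apply: cbounded_integrable; exact: cbounded_cst.
under eq_fun do rewrite big_cons; rewrite big_cons; split; first exact: cintegrableD.
by rewrite cintegralD// IH2.
Qed.

Lemma cintegral_real h : cintegral mu A (fun x => (h x)%:C) =
  (\int[mu]_(x in A) h x)%:C.
Proof. by rewrite /cintegral /= [X in _ +i* X](_ : _ = 0) // /Rintegral integral0. Qed.

Lemma cintegral_cst a : cintegral mu A (fun=> a) = a * (fine (mu A))%:C.
Proof.
rewrite /cintegral !Rintegral_cst//; case: a => x y /=.
by rewrite -[RHS]/(_ +i* _)/= !mulr0 subr0 add0r.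
Qed.

(** The factor 2 comes from bounding real and imaginary parts separately; it is harmless for
    limits. *)
Lemma cmod_cintegral_le f h : cintegrable f -> mu.-integrable A (EFin \o h) ->
  (forall x, A x -> cmod (f x) <= h x) ->
  cmod (cintegral mu A f) <= 2 * \int[mu]_(x in A) h x.
Proof.
move=> [fR fI] ih fh; apply: (le_trans (cmod_le_ReIm _)) => /=.
rewrite mulr_natl mulr2n; apply: lerD;
  apply: (le_trans (le_normr_Rintegral _ _)) => //; apply: le_Rintegral => //.
- exact: integrable_norm.
- by move=> x Ax; rewrite (le_trans (ler_Re_cmod _))// fh.
- exact: integrable_norm.
- by move=> x Ax; rewrite (le_trans (ler_Im_cmod _))// fh.
Qed.

Lemma cmod_cintegral_bound f (M : R) : cintegrable f ->
  (forall x, A x -> cmod (f x) <= M) ->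
  cmod (cintegral mu A f) <= 2 * (M * fine (mu A)).
Proof.
move=> fi fM; rewrite -Rintegral_cst//; apply: cmod_cintegral_le => //.
by apply: measurable_bounded_integrable => //; exact: bounded_cst.
Qed.

End complex_integral.

Section circle_integral.
Variable R : realType.
Local Notation C := (R[i]^o).
Local Notation period := (`[0%R, (2 * pi)%R]%classic : set R).
Implicit Types (f g : R -> C) (a z b : C) (t : R).

Lemma cmod_expi t : cmod (expi t) = 1 :> R.
Proof. by rewrite cmodE/= cos2Dsin2 sqrtr1. Qed.

Lemma expi_neq0 t : expi t != 0 :> C.
Proof. by rewrite -cmod_eq0 cmod_expi oner_eq0. Qed.

Lemma expiD s t : expi (s + t) = expi s * expi t :> C.
Proof. by rewrite /expi cosD sinD; congr (_ +i* _); rewrite addrC. Qed.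

Lemma expi0 : expi 0 = 1 :> C.
Proof. by rewrite /expi cos0 sin0. Qed.

Lemma expiX t n : expi t ^+ n = expi (n%:R * t) :> C.
Proof.
elim: n => [|n IH]; first by rewrite mul0r expi0.
by rewrite exprS IH -expiD -nat1r mulrDl mul1r.
Qed.

Lemma expi_conj t : (expi t)^*%C = (expi t)^-1 :> C.
Proof. by rewrite circle_conj// cmod_expi. Qed.

Lemma pi2_gt0 : 0 < 2 * pi :> R.
Proof. by rewrite mulr_gt0// pi_gt0. Qed.

Lemma measurable_period : measurable (period : set (measurableTypeR R)).
Proof. exact: measurable_itv. Qed.

Lemma lebesgue_period : lebesgue_measure period = (2 * pi)%:E.
Proof. by rewrite lebesgue_measure_itv/= lte_fin pi2_gt0 oppr0 addr0. Qed.

Lemma lebesgue_period_lty : (lebesgue_measure period < +oo)%E.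
Proof. by rewrite lebesgue_period ltry. Qed.

Hint Resolve measurable_period lebesgue_period_lty : core.

Definition ccontinuous f := continuous (fun t => complex.Re (f t)) /\
  continuous (fun t => complex.Im (f t)).

Lemma ccontinuous_cbounded f : ccontinuous f ->
  cbounded (period : set (measurableTypeR R)) f.
Proof.
move=> [cR cI]; split.
- by apply: measurable_funTS; exact: continuous_measurable_fun.
- by apply: measurable_funTS; exact: continuous_measurable_fun.
have bnd (h : R -> R) : continuous h -> exists M, forall x, period x -> `|h x| <= M.
  move=> ch; have [|c _ cM] := @EVT_max R (fun x => `|h x|) 0 (2 * pi) (ltW pi2_gt0).
    apply: continuous_subspaceT => x; apply: continuous_comp; first exact: ch.
    exact: norm_continuous.
  by exists `|h c| => x px; exact: cM.
have [M hM] := bnd _ cR; have [N hN] := bnd _ cI.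
exists (M + N) => x px; apply: (le_trans (cmod_le_ReIm _)); apply: lerD.
  exact: hM.
exact: hN.
Qed.

Lemma ccontinuous_cst a : ccontinuous (fun=> a).
Proof. by split; apply: cst_continuous. Qed.

Lemma ccontinuousD f g : ccontinuous f -> ccontinuous g ->
  ccontinuous (fun t => f t + g t).
Proof.
move=> [fR fI] [gR gI]; split.
  under eq_fun do rewrite ReD; move=> x; apply: cvgD; [exact: fR|exact: gR].
under eq_fun do rewrite ImD; move=> x; apply: cvgD; [exact: fI|exact: gI].
Qed.

Lemma ccontinuousM f g : ccontinuous f -> ccontinuous g ->
  ccontinuous (fun t => f t * g t).
Proof.
move=> [fR fI] [gR gI]; split.
  under eq_fun do rewrite ReM; move=> x; apply: cvgB; apply: cvgM;
  by [exact: fR|exact: gR|exact: fI|exact: gI].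
under eq_fun do rewrite ImM; move=> x; apply: cvgD; apply: cvgM;
by [exact: fR|exact: gR|exact: fI|exact: gI].
Qed.

Lemma ccontinuousJ f : ccontinuous f -> ccontinuous (fun t => (f t)^*%C).
Proof.
move=> [fR fI]; split; first by under eq_fun do rewrite ReJ.
by under eq_fun do rewrite ImJ; move=> x; apply: cvgN; exact: fI.
Qed.

Lemma ccontinuous_real (h : R -> R) : continuous h ->
  ccontinuous (fun t => (h t)%:C).
Proof. by move=> ch; split => //; exact: cst_continuous. Qed.

Lemma continuous_cmod2 f : ccontinuous f -> continuous (fun t => cmod (f t) ^+ 2).
Proof.
move=> [fR fI]; under eq_fun do rewrite cmod_sqr !expr2.
by move=> x; apply: cvgD; apply: cvgM; [exact: fR|exact: fR|exact: fI|exact: fI].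
Qed.

Lemma continuous_cmod f : ccontinuous f -> continuous (fun t => cmod (f t)).
Proof.
move=> cf; have -> : (fun t => cmod (f t)) = (fun t => Num.sqrt (cmod (f t) ^+ 2)).
  by apply/funext => t; rewrite sqrtr_sqr ger0_norm// cmod_ge0.
move=> x; apply: continuous_comp; first exact: (continuous_cmod2 cf).
exact: sqrt_continuous.
Qed.

Lemma invcE a : a^-1 = ((cmod a ^+ 2)^-1)%:C * a^*%C.
Proof.
have [->|a0] := eqVneq a 0; first by rewrite conjc0 mulr0 invr0.
apply: (mulfI a0); rewrite mulfV// mulrCA mul_conjc -rmorphM mulVf ?rmorph1//.
by rewrite expf_eq0/= cmod_eq0.
Qed.

Lemma ccontinuousV f : ccontinuous f -> (forall t, f t != 0) ->
  ccontinuous (fun t => (f t)^-1).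
Proof.
move=> cf f0; under eq_fun do rewrite invcE.
apply: ccontinuousM; last exact: ccontinuousJ.
apply: ccontinuous_real => x; apply: cvgV; last exact: (continuous_cmod2 cf).
by rewrite expf_eq0/= cmod_eq0.
Qed.

Lemma ccontinuous_expi : ccontinuous (@expi R).
Proof. by split; [exact: continuous_cos|exact: continuous_sin]. Qed.

Lemma ccontinuousX f n : ccontinuous f -> ccontinuous (fun t => f t ^+ n).
Proof.
move=> cf; elim: n => [|n IH].
  by under eq_fun do rewrite expr0; exact: ccontinuous_cst.
by under eq_fun do rewrite exprS; exact: ccontinuousM.
Qed.

Lemma ccontinuous_sum (I : Type) (s : seq I) (F : I -> R -> C) :
  (forall i, ccontinuous (F i)) -> ccontinuous (fun x => \sum_(i <- s) F i x).
Proof.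
move=> bF; elim: s => [|i s IH].
  by under eq_fun do rewrite big_nil; exact: ccontinuous_cst.
by under eq_fun do rewrite big_cons; exact: ccontinuousD.
Qed.

Lemma ccontinuous_horner (p : {poly C}) f :
  ccontinuous f -> ccontinuous (fun x => p.[f x]).
Proof.
move=> bf; under eq_fun do rewrite horner_coef.
by apply: ccontinuous_sum => i; apply: ccontinuousM;
  [exact: ccontinuous_cst|exact: ccontinuousX].
Qed.

Lemma ccontinuous_integrable f : ccontinuous f ->
  cintegrable lebesgue_measure (period : set (measurableTypeR R)) f.
Proof. by move=> cf; apply: cbounded_integrable => //; exact: ccontinuous_cbounded. Qed.

Lemma continuous_integrable (h : R -> R) : continuous h ->
  lebesgue_measure.-integrable (period : set (measurableTypeR R)) (EFin \o h).
Proof. by move=> ch; have [] := ccontinuous_integrable (ccontinuous_real ch). Qed.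

Definition tint f : C := cintegral lebesgue_measure (period : set (measurableTypeR R)) f.

Lemma tintD f g : ccontinuous f -> ccontinuous g ->
  tint (fun t => f t + g t) = tint f + tint g.
Proof. by move=> cf cg; rewrite /tint cintegralD//; exact: ccontinuous_integrable. Qed.

Lemma tintB f g : ccontinuous f -> ccontinuous g ->
  tint (fun t => f t - g t) = tint f - tint g.
Proof. by move=> cf cg; rewrite /tint cintegralB//; exact: ccontinuous_integrable. Qed.

Lemma tintZ a f : ccontinuous f -> tint (fun t => a * f t) = a * tint f.
Proof. by move=> cf; rewrite /tint cintegralZ//; exact: ccontinuous_integrable. Qed.

Lemma tintJ f : ccontinuous f -> tint (fun t => (f t)^*%C) = (tint f)^*%C.
Proof. by move=> cf; rewrite /tint cintegralJ//; exact: ccontinuous_integrable. Qed.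

Lemma tint_cst a : tint (fun=> a) = a * (2 * pi)%:C.
Proof.
rewrite /tint cintegral_cst//.
exact: (congr1 (fun x => a * (fine x)%:C) lebesgue_period).
Qed.

Lemma tint_bound f (M : R) : ccontinuous f ->
  (forall t, period t -> cmod (f t) <= M) ->
  cmod (tint f) <= 4 * pi * M.
Proof.
move=> cf fM; rewrite /tint.
apply: (le_trans (cmod_cintegral_bound measurable_period lebesgue_period_lty
  (ccontinuous_integrable cf) fM)).
rewrite (_ : fine _ = 2 * pi); last exact: (congr1 fine lebesgue_period).
by rewrite le_eqVlt; apply/orP; left; apply/eqP; ring.
Qed.

Lemma eq_tint f g : f =1 g -> tint f = tint g.
Proof. by move=> fg; congr tint; exact/funext. Qed.

Lemma tint_expi n : tint (fun t => expi t ^+ n) = if n == 0%N then (2 * pi)%:C else 0.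
Proof.
case: eqP => [->|/eqP n0].
  under eq_fun do rewrite expr0; by rewrite tint_cst mul1r.
have nR : n%:R != 0 :> R by rewrite pnatr_eq0.
have pn : sin (n%:R * (2 * pi)) = 0 :> R /\ cos (n%:R * (2 * pi)) = 1 :> R.
  have := @expiX (2 * pi) n.
  have -> : expi (2 * pi) = 1 :> C.
    by rewrite /expi mulr_natl cos2pi sin2pi.
  by rewrite expr1n => -[<- <-].
have dn (x : R) : is_derive x 1 (fun t : R => n%:R * t) (n%:R : R).
  by apply: is_derive_eq; rewrite /GRing.scale/= mulr1.
have ftc (f F : R -> R) : continuous f -> (forall x : R, is_derive x (1 : R) F (f x)) ->
    F (2 * pi) = F 0 -> \int[lebesgue_measure]_(x in period) f x = 0.
  move=> cf dF FE; rewrite /Rintegral (@continuous_FTC2 _ f F)//.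
  - by rewrite FE subee.
  - exact: pi2_gt0.
  - exact: continuous_subspaceT.
  - have cF : continuous F.
      move=> x; apply: differentiable_continuous.
      by apply/derivable1_diffP; exact: ex_derive.
    split.
    + by move=> x _; exact: ex_derive.
    + by apply: cvg_at_right_filter; exact: cF.
    + by apply: cvg_at_left_filter; exact: cF.
  - by move=> x _; rewrite derive1E derive_val.
under eq_fun do rewrite expiX.
have cn : continuous (fun t : R => n%:R * t).
  by move=> x; apply: cvgM; [exact: cvg_cst|exact: cvg_id].
rewrite /tint /cintegral /expi /=; congr (_ +i* _).
- apply: (ftc _ (fun t => n%:R^-1 * sin (n%:R * t))).
  + by move=> x; apply: continuous_comp; [exact: cn|exact: continuous_cos].
  + move=> x; apply: is_derive_eq; rewrite /GRing.scale/=.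
    by field.
  + by rewrite mulr0 sin0; case: pn => -> _.
- apply: (ftc _ (fun t => - (n%:R^-1 * cos (n%:R * t)))).
  + by move=> x; apply: continuous_comp; [exact: cn|exact: continuous_sin].
  + move=> x; apply: is_derive_eq; rewrite /GRing.scale/=.
    by field.
  + by rewrite mulr0 cos0; case: pn => _ ->.
Qed.

(** Meant for integrals related by [J k = z * J k.+1]: iterating gives [|J k| <= |z|^n M] for every
    [n], so they vanish. It stands in for power series expansions. *)
Lemma geometric_bound_le0 (x r M : R) : 0 <= r < 1 ->
  (forall n, x <= r ^+ n * M) -> x <= 0.
Proof.
move=> /andP[r0 r1] xM.
have cv : r ^+ n * M @[n --> \oo] --> 0 * M.
  by apply: cvgMl; apply: cvg_expr; rewrite ger0_norm.
rewrite mul0r in cv; rewrite -(cvg_lim _ cv)//; apply: limr_ge.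
  by apply/cvg_ex; exists 0.
by near=> n; exact: xM.
Unshelve. all: end_near. Qed.

End circle_integral.

(** * The Schwarz kernel *)

Section schwarz_kernel.
Variable R : realType.
Local Notation C := (R[i]^o).
Local Notation tint := (@tint R).
Implicit Types (z b x : C) (t : R).

Section kernel.
Variable z : C.
Hypothesis z1 : cmod z < 1.

Definition skernel t : C := (expi t + z) / (expi t - z).

Lemma expi_sub_neq0 t : expi t - z != 0.
Proof.
rewrite subr_eq0; apply: contraTneq z1 => <-.
by rewrite cmod_expi ltxx.
Qed.

Lemma ccontinuous_skernel : ccontinuous skernel.
Proof.
apply: ccontinuousM.
  by apply: ccontinuousD; [exact: ccontinuous_expi|exact: ccontinuous_cst].
apply: ccontinuousV expi_sub_neq0.
by apply: ccontinuousD; [exact: ccontinuous_expi|exact: ccontinuous_cst].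
Qed.

Lemma cmod_skernel t : cmod (skernel t) <= 2 / (1 - cmod z).
Proof.
have z1' : 0 < 1 - cmod z by rewrite subr_gt0.
rewrite /skernel cmodM cmodV; apply: ler_pM; rewrite ?cmod_ge0 ?invr_ge0 ?cmod_ge0//.
  by rewrite (le_trans (cmodD _ _))// cmod_expi; lra.
rewrite lef_pV2 ?posrE ?cmod_gt0 ?expi_sub_neq0// lerBlDr.
by rewrite -[leLHS](cmod_expi t) -[X in cmod X <= _](subrK z) cmodD.
Qed.

Lemma tint_expiJ n :
  tint (fun t => (expi t)^*%C ^+ n) = if n == 0%N then (2 * pi)%:C else 0.
Proof.
rewrite (_ : (fun _ => _) = (fun t => (expi t ^+ n)^*%C)); last first.
  by apply/funext => t; rewrite rmorphXn.
rewrite tintJ ?tint_expi; last by apply: ccontinuousX; exact: ccontinuous_expi.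
by case: ifP => _; rewrite ?conjc0 ?conjc_real.
Qed.

Let cexpiX n : ccontinuous (fun t => expi t ^+ n : C).
Proof. by apply: ccontinuousX; exact: ccontinuous_expi. Qed.

Let cexpiJ n : ccontinuous (fun t => (expi t)^*%C ^+ n : C).
Proof. by apply: ccontinuousX; apply: ccontinuousJ; exact: ccontinuous_expi. Qed.

(** With [e = expi t], the kernel [K] satisfies [K e^(-k) = z K e^(-k-1) + e^(-k) + z e^(-k-1)].
    Integration relates consecutive moments, and boundedness of [K] kills those of positive index.
    The same relation read upwards gives [tint_skernelX]. *)
Lemma tint_skernelJ n : tint (fun t => skernel t * (expi t)^*%C ^+ n) =
  if n == 0%N then (2 * pi)%:C else 0.
Proof.
pose J k := tint (fun t => skernel t * (expi t)^*%C ^+ k).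
have cJ k : ccontinuous (fun t => skernel t * (expi t)^*%C ^+ k).
  by apply: ccontinuousM => //; exact: ccontinuous_skernel.
have JS k : J k = z * J k.+1 + if k == 0%N then (2 * pi)%:C else 0.
  have <- : tint (fun t => (expi t)^*%C ^+ k + z * (expi t)^*%C ^+ k.+1) =
      if k == 0%N then (2 * pi)%:C else 0.
    rewrite tintD ?tintZ ?tint_expiJ ?mulr0 ?addr0//.
    by apply: ccontinuousM => //; exact: ccontinuous_cst.
  rewrite /J -tintZ// -tintD//; last 2 first.
  - by apply: ccontinuousM => //; exact: ccontinuous_cst.
  - apply: ccontinuousD => //.
    by apply: ccontinuousM => //; exact: ccontinuous_cst.
  apply: eq_tint => t; rewrite /skernel expi_conj !exprS.
  have e0 := expi_neq0 t; have ez := expi_sub_neq0 t.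
  by move: (_ ^-1 ^+ k) => u; field; rewrite e0.
have J1 k : J k.+1 = 0.
  apply/eqP; rewrite -cmod_eq0 eq_le cmod_ge0 andbT.
  apply: (@geometric_bound_le0 _ _ (cmod z) (4 * pi * (2 / (1 - cmod z)))).
    by rewrite cmod_ge0.
  move=> n'; have -> : J k.+1 = z ^+ n' * J (n' + k).+1.
    elim: n' => [|m IH]; first by rewrite mul1r.
    by rewrite IH JS addr0 exprSr mulrA.
  rewrite cmodM cmodX ler_wpM2l ?exprn_ge0 ?cmod_ge0// tint_bound// => t _.
  by rewrite cmodM cmodX cmod_conj cmod_expi expr1n mulr1 cmod_skernel.
by case: n => [|n]; [rewrite -/(J 0%N) JS J1 mulr0 add0r|exact: J1].
Qed.

Lemma tint_skernelX n : tint (fun t => skernel t * expi t ^+ n) =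
  if n == 0%N then (2 * pi)%:C else (4 * pi)%:C * z ^+ n.
Proof.
have cI k : ccontinuous (fun t => skernel t * expi t ^+ k).
  by apply: ccontinuousM => //; exact: ccontinuous_skernel.
have I0 : tint (fun t => skernel t * expi t ^+ 0) = (2 * pi)%:C.
  rewrite -[RHS](tint_skernelJ 0); apply: eq_tint => t; by rewrite !expr0.
have IS k : tint (fun t => skernel t * expi t ^+ k.+1) =
    z * tint (fun t => skernel t * expi t ^+ k) +
    if k == 0%N then z * (2 * pi)%:C else 0.
  have <- : tint (fun t => expi t ^+ k.+1 + z * expi t ^+ k) =
      if k == 0%N then z * (2 * pi)%:C else 0.
    rewrite tintD ?tintZ ?tint_expi ?add0r//.
      by case: ifP => // _; rewrite mulr0.
    by apply: ccontinuousM => //; exact: ccontinuous_cst.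
  rewrite -tintZ// -tintD//; last 2 first.
  - by apply: ccontinuousM => //; exact: ccontinuous_cst.
  - apply: ccontinuousD => //.
    by apply: ccontinuousM => //; exact: ccontinuous_cst.
  apply: eq_tint => t; rewrite /skernel !exprS.
  have ez := expi_sub_neq0 t.
  by move: (_ ^+ k) => u; field.
elim: n => [|n IH]; first by rewrite I0.
rewrite IS IH; case: n {IH} => [|n] /=.
  have -> : (4 * pi)%:C = 2%:R * (2 * pi)%:C :> C.
    by rewrite -(rmorph_nat (real_complex R)) -rmorphM; congr _%:C; ring.
  by ring.
by rewrite addr0 [in RHS]exprS mulrCA.
Qed.

End kernel.

Lemma one_sub_neq0 b t : cmod b < 1 -> 1 - b * expi t != 0.
Proof.
move=> b1; rewrite subr_eq0 eq_sym; apply: contraTneq b1 => be1.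
have -> : cmod b = 1; last by rewrite ltxx.
by rewrite -[LHS]mulr1 -[X in _ * X](cmod_expi t) -cmodM be1 cmod1.
Qed.

Lemma ccontinuous_one_sub b : ccontinuous (fun t => 1 - b * expi t).
Proof.
under eq_fun do rewrite -mulNr.
apply: ccontinuousD; first exact: ccontinuous_cst.
by apply: ccontinuousM; [exact: ccontinuous_cst|exact: ccontinuous_expi].
Qed.

(* The mean value property of [e^k / prod (1 - b e)], by induction on the
   number of factors: [1 / ((1 - b e) q) = 1 / q + b e / ((1 - b e) q)]. *)
Lemma tint_inv_prod (s : seq C) k : all (fun b => cmod b < 1) s ->
  tint (fun t => expi t ^+ k * (\prod_(b <- s) (1 - b * expi t))^-1) =
  if k == 0%N then (2 * pi)%:C else 0.
Proof.
have cp (r : seq C) : all (fun b => cmod b < 1) r -> forall j,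
    ccontinuous (fun t => expi t ^+ j * (\prod_(b <- r) (1 - b * expi t))^-1).
  move=> r1 j; apply: ccontinuousM.
    by apply: ccontinuousX; exact: ccontinuous_expi.
  apply: ccontinuousV.
    elim: r {r1} => [|b r IH].
      by under eq_fun do rewrite big_nil; exact: ccontinuous_cst.
    under eq_fun do rewrite big_cons; apply: ccontinuousM => //.
    exact: ccontinuous_one_sub.
  move=> t; elim: r r1 => [|b r IH]; first by rewrite big_nil oner_neq0.
  move=> /= /andP[b1 r1]; rewrite big_cons mulf_neq0 ?IH//.
  exact: one_sub_neq0.
elim: s k => [|b s IH] k.
  move=> _; rewrite -tint_expi; apply: eq_tint => t.
  by rewrite big_nil invr1 mulr1.
move=> /[dup] bs /= /andP[b1 s1].
pose J j := tint (fun t => expi t ^+ j * (\prod_(c <- b :: s) (1 - c * expi t))^-1).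
have JS j : J j = b * J j.+1 + if j == 0%N then (2 * pi)%:C else 0.
  have c1 : ccontinuous (fun t => b *
      (expi t ^+ j.+1 * (\prod_(c <- b :: s) (1 - c * expi t))^-1)).
    by apply: ccontinuousM; [exact: ccontinuous_cst|exact: cp].
  rewrite -(IH j s1) /J -(tintZ _ (cp _ bs _)) -(tintD c1 (cp _ s1 _)).
  apply: eq_tint => t; rewrite big_cons invfM exprS.
  have := one_sub_neq0 t b1.
  set q := (\prod_(c <- s) (1 - c * expi t))^-1.
  by move: q (expi t ^+ j) (expi t) => q u e e0; field.
have J1 j : J j.+1 = 0.
  have [_ _ [M JM]] := ccontinuous_cbounded (cp _ bs 0%N).
  apply/eqP; rewrite -cmod_eq0 eq_le cmod_ge0 andbT.
  apply: (@geometric_bound_le0 _ _ (cmod b) (4 * pi * M)).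
    by rewrite cmod_ge0.
  move=> n; have -> : J j.+1 = b ^+ n * J (n + j).+1.
    elim: n => [|m IHm]; first by rewrite mul1r.
    by rewrite IHm JS addr0 exprSr mulrA.
  rewrite cmodM cmodX ler_wpM2l ?exprn_ge0 ?cmod_ge0//.
  apply: tint_bound => [|t pt]; first exact: cp.
  have := JM _ pt; rewrite !cmodM !cmodX cmod_expi !expr1n//.
by case: k => [|k]; [rewrite -/(J 0%N) JS J1 mulr0 add0r|exact: J1].
Qed.

(** A primitive of [sum c_k X^k]. As a real polynomial in the radial parameter, it makes both
    components of [log_series n (t x)] differentiable in [t]. *)
Definition log_poly (c : nat -> R) n : {poly R} :=
  \sum_(k < n) (c k / k.+1%:R) *: 'X^(k.+1).

Lemma deriv_log_poly c n : (log_poly c n)^`() = \sum_(k < n) c k *: 'X^k.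
Proof.
rewrite /log_poly raddf_sum/=; apply: eq_bigr => k _.
by rewrite derivZ derivXn -scalerMnr scalerMnl -mulr_natr divfK// pnatr_eq0.
Qed.

(** Partial sums of [- log (1 - x)]; only their exponentials are compared with [1 - x], so no branch
    of the complex logarithm is chosen. *)
Definition log_series n x : C := \sum_(k < n) x ^+ k.+1 / k.+1%:R.

Lemma one_sub_mul_components (t u : R) (x s w : C) :
  (1 - t%:C * x) * s = x - w * u%:C ->
  (1 - t * complex.Re x) * complex.Re s + t * complex.Im x * complex.Im s
    = complex.Re x - u * complex.Re w /\
  (1 - t * complex.Re x) * complex.Im s - t * complex.Im x * complex.Re s
    = complex.Im x - u * complex.Im w.
Proof.
case: x s w => [x1 x2] [s1 s2] [w1 w2] [] /= H1 H2; split; lra.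
Qed.

(* The derivative of [(1 - t x) exp (log_series n (t x))] in the real variable
   [t] is [- x (t x)^n exp (log_series n (t x))]. *)
Lemma exp_log_series n x (r : R) : cmod x <= r -> r < 1 ->
  cmod ((1 - x) * cexp (log_series n x) - 1)
    <= 4 * r ^+ n * expR (1 - r)^-1.
Proof.
move=> xr r1; have r0 : 0 <= r := le_trans (cmod_ge0 _) xr.
pose pa := log_poly (fun k => complex.Re (x ^+ k.+1)) n.
pose pb := log_poly (fun k => complex.Im (x ^+ k.+1)) n.
pose a t := pa.[t]; pose b t := pb.[t].
have aE : a 1 = complex.Re (log_series n x).
  rewrite /a /pa /log_poly horner_sum /log_series.
  rewrite Re_sum; apply: eq_bigr => k _.
  rewrite hornerZ hornerXn expr1n mulr1 -(rmorph_nat (real_complex R)).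
  by rewrite -fmorphV ReM /= mulr0 subr0.
have bE : b 1 = complex.Im (log_series n x).
  rewrite /b /pb /log_poly horner_sum /log_series.
  rewrite Im_sum; apply: eq_bigr => k _.
  rewrite hornerZ hornerXn expr1n mulr1 -(rmorph_nat (real_complex R)).
  by rewrite -fmorphV ImM /= mulr0 add0r.
pose s t : C := \sum_(k < n) x ^+ k.+1 * t%:C ^+ k.
have sE t : (1 - t%:C * x) * s t = x - x ^+ n.+1 * t%:C ^+ n.
  rewrite -[X in 1 - X]mulrC /s; elim: (n) => [|k IH].
    by rewrite big_ord0 mulr0 expr0 expr1 mulr1 subrr.
  by rewrite big_ord_recr/= mulrDr IH !exprS; ring.
have da t : is_derive t (1 : R) a (complex.Re (s t)).
  rewrite (_ : complex.Re _ = pa^`().[t]); first exact: is_derive_poly.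
  rewrite deriv_log_poly horner_sum /s Re_sum.
  apply: eq_bigr => k _; rewrite hornerZ hornerXn -rmorphXn ReM/=.
  by rewrite mulr0 subr0.
have db t : is_derive t (1 : R) b (complex.Im (s t)).
  rewrite (_ : complex.Im _ = pb^`().[t]); first exact: is_derive_poly.
  rewrite deriv_log_poly horner_sum /s Im_sum.
  apply: eq_bigr => k _; rewrite hornerZ hornerXn -rmorphXn ImM/=.
  by rewrite mulr0 add0r.
pose x1 := complex.Re x; pose x2 := complex.Im x.
pose y1 := complex.Re (x ^+ n.+1); pose y2 := complex.Im (x ^+ n.+1).
pose A t := expR (a t) * cos (b t); pose B t := expR (a t) * sin (b t).
(* [U] and [V] are the real and imaginary parts of [(1 - t x) exp (log_series n (t x))]. *)
pose U t := (1 - t * x1) * A t + t * x2 * B t.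
pose V t := (1 - t * x1) * B t - t * x2 * A t.
have sE' t : (1 - t%:C * x) * s t = x - x ^+ n.+1 * (t ^+ n)%:C.
  by rewrite sE rmorphXn.
have sRI t := one_sub_mul_components (sE' t).
have dU t : is_derive t (1 : R) U (t ^+ n * (y2 * B t - y1 * A t)).
  apply: is_derive_eq; rewrite /GRing.scale/=.
  have [H1 H2] := sRI t; rewrite /A /B -/x1.
  have h1 : t ^+ n * y1 = x1 - ((1 - t * x1) * complex.Re (s t) + t * x2 * complex.Im (s t)).
    by rewrite H1 opprB addrC subrK.
  have h2 : t ^+ n * y2 = x2 - ((1 - t * x1) * complex.Im (s t) - t * x2 * complex.Re (s t)).
    by rewrite H2 opprB addrC subrK.
  by rewrite [RHS]mulrBr ![t ^+ n * (_ * _)]mulrA h1 h2; ring.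
have dV t : is_derive t (1 : R) V (- (t ^+ n * (y1 * B t + y2 * A t))).
  apply: is_derive_eq; rewrite /GRing.scale/=.
  have [H1 H2] := sRI t; rewrite /A /B -/x1.
  have h1 : t ^+ n * y1 = x1 - ((1 - t * x1) * complex.Re (s t) + t * x2 * complex.Im (s t)).
    by rewrite H1 opprB addrC subrK.
  have h2 : t ^+ n * y2 = x2 - ((1 - t * x1) * complex.Im (s t) - t * x2 * complex.Re (s t)).
    by rewrite H2 opprB addrC subrK.
  by rewrite [X in _ = - X]mulrDr ![t ^+ n * (_ * _)]mulrA h1 h2; ring.
have y1r : `|y1| <= r ^+ n /\ `|y2| <= r ^+ n.
  have xn : cmod (x ^+ n.+1) <= r ^+ n.
    rewrite cmodX exprSr -[leRHS]mulr1 ler_pM ?exprn_ge0 ?cmod_ge0//.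
      by rewrite lerXn2r ?nnegrE ?cmod_ge0.
    by rewrite (le_trans xr)// ltW.
  by split; apply: le_trans xn; [exact: ler_Re_cmod|exact: ler_Im_cmod].
have r1' : 0 < 1 - r by rewrite subr_gt0.
have aB t : 0 <= t <= 1 -> a t <= (1 - r)^-1.
  move=> /andP[t0 t1]; rewrite /a /pa /log_poly horner_sum.
  have geo : (\sum_(k < n) r ^+ k) <= (1 - r)^-1.
    rewrite -(ler_pM2l r1') mulfV ?gt_eqF// -[1 - r]opprB mulNr -subrX1 opprB.
    by rewrite lerBlDr lerDl exprn_ge0.
  apply: le_trans geo; apply: ler_sum => k _; rewrite hornerZ hornerXn.
  apply: (le_trans (ler_norm _)); rewrite !normrM -[leRHS]mulr1.
  apply: ler_pM => //.
    rewrite -[leRHS]mulr1; apply: ler_pM => //.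
      apply: (le_trans (ler_Re_cmod _)); rewrite cmodX exprSr -[leRHS]mulr1.
      rewrite ler_pM ?exprn_ge0 ?cmod_ge0//.
        by rewrite lerXn2r ?nnegrE ?cmod_ge0.
      by rewrite (le_trans xr)// ltW.
    by rewrite ger0_norm ?invr_ge0// invf_le1// ler1n.
  by rewrite ger0_norm ?exprn_ge0// exprn_ile1.
have a0 : a 0 = 0 /\ b 0 = 0.
  split; rewrite /a /b /pa /pb /log_poly horner_sum big1// => k _;
  by rewrite hornerZ hornerXn expr0n mulr0.
have AB t : 0 <= t <= 1 -> `|A t| <= expR (1 - r)^-1 /\ `|B t| <= expR (1 - r)^-1.
  move=> t01; have ea : expR (a t) <= expR (1 - r)^-1 by rewrite ler_expR aB.
  have e0 := expR_ge0 (a t).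
  split; rewrite normrM (ger0_norm e0) (le_trans _ ea)// ler_piMr//.
    by rewrite ler_norml cos_le1 cos_geN1.
  by rewrite ler_norml sin_le1 sin_geN1.
(* The mean value theorem is applied to [U] and [V] separately, at two different points; each
   contributes [2 r^n exp (1/(1-r))], whence the constant 4. *)
have mvt (f df : R -> R) : (forall t, is_derive t (1 : R) f (df t)) ->
    exists2 t, 0 <= t <= 1 & f 1 - f 0 = df t.
  move=> dff; have cf : continuous f.
    move=> t; apply: differentiable_continuous.
    by apply/derivable1_diffP; exact: ex_derive.
  have [|t t01 ->] := @MVT_segment R f df 0 1 ler01 (fun t _ => dff t).
    exact: continuous_subspaceT.
  by exists t => //; rewrite subr0 mulr1.
have bnd t (p q u v e : R) : 0 <= t <= 1 -> `|p| <= r ^+ n -> `|q| <= r ^+ n ->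
    `|u| <= e -> `|v| <= e -> `|t ^+ n * (p * u + q * v)| <= 2 * r ^+ n * e.
  move=> /andP[t0 t1] pr qr ue ve; rewrite normrM -[leRHS]mul1r.
  apply: ler_pM => //; first by rewrite ger0_norm ?exprn_ge0// exprn_ile1.
  rewrite -mulrA mulr_natl mulr2n; apply: (le_trans (ler_normD _ _)).
  by rewrite !normrM; apply: lerD; apply: ler_pM.
have [t tI HU] := mvt _ _ dU; have [t' tI' HV] := mvt _ _ dV.
have [y1n y2n] := y1r; have [At Bt] := AB _ tI; have [At' Bt'] := AB _ tI'.
have -> : (1 - x) * cexp (log_series n x) = U 1 +i* V 1.
  rewrite /cexp /U /V /A /B aE bE /expi /x1 /x2 !mul1r.
  case: x {xr sE sE' sRI da db aE bE x1 x2 y1 y2 A B U V s dU dV pa pb a b aB AB a0 HU HV At Bt At' Bt' y1r y1n y2n} => u1 u2 /=.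
  congr (_ +i* _) => /=; ring.
have -> : U 1 +i* V 1 - 1 = (U 1 - U 0) +i* (V 1 - V 0) :> C.
  rewrite /U /V !mul0r !subr0 !mul1r !addr0 /A /B.
  by have [-> ->] := a0; rewrite expR0 cos0 sin0 !mul1r; congr (_ +i* _).
apply: (le_trans (cmod_le_ReIm _)) => /=; rewrite HU HV normrN.
have := bnd _ _ _ _ _ _ tI y2n (_ : `|- y1| <= _) Bt At.
rewrite normrN mulNr => /(_ y1n).
have := bnd _ _ _ _ _ _ tI' y1n y2n Bt' At'.
lra.
Qed.

End schwarz_kernel.

(** * Componentwise limits of complex sequences *)

Section complex_sequences.
Variable R : realType.
Local Notation C := (R[i]^o).
Implicit Types (u v : nat -> C) (l x y : C).

Lemma cmod_dist x y : `|cmod x - cmod y| <= cmod (x - y).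
Proof.
have := cmodD (x - y) y; have := cmodD (y - x) x; rewrite !subrK cmod_distC.
by rewrite ler_norml => H1 H2; apply/andP; split; lra.
Qed.

Definition ccvg u l := complex.Re (u n) @[n --> \oo] --> complex.Re l /\
  complex.Im (u n) @[n --> \oo] --> complex.Im l.

Lemma ReN x : complex.Re (- x) = - complex.Re x.
Proof. by case: x. Qed.

Lemma ImN x : complex.Im (- x) = - complex.Im x.
Proof. by case: x. Qed.

Lemma ccvg_cst l : ccvg (fun=> l) l.
Proof. by split; exact: cvg_cst. Qed.

Lemma ccvgD u v l x : ccvg u l -> ccvg v x -> ccvg (fun n => u n + v n) (l + x).
Proof.
move=> [uR uI] [vR vI]; split.
  by under eq_fun do rewrite ReD; rewrite ReD; exact: cvgD.
by under eq_fun do rewrite ImD; rewrite ImD; exact: cvgD.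
Qed.

Lemma ccvgM u v l x : ccvg u l -> ccvg v x -> ccvg (fun n => u n * v n) (l * x).
Proof.
move=> [uR uI] [vR vI]; split.
  by under eq_fun do rewrite ReM; rewrite ReM; apply: cvgB; exact: cvgM.
by under eq_fun do rewrite ImM; rewrite ImM; apply: cvgD; exact: cvgM.
Qed.

Lemma ccvg_unique u l x : ccvg u l -> ccvg u x -> l = x.
Proof.
move=> [uR uI] [vR vI]; apply/eqP; rewrite eq_complex.
by rewrite (cvg_unique _ uR vR)// (cvg_unique _ uI vI)// !eqxx.
Qed.

Lemma ccvg_real (h : nat -> R) (r : R) : h n @[n --> \oo] --> r ->
  ccvg (fun n => (h n)%:C) r%:C.
Proof. by move=> hr; split => //=; exact: cvg_cst. Qed.

Lemma ccvg_squeeze u l (h : nat -> R) : h n @[n --> \oo] --> (0 : R) ->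
  (\forall n \near \oo, cmod (u n - l) <= h n) -> ccvg u l.
Proof.
move=> h0 uh.
have sq (f : nat -> R) (r : R) : (\forall n \near \oo, `|f n - r| <= h n) ->
    f n @[n --> \oo] --> r.
  move=> fh; apply/cvgrPdist_lt => e e0.
  move/cvgrPdist_lt : (h0) => /(_ _ e0); apply: filter_app2 fh; near=> n.
  move=> fr; rewrite sub0r normrN => he; rewrite distrC (le_lt_trans fr)//.
  by rewrite (le_lt_trans (ler_norm _)).
split; apply: sq; apply: filterS uh => n; apply: le_trans.
  by rewrite -ReN -ReD ler_Re_cmod.
by rewrite -ImN -ImD ler_Im_cmod.
Unshelve. all: end_near. Qed.

Lemma ccvg_cmod u l : ccvg u l -> cmod (u n) @[n --> \oo] --> cmod l.
Proof.
move=> [uR uI]; under eq_fun do rewrite cmodE !expr2; rewrite cmodE !expr2.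
apply: continuous_cvg; first exact: sqrt_continuous.
by apply: cvgD; apply: cvgM.
Qed.

Lemma ccvgV u l : ccvg u l -> l != 0 -> ccvg (fun n => (u n)^-1) l^-1.
Proof.
move=> ul l0; have l0' : cmod l * cmod l != 0 by rewrite mulf_neq0 ?cmod_eq0.
have H : ccvg (fun n => ((cmod (u n) * cmod (u n))^-1)%:C) ((cmod l * cmod l)^-1)%:C.
  apply: ccvg_real; apply: cvgV => //; apply: cvgM; exact: ccvg_cmod.
have HJ : ccvg (fun n => (u n)^*%C) l^*%C.
  case: ul => uR uI; split; first by under eq_fun do rewrite ReJ; rewrite ReJ.
  by under eq_fun do rewrite ImJ; rewrite ImJ; exact: cvgN.
have := ccvgM H HJ; rewrite -expr2 -invcE.
by under eq_fun do rewrite -expr2 -invcE.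
Qed.

Lemma ccvg_shift u l : ccvg u l -> ccvg (fun n => u n.+1) l.
Proof.
by move=> [uR uI]; split; [rewrite (cvg_shiftS (fun n => complex.Re (u n)))|rewrite (cvg_shiftS (fun n => complex.Im (u n)))].
Qed.

Lemma cexpD x y : cexp (x + y) = cexp x * cexp y.
Proof.
rewrite /cexp ReD ImD expRD expiD rmorphM.
by rewrite !mulrA; congr (_ * _); rewrite mulrAC.
Qed.

Lemma cexp0 : cexp 0 = 1 :> C.
Proof. by rewrite /cexp /= expR0 expi0 mulr1. Qed.

Lemma cexp_real (r : R) : cexp r%:C = (expR r)%:C.
Proof. by rewrite /cexp /= expi0 mulr1. Qed.

Lemma cmod_cexp x : cmod (cexp x) = expR (complex.Re x).
Proof. by rewrite /cexp cmodM cmodR cmod_expi mulr1 ger0_norm// expR_ge0. Qed.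

Lemma ccvg_cexp u l : ccvg u l -> ccvg (fun n => cexp (u n)) (cexp l).
Proof.
move=> [uR uI]; apply: ccvgM.
  by apply: ccvg_real; apply: continuous_cvg => //; exact: continuous_expR.
split => /=; apply: continuous_cvg => //; [exact: continuous_cos|exact: continuous_sin].
Qed.

End complex_sequences.

(** * The Schwarz integral of the logarithm of a modulus *)

Section schwarz_formula.
Variable R : realType.
Local Notation C := (R[i]^o).
Local Notation tint := (@tint R).
Implicit Types (z b x : C) (t : R).

Lemma ln_dist (y e : R) : `|y - 1| <= e -> e <= 2^-1 -> `|ln y| <= 2 * e.
Proof.
move=> ye e2; have [y1 y2] : 1 - e <= y /\ y <= 1 + e.
  by move: ye; rewrite ler_distl => /andP[].
have y0 : 0 < y by lra.
have lny : ln y <= y - 1.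
  have -> : y = 1 + (y - 1) by ring.
  by rewrite (le_trans (le_ln1Dx _))//; lra.
have lnVy : - ln y <= y^-1 - 1.
  rewrite -lnV ?posrE//; have -> : y^-1 = 1 + (y^-1 - 1) by ring.
  rewrite (le_trans (le_ln1Dx _))//; last by lra.
  by have : 0 < y^-1 by [rewrite invr_gt0]; lra.
have yV : y^-1 - 1 <= 2 * e.
  have : y^-1 <= 1 + 2 * e.
    by rewrite -[leLHS]mul1r ler_pdivrMr//; nra.
  lra.
by rewrite ler_norml; apply/andP; split; lra.
Qed.

Lemma log_series_ln n x (r : R) : cmod x <= r -> r < 1 ->
  4 * r ^+ n * expR (1 - r)^-1 <= 2^-1 ->
  `|ln (cmod (1 - x)) + complex.Re (log_series n x)|
    <= 2 * (4 * r ^+ n * expR (1 - r)^-1).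
Proof.
move=> xr r1 e2; have H := exp_log_series n xr r1.
have x1 : 0 < cmod (1 - x).
  rewrite cmod_gt0 subr_eq0; apply: contraTneq r1 => x1.
  by rewrite -leNgt -[leLHS]cmod1 x1.
rewrite -[complex.Re (log_series n x)]expRK -lnM ?posrE ?expR_gt0//.
rewrite -cmod_cexp -cmodM; apply: ln_dist => //; apply: le_trans H.
by rewrite -[X in `|_ - X|]cmod1 cmod_dist.
Qed.

Lemma ccvg_exp_log_series x : cmod x < 1 ->
  ccvg (fun n => (1 - x) * cexp (log_series n x)) 1.
Proof.
move=> x1; apply: (@ccvg_squeeze _ _ _
  (fun n => cmod x ^+ n * (4 * expR (1 - cmod x)^-1))).
  rewrite -[X in _ --> X](mul0r (4 * expR (1 - cmod x)^-1)).
  by apply: cvgMl; apply: cvg_expr; rewrite ger0_norm ?cmod_ge0.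
near=> n; rewrite mulrA [_ * 4]mulrC.
exact: exp_log_series.
Unshelve. all: end_near. Qed.

(** Normalised as in the Szego function: for the zero-free functions used here, [2 ln |f|] on the
    circle yields a logarithm of [f] in the disk, and constants are halved. *)
Definition schwarz z (h : R -> R) : C :=
  ((4 * pi)^-1)%:C * tint (fun t => skernel z t * (h t)%:C).

Lemma schwarzD z h k : cmod z < 1 -> continuous h -> continuous k ->
  schwarz z (fun t => h t + k t) = schwarz z h + schwarz z k.
Proof.
move=> z1 ch ck; rewrite /schwarz -mulrDr -tintD; first last.
- by apply: ccontinuousM; [exact: ccontinuous_skernel|exact: ccontinuous_real].
- by apply: ccontinuousM; [exact: ccontinuous_skernel|exact: ccontinuous_real].
by congr (_ * _); apply: eq_tint => t; rewrite rmorphD mulrDr.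
Qed.

Lemma pi4_neq0 : 4 * pi != 0 :> R.
Proof. by rewrite mulf_neq0// gt_eqF// pi_gt0. Qed.

Lemma schwarz_cst z (r : R) : cmod z < 1 -> schwarz z (fun=> r) = (r / 2)%:C.
Proof.
move=> z1; rewrite /schwarz.
have -> : tint (fun t => skernel z t * r%:C) = r%:C * (2 * pi)%:C.
  have := tint_skernelX z1 0; rewrite eqxx => <-.
  rewrite -tintZ; last first.
    apply: ccontinuousM; first exact: ccontinuous_skernel.
    by under eq_fun do rewrite expr0; exact: ccontinuous_cst.
  by apply: eq_tint => t; rewrite expr0 mulr1 mulrC.
rewrite -!rmorphM; congr _%:C.
have pi0 : pi != 0 :> R by rewrite gt_eqF// pi_gt0.
by move: pi pi0 => p p0; field.
Qed.

Lemma schwarz_dist z h k (e : R) : cmod z < 1 -> continuous h -> continuous k ->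
  (forall t, `|h t - k t| <= e) ->
  cmod (schwarz z h - schwarz z k) <= 2 / (1 - cmod z) * e.
Proof.
move=> z1 ch ck hke; rewrite /schwarz -mulrBr -tintB; first last.
- by apply: ccontinuousM; [exact: ccontinuous_skernel|exact: ccontinuous_real].
- by apply: ccontinuousM; [exact: ccontinuous_skernel|exact: ccontinuous_real].
rewrite cmodM cmodR ger0_norm ?invr_ge0 ?mulr_ge0 ?pi_ge0//.
rewrite ler_pdivrMl ?mulr_gt0 ?pi_gt0//; apply: tint_bound.
  under eq_fun do rewrite -mulrBr -rmorphB; apply: ccontinuousM.
    exact: ccontinuous_skernel.
  by apply: ccontinuous_real => t; apply: cvgB; [exact: ch|exact: ck].
move=> t _; rewrite -mulrBr -rmorphB cmodM cmodR.
by apply: ler_pM => //; rewrite ?cmod_ge0// cmod_skernel.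
Qed.

(** Twice the real part is the sum plus its conjugate; the kernel annihilates negative frequencies
    and reproduces positive ones. *)
Lemma schwarz_Re_log_series z b n : cmod z < 1 ->
  schwarz z (fun t => 2 * complex.Re (log_series n (b * expi t)))
  = log_series n (b * z).
Proof.
move=> z1; rewrite /schwarz.
have cE k : ccontinuous (fun t => skernel z t * expi t ^+ k).
  apply: ccontinuousM; first exact: ccontinuous_skernel.
  by apply: ccontinuousX; exact: ccontinuous_expi.
have cJ k : ccontinuous (fun t => skernel z t * (expi t)^*%C ^+ k).
  apply: ccontinuousM; first exact: ccontinuous_skernel.
  by apply: ccontinuousX; apply: ccontinuousJ; exact: ccontinuous_expi.
pose c k : C := b ^+ k.+1 / k.+1%:R.
have E t : skernel z t * (2 * complex.Re (log_series n (b * expi t)))%:C =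
    \sum_(k < n) (c k * (skernel z t * expi t ^+ k.+1) +
      (c k)^*%C * (skernel z t * (expi t)^*%C ^+ k.+1)).
  rewrite rmorphM rmorph_nat -addcJ mulrDr big_split/= /log_series.
  rewrite rmorph_sum !mulr_sumr; congr (_ + _); apply: eq_bigr => k _.
    by rewrite exprMn /c; set u := b ^+ _; set v := expi t ^+ _; set w := _^-1; ring.
  rewrite /c exprMn !rmorphM !rmorphXn/=.
  by set u := _^*%C ^+ _; set v := _^*%C ^+ _; set w := _^*%C; ring.
have cS k : ccontinuous (fun t => c k * (skernel z t * expi t ^+ k.+1) +
      (c k)^*%C * (skernel z t * (expi t)^*%C ^+ k.+1)).
  by apply: ccontinuousD; apply: ccontinuousM => //; exact: ccontinuous_cst.
rewrite (eq_tint E) /tint.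
have [_ ->] := cintegral_sum (@measurable_period R) (@lebesgue_period_lty R)
  (index_enum 'I_n) (fun k : 'I_n => ccontinuous_integrable (cS k)).
rewrite mulr_sumr; apply: eq_bigr => k _.
rewrite -/(tint _) tintD; [|apply: ccontinuousM => //; exact: ccontinuous_cst..].
rewrite !tintZ// tint_skernelX// tint_skernelJ//= mulr0 addr0.
have E4 : ((4 * pi)^-1)%:C * (4 * pi)%:C = 1 :> C.
  by rewrite -rmorphM mulVf ?pi4_neq0// rmorph1.
rewrite mulrCA [X in c k * X]mulrA E4 mul1r /c exprMn.
by rewrite mulrAC.
Qed.

Lemma geometric_cvg0 (r M : R) : 0 <= r -> r < 1 ->
  r ^+ n * M @[n --> \oo] --> (0 : R).
Proof.
move=> r0 r1; rewrite -[X in _ --> X](mul0r M).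
by apply: cvgMl; apply: cvg_expr; rewrite ger0_norm.
Qed.

Lemma continuous_ln_cmod (f : R -> C) : ccontinuous f -> (forall t, f t != 0) ->
  continuous (fun t => ln (cmod (f t))).
Proof.
move=> cf f0 t; apply: continuous_comp; first exact: continuous_cmod.
by apply: continuous_ln; rewrite cmod_gt0.
Qed.

(** Since [|b| < 1], the function [- Re log_series n (b e)] approaches [ln |1 - b e|] uniformly on
    the circle, so the Schwarz integral is the limit of [- log_series n (b z)]. Exponentiation
    identifies its exponential with [1 - b z]. *)
Lemma schwarz_one_sub z b : cmod z < 1 -> cmod b < 1 ->
  cexp (schwarz z (fun t => 2 * ln (cmod (1 - b * expi t)))) = 1 - b * z.
Proof.
move=> z1 b1; set G := schwarz z _.
have bz1 : cmod (b * z) < 1.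
  rewrite cmodM (le_lt_trans _ b1)// ler_piMr ?cmod_ge0//; exact: ltW.
pose e n := 4 * cmod b ^+ n * expR (1 - cmod b)^-1.
have e0 : e n @[n --> \oo] --> (0 : R).
  under eq_fun do rewrite /e mulrAC mulrC.
  by apply: geometric_cvg0; rewrite ?cmod_ge0.
have GLS : ccvg (fun n => G + log_series n (b * z)) 0.
  apply: (@ccvg_squeeze _ _ _ (fun n => 2 / (1 - cmod z) * (4 * e n))).
    rewrite -[X in _ --> X](mulr0 (2 / (1 - cmod z))).
    apply: cvgMr; rewrite -[X in _ --> X](mulr0 4); exact: cvgMr.
  have h0 : 0 < 2^-1 :> R by rewrite invr_gt0.
  move/cvgrPdist_le : e0 => /(_ _ h0).
  apply: filterS => n; rewrite sub0r normrN => en.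
  have {}en : e n <= 2^-1 by rewrite (le_trans (ler_norm _)).
  rewrite subr0 -(schwarz_Re_log_series b n z1).
  have cR : continuous (fun t => 2 * complex.Re (log_series n (b * expi t))).
    have [cR _] : ccontinuous (fun t => log_series n (b * expi t)).
      apply: ccontinuous_sum => k; apply: ccontinuousM; last exact: ccontinuous_cst.
      apply: ccontinuousX; apply: ccontinuousM; first exact: ccontinuous_cst.
      exact: ccontinuous_expi.
    by move=> t; apply: cvgMr; exact: cR.
  rewrite -[X in G + X]opprK; set S := schwarz z _.
  have -> : - S = schwarz z (fun t => - (2 * complex.Re (log_series n (b * expi t)))).
    rewrite /S /schwarz -mulrN -[X in _ * - X]mul1r -mulNr -tintZ; last first.
      apply: ccontinuousM; first exact: ccontinuous_skernel.
      exact: ccontinuous_real.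
    by congr (_ * _); apply: eq_tint => t; rewrite rmorphN mulrN mulN1r.
  apply: schwarz_dist => //.
  - move=> t; apply: cvgMr; apply: continuous_ln_cmod.
      exact: ccontinuous_one_sub.
    by move=> s; exact: one_sub_neq0.
  - by move=> t; apply: cvgN; exact: cR.
  - move=> t; rewrite opprK -mulrDr normrM ger0_norm//.
    have := @log_series_ln n (b * expi t) (cmod b); rewrite cmodM cmod_expi mulr1.
    move=> /(_ (lexx _) b1 en); rewrite -/(e n); lra.
have H1 := ccvg_cexp GLS; rewrite cexp0 in H1.
have H2 := ccvg_exp_log_series bz1.
have H3 : ccvg (fun n => (1 - b * z) * cexp (G + log_series n (b * z))) (1 - b * z).
  by rewrite -[X in ccvg _ X]mulr1; apply: ccvgM => //; exact: ccvg_cst.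
have H4 : ccvg (fun n => cexp G * ((1 - b * z) * cexp (log_series n (b * z)))) (cexp G).
  by rewrite -[X in ccvg _ X]mulr1; apply: ccvgM => //; exact: ccvg_cst.
apply: ccvg_unique H4 _; move: H3; congr (ccvg _ _); apply/funext => n.
by rewrite cexpD; ring.
Qed.

Lemma schwarz_prod z (s : seq C) : cmod z < 1 -> all (fun b => cmod b < 1) s ->
  cexp (schwarz z (fun t => 2 * ln (cmod (\prod_(b <- s) (1 - b * expi t)))))
  = \prod_(b <- s) (1 - b * z).
Proof.
move=> z1; elim: s => [|b s IH].
  move=> _; under eq_fun do rewrite big_nil cmod1 ln1 mulr0.
  by rewrite schwarz_cst// mul0r big_nil cexp0.
move=> /= /andP[b1 s1]; rewrite big_cons -IH// -(schwarz_one_sub z1 b1) -cexpD.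
have p0 t : \prod_(b <- s) (1 - b * expi t) != 0.
  elim: s s1 {IH} => [|c s IH]; first by rewrite big_nil oner_neq0.
  move=> /= /andP[c1 s1]; rewrite big_cons mulf_neq0 ?IH//.
  exact: one_sub_neq0.
have pc : ccontinuous (fun t => \prod_(b <- s) (1 - b * expi t)).
  elim: s {s1 IH p0} => [|c s IH].
    by under eq_fun do rewrite big_nil; exact: ccontinuous_cst.
  under eq_fun do rewrite big_cons; apply: ccontinuousM => //.
  exact: ccontinuous_one_sub.
rewrite -schwarzD//; first last.
- by move=> t; apply: cvgMr; exact: continuous_ln_cmod.
- move=> t; apply: cvgMr; apply: continuous_ln_cmod.
    exact: ccontinuous_one_sub.
  by move=> u; exact: one_sub_neq0.
congr (cexp (schwarz z _)); apply/funext => t; rewrite big_cons cmodM lnM ?mulrDr//.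
  by rewrite posrE cmod_gt0 one_sub_neq0.
by rewrite posrE cmod_gt0.
Qed.

End schwarz_formula.

(** * Bernstein-Szego weights *)

Section bernstein_szego.
Variable R : realType.
Local Notation C := (R[i]^o).
Local Notation tint := (@tint R).
Variable F : {poly C} -> {poly C} -> C.
Hypotheses (FT : toeplitz F) (Fpos : posdef F).
Local Notation P := (opoly F).
Local Notation Q := (opolyr F).
Local Notation N := (onorm2 F).
Implicit Types (z w b : C) (t : R) (n : nat).

Lemma opolyr_neq0 n z : cmod z <= 1 -> (Q n).[z] != 0.
Proof.
move=> z1; rewrite -cmod_gt0.
have rec := szego_rec_opoly FT Fpos z.
by have [] := szego_rec_le (verb_lt1 FT Fpos) rec z1 n.
Qed.

(** A zero [w] outside the open disk would be reflected to a zero [1/conj(w)] of [Q n] in the closed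
    disk. *)
Lemma root_opoly_lt1 n w : (P n).[w] = 0 -> cmod w < 1.
Proof.
move=> Pw; rewrite ltNge; apply/negP => w1.
have w0 : w != 0 by rewrite -cmod_gt0 (lt_le_trans _ w1).
have u0 : (w^*%C)^-1 != 0 by rewrite invr_eq0 conjc_eq0.
have u1 : cmod (w^*%C)^-1 <= 1.
  by rewrite cmodV cmod_conj invf_le1// (lt_le_trans _ w1).
have /eqP := opolyr_neq0 n u1; apply.
rewrite /opolyr (@reverse_polyE R n (P n) _ _ u0) ?size_opoly//.
by rewrite -[((w^*%C)^-1)^*%C]/(conjc _) rmorphV/= ?unitfE ?conjc_eq0// conjcK invrK Pw conjc0 mulr0.
Qed.

Lemma reverse_prod (s : seq C) :
  reverse_poly (size s) (\prod_(w <- s) ('X - w%:P)) =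
  \prod_(w <- s) (1 - w^*%C *: 'X).
Proof.
elim: s => [|w s IH]; first by rewrite !big_nil reverse0.
rewrite !big_cons mulrBl mul_polyC -scaleNr reverseD reverseZ reverseSX.
rewrite reverseS ?size_prod_XsubC// IH mulrBl mul1r rmorphN scaleNr.
by rewrite scalerAl.
Qed.

(** Reduces the mean value property of [1 / Q n] and the Schwarz formula for [ln |Q n|] to linear
    factors without zeros in the closed disk. *)
Lemma opolyr_factor n : exists2 s : seq C, all (fun b => cmod b < 1) s &
  forall z, (Q n).[z] = \prod_(b <- s) (1 - b * z).
Proof.
have [s sE] := @closed_field_poly_normal (R[i] : closedFieldType) (P n).
have {}sE : P n = \prod_(w <- s) ('X - w%:P).
  by rewrite sE (eqP (monic_opoly FT Fpos n)) scale1r.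
have ss : size s = n.
  by have := size_opoly FT Fpos n; rewrite sE size_prod_XsubC => -[].
exists [seq w^*%C | w <- s].
  rewrite all_map; apply/allP => w ws /=; rewrite cmod_conj.
  apply: (@root_opoly_lt1 n); apply/eqP; rewrite -/(root _ _) sE.
  by rewrite root_prod_XsubC.
move=> z; rewrite /opolyr sE -[X in reverse_poly X _]ss reverse_prod.
rewrite horner_prod big_map; apply: eq_bigr => w _.
by rewrite hornerD hornerN hornerZ hornerX hornerC.
Qed.

Definition bsw n t : R := N n / cmod (Q n).[expi t] ^+ 2.

Lemma ccontinuous_Q n : ccontinuous (fun t => (Q n).[expi t]).
Proof. by apply: ccontinuous_horner; exact: ccontinuous_expi. Qed.

Lemma Q_expi_neq0 n t : (Q n).[expi t] != 0.
Proof. by rewrite opolyr_neq0// cmod_expi. Qed.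

Lemma bsw_gt0 n t : 0 < bsw n t.
Proof.
by rewrite divr_gt0 ?onorm2_gt0// exprn_gt0// cmod_gt0 Q_expi_neq0.
Qed.

Lemma continuous_bsw n : continuous (bsw n).
Proof.
move=> t; apply: cvgM; first exact: cvg_cst.
apply: cvgV; last exact: continuous_cmod2 (@ccontinuous_Q n) t.
by rewrite expf_eq0/= cmod_eq0 Q_expi_neq0.
Qed.

Definition bsform n (p q : {poly C}) : C := ((2 * pi)^-1)%:C *
  tint (fun t => (p.[expi t])^*%C * q.[expi t] * (bsw n t)%:C).

Lemma ccontinuous_bsform n (p q : {poly C}) :
  ccontinuous (fun t => (p.[expi t])^*%C * q.[expi t] * (bsw n t)%:C).
Proof.
apply: ccontinuousM; last by apply: ccontinuous_real; exact: continuous_bsw.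
apply: ccontinuousM; last by apply: ccontinuous_horner; exact: ccontinuous_expi.
by apply: ccontinuousJ; apply: ccontinuous_horner; exact: ccontinuous_expi.
Qed.

Lemma toeplitz_bsform n : toeplitz (bsform n).
Proof.
split.
- move=> p a q r; rewrite /bsform [a * _]mulrCA -mulrDr.
  have c1 := ccontinuousM (ccontinuous_cst a) (ccontinuous_bsform n p q).
  rewrite -(tintZ a (ccontinuous_bsform n p q)) -(tintD c1 (ccontinuous_bsform n p r)).
  by congr (_ * _); apply: eq_tint => t; rewrite hornerD hornerZ; ring.
- move=> p q; rewrite /bsform rmorphM /= conjc_real; congr (_ * _).
  rewrite -[RHS](tintJ (ccontinuous_bsform n p q)); apply: eq_tint => t.
  by rewrite [RHS]rmorphM [X in _ = X * _]rmorphM /= conjcK conjc_real [p.[_] * _]mulrC.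
- move=> p q; congr (_ * _); apply: eq_tint => t.
  rewrite !hornerM !hornerX rmorphM; congr (_ * _).
  have e1 : (expi t)^*%C * expi t = 1 :> C by rewrite mulrC mul_conjc cmod_expi expr1n.
  by rewrite mulrACA e1 mul1r.
Qed.

(** On the circle [P_n = z^n conj(Q_n)], so the integrand is [N_n z^(n-j) / Q_n], analytic on the
    closed disk; its mean is its value at [0]. *)
Lemma bsform_orth n j : (j <= n)%N ->
  bsform n 'X^j (P n) = if j == n then (N n)%:C else 0.
Proof.
move=> jn; have [s s1 sE] := opolyr_factor n.
have E t : ('X^j).[expi t]^*%C * (P n).[expi t] * (bsw n t)%:C =
    (N n)%:C * (expi t ^+ (n - j) * (\prod_(b <- s) (1 - b * expi t))^-1).
  have wE : (bsw n t)%:C = (N n)%:C / ((Q n).[expi t] * ((Q n).[expi t])^*%C).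
    by rewrite /bsw [LHS]rmorphM fmorphV mul_conjc.
  rewrite wE -sE hornerXn (opoly_circle FT Fpos)// ?cmod_expi// rmorphXn/= expi_conj.
  rewrite -{1}(subnK jn) exprD.
  have q0 := Q_expi_neq0 n t; have e0 := expi_neq0 t.
  have qc : ((Q n).[expi t])^*%C != 0 by rewrite conjc_eq0.
  move: ((Q n).[expi t]) ((Q n).[expi t])^*%C q0 qc => q q' q0 qc.
  rewrite exprVn; have ej : expi t ^+ j != 0 :> C by rewrite expf_neq0.
  move: (expi t ^+ j) (expi t ^+ (n - j)) ej => u v u0.
  by field; rewrite q0 qc u0.
rewrite /bsform (eq_tint E) tintZ; last first.
  apply: ccontinuousM; first by apply: ccontinuousX; exact: ccontinuous_expi.
  have -> : (fun t => (\prod_(b <- s) (1 - b * expi t))^-1) = (fun t => ((Q n).[expi t])^-1).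
    by apply/funext => t; rewrite sE.
  by apply: ccontinuousV; [exact: ccontinuous_Q|exact: Q_expi_neq0].
rewrite tint_inv_prod// subn_eq0.
have -> : (n <= j)%N = (j == n) by rewrite eqn_leq jn.
case: ifP => _; last by rewrite !mulr0.
rewrite mulrCA -rmorphM mulVf ?rmorph1 ?mulr1//.
by rewrite gt_eqF// pi2_gt0.
Qed.

Lemma bsform_moments n (p q : {poly C}) :
  (size p <= n.+1)%N -> (size q <= n.+1)%N -> bsform n p q = F p q.
Proof.
apply: (toeplitz_moments FT Fpos (toeplitz_bsform n)) => j jn.
exact: bsform_orth.
Qed.

Lemma continuous_ln_bsw n : continuous (fun t => ln (bsw n t)).
Proof.
move=> t; apply: continuous_comp; first exact: continuous_bsw.
by apply: continuous_ln; exact: bsw_gt0.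
Qed.

(** The Szego function of the [n]-th Bernstein-Szego weight: the Schwarz integral is additive in
    [ln N_n = ln w_n + 2 ln |Q_n|]. *)
Lemma cexp_schwarz_bsw n z : cmod z < 1 ->
  cexp (schwarz z (fun t => ln (bsw n t))) = (Num.sqrt (N n))%:C / (Q n).[z].
Proof.
move=> z1; have [s s1 sE] := opolyr_factor n.
have N0 := onorm2_gt0 FT Fpos n.
have cQ : continuous (fun t => 2 * ln (cmod (Q n).[expi t])).
  move=> t; apply: cvgMr; apply: continuous_ln_cmod; first exact: ccontinuous_Q.
  by move=> u; exact: Q_expi_neq0.
have E t : ln (bsw n t) + 2 * ln (cmod (Q n).[expi t]) = ln (N n).
  have q0 : 0 < cmod (Q n).[expi t] by rewrite cmod_gt0 Q_expi_neq0.
  rewrite /bsw ln_div ?posrE ?exprn_gt0// lnXn// [2 * _]mulr_natl.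
  by rewrite subrK.
have := schwarzD z1 (@continuous_ln_bsw n) cQ.
under eq_fun do rewrite E.
rewrite schwarz_cst// => /(congr1 (@cexp R)); rewrite cexpD cexp_real.
have -> : cexp (schwarz z (fun t => 2 * ln (cmod (Q n).[expi t]))) = (Q n).[z].
  by under eq_fun do rewrite sE; rewrite schwarz_prod// sE.
have -> : expR (ln (N n) / 2) = Num.sqrt (N n).
  rewrite -[LHS]ger0_norm ?expR_ge0// -sqrtr_sqr -expRM_natl mulrC.
  by rewrite divfK// lnK.
by move=> ->; rewrite mulfK// opolyr_neq0// ltW.
Qed.

End bernstein_szego.

(** * Limits of the reversed polynomials *)

Section szego_limits.
Variable R : realType.
Local Notation C := (R[i]^o).
Implicit Types (z w : C) (n : nat) (e d : R).

Lemma horner_lipschitz (p : {poly C}) : exists L : R, 0 < L /\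
  forall z w, cmod z <= 1 -> cmod w <= 1 -> cmod (p.[z] - p.[w]) <= L * cmod (z - w).
Proof.
have powL k z w : cmod z <= 1 -> cmod w <= 1 ->
    cmod (z ^+ k - w ^+ k) <= k%:R * cmod (z - w).
  move=> z1 w1; elim: k => [|k IH]; first by rewrite !expr0 subrr cmod0 mul0r.
  have -> : z ^+ k.+1 - w ^+ k.+1 = z * (z ^+ k - w ^+ k) + (z - w) * w ^+ k.
    by rewrite !exprS; ring.
  rewrite (le_trans (cmodD _ _))// !cmodM cmodX -natr1 mulrDl mul1r lerD//.
    by rewrite (le_trans _ IH)// ler_piMl ?cmod_ge0.
  by rewrite ler_piMr ?cmod_ge0// exprn_ile1 ?cmod_ge0.
exists (1 + \sum_(k < size p) cmod p`_k * k%:R); split.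
  by rewrite ltr_pwDl// sumr_ge0// => k _; rewrite mulr_ge0 ?cmod_ge0.
move=> z w z1 w1; rewrite !horner_coef -sumrB.
rewrite (le_trans (cmod_sum _ _ _))// mulrDl mul1r ler_wpDl ?cmod_ge0//.
rewrite mulr_suml; apply: ler_sum => k _; rewrite -mulrBr cmodM -mulrA.
by rewrite ler_wpM2l ?cmod_ge0 ?powL.
Qed.

Variable F : {poly C} -> {poly C} -> C.
Hypotheses (FT : toeplitz F) (Fpos : posdef F).
Local Notation P := (opoly F).
Local Notation Q := (opolyr F).
Local Notation N := (onorm2 F).
Local Notation al := (verb F).
Variables M1 M2 : R.
Hypothesis bv : forall n, \sum_(0 <= k < n) cmod (al k.+1 - al k) <= M1.
Hypothesis l2 : forall n, \sum_(0 <= k < n) cmod (al k) ^+ 2 <= M2.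

Lemma verb_cvg0 e : 0 < e -> exists n0, forall n, (n0 <= n)%N -> cmod (al n) <= e.
Proof.
move=> e0; have e20 : 0 < e ^+ 2 by rewrite exprn_gt0.
have [n0 H] := bounded_tail (fun k => sqr_ge0 (cmod (al k))) l2 e20.
exists n0 => n n0n; have := H n n.+1; rewrite n0n leqnSn big_nat1 => /(_ isT).
by rewrite ler_pXn2r// ?nnegrE ?cmod_ge0// ltW.
Qed.

Lemma verb_err e : 0 < e -> exists n0, forall n m, (n0 <= n <= m)%N ->
  szego_err al n m <= e.
Proof.
move=> e0; have e4 : 0 < e / 4 by rewrite divr_gt0.
have [n1 H1] := verb_cvg0 e4.
have [n2 H2] := bounded_tail (fun k => sqr_ge0 (cmod (al k))) l2 e4.
have [n3 H3] := bounded_tail (fun k => cmod_ge0 (al k.+1 - al k)) bv e4.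
exists (maxn n1 (maxn n2 n3)) => n m; rewrite !geq_max -!andbA => /and4P[a1 a2 a3 nm].
rewrite /szego_err big_split/=.
have := H1 _ a1; have := H1 _ (leq_trans a1 nm).
have := H2 n m; rewrite a2 nm => /(_ isT).
have := H3 n m; rewrite a3 nm => /(_ isT).
lra.
Qed.

Lemma opolyr_bounds d : 0 < d -> exists c B : R, 0 < c /\
  forall z, cmod z <= 1 -> d <= cmod (z - 1) -> forall n, c <= cmod (Q n).[z] <= B.
Proof.
move=> d0; have [c [B [c0 H]]] := szego_rec_bounds (verb_lt1 FT Fpos) verb_err d0.
by exists c, B; split => // z z1 dz; apply: H (szego_rec_opoly FT Fpos z) z1 dz.
Qed.

Lemma opolyr_cauchy d e : 0 < d -> 0 < e -> exists n0, forall z, cmod z <= 1 ->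
  d <= cmod (z - 1) -> forall n m, (n0 <= n <= m)%N ->
  cmod ((Q m).[z] - (Q n).[z]) <= e.
Proof.
move=> d0 e0; have [n0 H] := szego_rec_cauchy (verb_lt1 FT Fpos) verb_err d0 e0.
by exists n0 => z z1 dz; apply: H (szego_rec_opoly FT Fpos z) z1 dz.
Qed.

Definition opoly_lim z : C :=
  limn (fun n => complex.Re (Q n).[z]) +i* limn (fun n => complex.Im (Q n).[z]).

Lemma real_cauchy (u : nat -> R) : (forall e, 0 < e ->
    exists n0, forall n m, (n0 <= n <= m)%N -> `|u m - u n| <= e) ->
  u n @[n --> \oo] --> limn u.
Proof.
move=> H; suff : cvg (u @ \oo) by [].
apply/cauchy_cvgP/cauchy_exP => e e0.
have [|n0 Hn] := H (e / 2); first by rewrite divr_gt0.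
exists (u n0), n0 => // n /= n0n; rewrite /ball/= distrC.
have := Hn n0 n; rewrite leqnn n0n => /(_ isT); lra.
Qed.

Lemma ccvg_opoly_lim z : cmod z <= 1 -> z != 1 ->
  ccvg (fun n => (Q n).[z]) (opoly_lim z).
Proof.
move=> z1 zn1; have d0 : 0 < cmod (z - 1) by rewrite cmod_gt0 subr_eq0.
split; apply: real_cauchy => e e0; have [n0 H] := opolyr_cauchy d0 e0;
  exists n0 => n m nm; apply: le_trans (H z z1 (lexx _) n m nm).
  by rewrite -ReN -ReD ler_Re_cmod.
by rewrite -ImN -ImD ler_Im_cmod.
Qed.

Lemma opoly_lim_bounds d : 0 < d -> exists c B : R, 0 < c /\
  forall z, cmod z <= 1 -> d <= cmod (z - 1) -> c <= cmod (opoly_lim z) <= B.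
Proof.
move=> d0; have [c [B [c0 H]]] := opolyr_bounds d0; exists c, B; split => //.
move=> z z1 dz; have zn1 : z != 1.
  by rewrite -subr_eq0 -cmod_gt0 (lt_le_trans d0).
have cv := ccvg_cmod (ccvg_opoly_lim z1 zn1).
rewrite -(cvg_lim _ cv)//; apply/andP; split.
  by apply: limr_ge; [exact: cvgP cv|near=> n; have /andP[] := H z z1 dz n].
by apply: limr_le; [exact: cvgP cv|near=> n; have /andP[] := H z z1 dz n].
Unshelve. all: end_near. Qed.

Lemma opoly_lim_neq0 z : cmod z <= 1 -> z != 1 -> opoly_lim z != 0.
Proof.
move=> z1 zn1; have d0 : 0 < cmod (z - 1) by rewrite cmod_gt0 subr_eq0.
have [c [B [c0 H]]] := opoly_lim_bounds d0.
by have /andP[cz _] := H z z1 (lexx _); rewrite -cmod_gt0 (lt_le_trans c0).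
Qed.

Lemma opoly_lim_dist d e : 0 < d -> 0 < e -> exists n0, forall z, cmod z <= 1 ->
  d <= cmod (z - 1) -> forall n, (n0 <= n)%N -> cmod (opoly_lim z - (Q n).[z]) <= e.
Proof.
move=> d0 e0; have [n0 H] := opolyr_cauchy d0 e0; exists n0 => z z1 dz n n0n.
have zn1 : z != 1.
  by rewrite -subr_eq0 -cmod_gt0 (lt_le_trans d0).
have cv := ccvg_cmod (ccvgD (ccvg_opoly_lim z1 zn1) (ccvg_cst (- (Q n).[z]))).
rewrite -(cvg_lim _ cv)//; apply: limr_le; first exact: cvgP cv.
near=> m; apply: H => //; rewrite n0n /=; near: m; exact: nbhs_infty_ge.
Unshelve. all: end_near. Qed.

(** A uniform limit of polynomials: the radius keeps [w] at distance at least [|z - 1| / 2] from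
    [1], where one index [n0] serves [z] and [w] alike. *)
Lemma opoly_lim_continuous z : cmod z <= 1 -> z != 1 -> forall e, 0 < e ->
  exists2 d, 0 < d & forall w, cmod w <= 1 -> cmod (w - z) <= d ->
  cmod (opoly_lim w - opoly_lim z) <= e.
Proof.
move=> z1 zn1 e e0; have d0 : 0 < cmod (z - 1) / 2.
  by rewrite divr_gt0// cmod_gt0 subr_eq0.
have [|n0 H] := opoly_lim_dist d0 (_ : 0 < e / 3); first by rewrite divr_gt0.
have [L [L0 HL]] := horner_lipschitz (Q n0).
exists (Num.min (cmod (z - 1) / 2) (e / 3 / L)).
  by rewrite lt_min d0 !divr_gt0.
move=> w w1; rewrite le_min => /andP[wz wze].
have dw : cmod (z - 1) / 2 <= cmod (w - 1).
  have : cmod (z - 1) <= cmod (w - 1) + cmod (w - z).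
    rewrite (cmod_distC w z).
    have -> : z - 1 = (w - 1) + (z - w) by ring.
    exact: cmodD.
  lra.
have dz : cmod (z - 1) / 2 <= cmod (z - 1) by lra.
have h1 := H w w1 dw _ (leqnn n0); have h2 := H z z1 dz _ (leqnn n0).
have h3 : cmod ((Q n0).[w] - (Q n0).[z]) <= e / 3.
  by rewrite (le_trans (HL _ _ w1 z1))// mulrC -ler_pdivlMr.
have -> : opoly_lim w - opoly_lim z = (opoly_lim w - (Q n0).[w]) +
    ((Q n0).[w] - (Q n0).[z]) - (opoly_lim z - (Q n0).[z]) by ring.
have := cmodB (opoly_lim w - (Q n0).[w] + ((Q n0).[w] - (Q n0).[z])) (opoly_lim z - (Q n0).[z]).
have := cmodD (opoly_lim w - (Q n0).[w]) ((Q n0).[w] - (Q n0).[z]).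
lra.
Qed.

Definition onorm2_lim : R := limn N.

Lemma onorm2_noninc n : N n.+1 <= N n.
Proof.
rewrite (onorm2S FT Fpos) ler_piMl ?(ltW (onorm2_gt0 FT Fpos n))//.
by rewrite lerBlDr lerDl sqr_ge0.
Qed.

(** Instead of an infinite product, [prod (1 - x_k) >= 1 - sum x_k] is used beyond the index where
    the tail of [sum |al_k|^2] is at most 1/2; earlier norms are larger by monotonicity. *)
Lemma onorm2_lower : exists2 c, 0 < c & forall n, c <= N n.
Proof.
have h0 : 0 < 2^-1 :> R by rewrite invr_gt0.
have [n0 H] := bounded_tail (fun k => sqr_ge0 (cmod (al k))) l2 h0.
have Nn k : N n0 * (1 - \sum_(n0 <= j < n0 + k) cmod (al j) ^+ 2) <= N (n0 + k).
  elim: k => [|k IH]; first by rewrite addn0 big_geq// subr0 mulr1.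
  rewrite addnS big_nat_recr ?leq_addr//= (onorm2S FT Fpos).
  have a0 := sqr_ge0 (cmod (al (n0 + k))).
  have N0 := onorm2_gt0 FT Fpos n0; have Nk := onorm2_gt0 FT Fpos (n0 + k).
  set S := \sum_(_ <= _ < _) _ in IH *.
  have : N (n0 + k) <= N n0.
    elim: (k) => [|j IHj]; first by rewrite addn0.
    by rewrite addnS (le_trans (onorm2_noninc _)).
  move: IH; set a := cmod _ ^+ 2 in a0 *; nra.
have N0 := onorm2_gt0 FT Fpos n0.
exists (N n0 / 2); first by rewrite divr_gt0.
move=> n; have [nn0|n0n] := leqP n n0.
  have : N n0 <= N n.
    rewrite -(subnK nn0) addnC; elim: (n0 - n)%N => [|j IHj]; first by rewrite addn0.
    by rewrite addnS (le_trans (onorm2_noninc _)).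
  lra.
have := Nn (n - n0)%N; rewrite subnKC ?(ltnW n0n)//; apply: le_trans.
rewrite ler_pM2l//; have := H n0 n; rewrite leqnn (ltnW n0n) => /(_ isT).
lra.
Qed.

Lemma onorm2_cvg : N n @[n --> \oo] --> onorm2_lim.
Proof.
have [c c0 H] := onorm2_lower.
apply: nonincreasing_is_cvgn; first by apply/nonincreasing_seqP; exact: onorm2_noninc.
by exists c => _ [n _ <-].
Qed.

Lemma onorm2_lim_gt0 : 0 < onorm2_lim.
Proof.
have [c c0 H] := onorm2_lower; rewrite (lt_le_trans c0)//.
by apply: limr_ge; [exact: cvgP onorm2_cvg|near=> n].
Unshelve. all: end_near. Qed.

End szego_limits.

Section max_min_cvg.
Variable R : realType.

Lemma cvg_maxr0 (u : nat -> R) l : u n @[n --> \oo] --> l ->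
  Num.max (u n) 0 @[n --> \oo] --> Num.max l 0.
Proof.
move=> ul; under eq_fun do rewrite maxr_absE; rewrite maxr_absE.
apply: cvgMl; apply: cvgD; first by apply: cvgD => //; exact: cvg_cst.
by apply: cvg_norm; apply: cvgB => //; exact: cvg_cst.
Qed.

Lemma cvg_minr_cst (u : nat -> R) l (M : R) : u n @[n --> \oo] --> l ->
  Num.min (u n) M @[n --> \oo] --> Num.min l M.
Proof.
move=> ul; under eq_fun do rewrite minr_absE; rewrite minr_absE.
apply: cvgMl; apply: cvgB; first by apply: cvgD => //; exact: cvg_cst.
by apply: cvg_norm; apply: cvgB => //; exact: cvg_cst.
Qed.

End max_min_cvg.

(** * Convergence in mean of the logarithms of weights *)

Section log_convergence.
Context {R : realType} {d : measure_display} {T : measurableType d}.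
Variables (mu : {measure set T -> \bar R}) (D : set T).
Hypotheses (mD : measurable D) (muD : (mu D < +oo)%E).
Implicit Types (g h : T -> R).
Local Notation integr h := (mu.-integrable D (EFin \o h)).
Local Notation int h := (\int[mu]_(x in D) h x).

Lemma integrable_int h : integr h -> (\int[mu]_(x in D) (h x)%:E)%E = (int h)%:E.
Proof. by move=> ih; rewrite /Rintegral fineK//; exact: integrable_fin_num. Qed.

Lemma fatou_integrable (g_ : nat -> T -> R) g (M : R) :
  (forall n, integr (g_ n)) -> (forall n x, D x -> 0 <= g_ n x) ->
  (forall x, D x -> g_ n x @[n --> \oo] --> g x) ->
  (forall n, int (g_ n) <= M) -> integr g /\ int g <= M.
Proof.
move=> ig g0 gc gM.
have mg_ n : measurable_fun D (g_ n).
  by apply/measurable_EFinP; exact: measurable_int (ig n).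
have mg : measurable_fun D g by exact: measurable_fun_cvg gc.
have gge0 x : D x -> 0 <= g x.
  move=> Dx; have cv := gc x Dx; rewrite -(cvg_lim _ cv)//.
  by apply: limr_ge; [exact: cvgP cv|near=> n; exact: g0].
have le : (\int[mu]_(x in D) (g x)%:E <= M%:E)%E.
  have fat : (\int[mu]_(x in D) limn_einf (fun n => (g_ n x)%:E) <=
      limn_einf (fun n => \int[mu]_(x in D) (g_ n x)%:E))%E.
    apply: (@fatou _ _ _ mu D mD (fun n x => (g_ n x)%:E)) => [n|n x Dx].
      by apply/measurable_EFinP.
    by rewrite lee_fin g0.
  rewrite (eq_integral (fun x => limn_einf (fun n => (g_ n x)%:E))); last first.
    move=> x; rewrite inE => Dx.
    have [] := @cvg_limn_einf_sup R (fun n => (g_ n x)%:E) (g x)%:E; last by move=> ->.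
    by apply: cvg_EFin; [near=> n|exact: gc].
  apply: (le_trans fat); rewrite limn_einf_lim.
  apply: lime_le; first exact: is_cvg_einfs.
  near=> n; apply: (@le_trans _ _ (\int[mu]_(x in D) (g_ n x)%:E)%E).
    by apply: ereal_inf_lbound; exists n => /=.
  by rewrite integrable_int// lee_fin.
have ig' : integr g.
  apply/integrableP; split; first by apply/measurable_EFinP.
  rewrite (eq_integral (fun x => (g x)%:E)).
    by rewrite (le_lt_trans le)// ltry.
  by move=> x; rewrite inE => Dx /=; rewrite ger0_norm// gge0.
by split => //; rewrite -lee_fin -integrable_int.
Unshelve. all: end_near. Qed.

Lemma le_int_norm g h : measurable_fun D g -> integr h ->
  (forall x, D x -> `|g x| <= h x) -> integr g.
Proof.
move=> mg ih gh; apply: le_integrable ih => //; first by apply/measurable_EFinP.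
move=> x Dx /=; rewrite lee_fin (le_trans (gh x Dx))//.
exact: ler_norm.
Qed.

Lemma dominated_cvg0 (g_ : nat -> T -> R) h :
  (forall n, measurable_fun D (g_ n)) -> integr h ->
  (forall n x, D x -> `|g_ n x| <= h x) ->
  (forall x, D x -> g_ n x @[n --> \oo] --> (0 : R)) ->
  int (g_ n) @[n --> \oo] --> (0 : R).
Proof.
move=> mg ih gh gc.
have [] := @dominated_convergence _ _ _ mu D mD (fun n x => (g_ n x)%:E)
  (fun=> 0%E) (EFin \o h).
- by move=> n; apply/measurable_EFinP.
- exact: measurable_cst.
- by apply/aeW => x Dx; apply: cvg_EFin; [near=> n|exact: gc].
- exact: ih.
- by apply/aeW => x n Dx; rewrite /= lee_fin gh.
move=> _ _; rewrite integral0 => H.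
exact: (fine_cvg H).
Unshelve. all: end_near. Qed.

(** Abstracts what the Bernstein-Szego weights provide. [ratio] is the decisive property: [1 / w_n]
    is a multiple of [|P_n|^2], whose integral against every later weight is known exactly. *)
Variables (w_ : nat -> T -> R) (w : T -> R) (K c : R).
Hypotheses (w_gt0 : forall n x, D x -> 0 < w_ n x)
  (w_gt0' : forall x, D x -> 0 < w x)
  (iw_ : forall n, integr (w_ n))
  (ilnw_ : forall n, integr (fun x => ln (w_ n x)))
  (wc : forall x, D x -> w_ n x @[n --> \oo] --> w x)
  (wK : forall n, int (w_ n) <= K)
  (lnwc : forall n, - c <= int (fun x => ln (w_ n x)))
  (ratio : forall n N, (n <= N)%N -> integr (fun x => w_ N x / w_ n x) /\
    int (fun x => w_ N x / w_ n x) <= fine (mu D)).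

Lemma ln_le_sub1 (x : R) : 0 < x -> ln x <= x - 1.
Proof.
move=> x0; have -> : x = 1 + (x - 1) by rewrite addrC subrK.
apply: (le_trans (le_ln1Dx _)); lra.
Qed.

Lemma integrable_limit_weight : integr w /\ int w <= K.
Proof. by apply: fatou_integrable wK => // n x Dx; rewrite ltW// w_gt0. Qed.

Let lnwcvg x : D x -> ln (w_ n x) @[n --> \oo] --> ln (w x).
Proof.
move=> Dx; apply: continuous_cvg; last exact: wc.
by apply: continuous_ln; exact: w_gt0'.
Qed.

Lemma integrableBr g h : integr g -> integr h -> integr (fun x => g x - h x).
Proof. by move=> ig ih; exact: eq_integrable (integrableB mD ig ih). Qed.

Lemma integrableZr g (a : R) : integr g -> integr (fun x => a * g x).
Proof. by move=> ig; exact: eq_integrable (integrableZl mD a ig). Qed.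

(** [|ln w_n| <= 2 w_n - ln w_n], whose integrals are bounded by [wK] and [lnwc]; Fatou's lemma
    passes to the limit. *)
Lemma integrable_ln_limit : integr (fun x => ln (w x)).
Proof.
have [iabs _] : integr (fun x => `|ln (w x)|) /\ int (fun x => `|ln (w x)|) <= 2 * K + c.
  apply: (@fatou_integrable (fun n x => `|ln (w_ n x)|)) => //.
  - by move=> n; exact: integrable_norm (ilnw_ n).
  - by move=> x Dx; apply: cvg_norm; exact: lnwcvg.
  move=> n; apply: (@le_trans _ _ (int (fun x => 2 * w_ n x - ln (w_ n x)))).
    apply: le_Rintegral => //.
    - exact: integrable_norm (ilnw_ n).
    - by apply: integrableBr => //; exact: integrableZr.
    - move=> x Dx; have := ln_le_sub1 (w_gt0 n Dx); have := w_gt0 n Dx.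
      by case: (ger0P (ln (w_ n x))); lra.
  rewrite RintegralB//; last exact: integrableZr.
  by rewrite RintegralZl//; have := wK n; have := lnwc n; lra.
apply: le_int_norm iabs _ => //.
by apply: (@measurable_fun_cvg _ _ _ D (fun n x => ln (w_ n x))) => // n;
  apply/measurable_EFinP; exact: measurable_int (ilnw_ n).
Qed.

Let ilnw := integrable_ln_limit.

(** Jensen's inequality in the form [ln w - ln w_n <= w / w_n - 1]: by Fatou's lemma the mean of
    [w / w_n] inherits the bound of [ratio]. *)
Lemma int_ln_limit_le n : int (fun x => ln (w x)) <= int (fun x => ln (w_ n x)).
Proof.
have [ir rm] : integr (fun x => w x / w_ n x) /\
    int (fun x => w x / w_ n x) <= fine (mu D).
  apply: (@fatou_integrable (fun N x => w_ (N + n) x / w_ n x)).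
  - by move=> N; have [] := ratio (leq_addl N n).
  - by move=> N x Dx; rewrite divr_ge0// ltW// w_gt0.
  - move=> x Dx; apply: cvgMl.
    by have := wc Dx; rewrite -(cvg_shiftn n (fun k => w_ k x)).
  - by move=> N; have [] := ratio (leq_addl N n).
rewrite -subr_le0 -RintegralB//.
apply: (@le_trans _ _ (int (fun x => w x / w_ n x - 1))).
  apply: le_Rintegral => //.
  - exact: integrableBr.
  - apply: integrableBr => //; apply: measurable_bounded_integrable => //.
    exact: bounded_cst.
  - move=> x Dx; rewrite -ln_div ?posrE ?w_gt0// ?w_gt0'//.
    by apply: ln_le_sub1; rewrite divr_gt0 ?w_gt0 ?w_gt0'.
rewrite RintegralB//; last first.
  by apply: measurable_bounded_integrable => //; exact: bounded_cst.
by rewrite Rintegral_cst// mul1r subr_le0.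
Qed.

(* Scheffe's argument; the truncation at height [M] replaces uniform
   integrability of the positive parts. *)
Lemma ln_weight_cvg : int (fun x => `|ln (w_ n x) - ln (w x)|) @[n --> \oo] --> (0 : R).
Proof.
(* The truncated positive part of [ln w_n - ln w], dominated by [|M| + |ln w|]; for fixed [M] its
   integral tends to 0. *)
pose h (M : R) n x := Num.max (Num.min (ln (w_ n x)) M - ln (w x)) 0.
have mln n : measurable_fun D (fun x => ln (w_ n x)).
  by apply/measurable_EFinP; exact: measurable_int (ilnw_ n).
have mlnw : measurable_fun D (fun x => ln (w x)).
  by apply/measurable_EFinP; exact: measurable_int ilnw.
have mh M n : measurable_fun D (h M n).
  apply: measurable_maxr; last exact: measurable_cst.
  apply: measurable_funB => //; apply: measurable_minr => //.
have idom (M : R) : integr (fun x => `|M| + `|ln (w x)|).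
  apply: (eq_integrable mD) (integrableD mD (_ : integr (fun=> `|M|)) (integrable_norm ilnw)) => //.
  by apply: measurable_bounded_integrable => //; exact: bounded_cst.
have hdom (M : R) n x : D x -> `|h M n x| <= `|M| + `|ln (w x)|.
  move=> Dx; rewrite ger0_norm ?le_max ?lexx ?orbT//.
  rewrite ge_max addr_ge0// andbT.
  have : Num.min (ln (w_ n x)) M <= M by rewrite ge_min lexx orbT.
  by have := ler_norm M; have := ler_norm (- ln (w x)); rewrite normrN; lra.
have ih M n : integr (h M n).
  by apply: (le_int_norm (mh M n) (idom M)) => x; exact: hdom.
have hc M : int (h M n) @[n --> \oo] --> (0 : R).
  apply: (dominated_cvg0 (mh M) (idom M)) => [n x|x Dx]; first exact: hdom.
  have -> : 0 = Num.max (Num.min (ln (w x)) M - ln (w x)) 0 :> R.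
    by rewrite max_r// subr_le0 ge_min lexx.
  apply: cvg_maxr0; apply: cvgB; last exact: cvg_cst.
  by apply: cvg_minr_cst; exact: lnwcvg.
(* For [x = ln w_n - ln w], [|x| = 2 x^+ - x], where [- x] has nonpositive integral by
   [int_ln_limit_le]. The part of [x^+] lost by truncation is at most [exp (- M) w_n]. *)
have key M n : int (fun x => `|ln (w_ n x) - ln (w x)|) <=
    2 * (int (h M n) + expR (- M) * K).
  have ie : integr (fun x => expR (- M) * w_ n x) by exact: integrableZr.
  have iD : integr (fun x => h M n x + expR (- M) * w_ n x).
    exact: (eq_integrable mD) (integrableD mD (ih M n) ie).
  apply: (@le_trans _ _ (int (fun x => 2 * (h M n x + expR (- M) * w_ n x) -
      (ln (w_ n x) - ln (w x))))).
    apply: le_Rintegral => //.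
    - by apply: integrable_norm; exact: integrableBr.
    - by apply: integrableBr; [exact: integrableZr|exact: integrableBr].
    move=> x Dx; have w0 := w_gt0 n Dx.
    have e1 : ln (w_ n x) - M <= expR (- M) * w_ n x.
      rewrite -[X in ln X](@mulfK _ (expR M)) ?gt_eqF ?expR_gt0//.
      rewrite -expRN mulrAC lnM ?posrE ?expR_gt0 ?mulr_gt0 ?expR_gt0//.
      rewrite expRK addrK [w_ n x * _]mulrC (le_trans (ln_le_sub1 _)) ?mulr_gt0 ?expR_gt0//.
      by rewrite gerBl.
    have h0 : 0 <= h M n x by rewrite le_max lexx orbT.
    have h1 : Num.min (ln (w_ n x)) M - ln (w x) <= h M n x by rewrite le_max lexx.
    have ew : 0 < expR (- M) * w_ n x by rewrite mulr_gt0 ?expR_gt0.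
    case: (ger0P (ln (w_ n x) - ln (w x))) => _; last by lra.
    by move: h1; case: (leP (ln (w_ n x)) M); lra.
  rewrite RintegralB//; [|exact: integrableZr|exact: integrableBr].
  rewrite (RintegralZl _ mD iD) (RintegralD mD (ih M n) ie).
  rewrite (RintegralZl _ mD (iw_ n)) (RintegralB mD (ilnw_ n) ilnw).
  have := int_ln_limit_le n; have := wK n.
  have := expR_ge0 (- M); set E := expR (- M) => E0 H1 H2.
  have : E * int (w_ n) <= E * K by rewrite ler_wpM2l.
  lra.
have K0 : 0 <= K.
  by rewrite (le_trans _ (wK 0%N))//; apply: Rintegral_ge0 => x Dx; rewrite ltW ?w_gt0.
apply/cvgrPdist_le => e e0.
(* Makes [exp (- M) K] at most [e / 4]; [K + 1] keeps the denominator positive when [K = 0]. *)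
pose M := - ln (e / (4 * (K + 1))).
have e4 : 0 < e / (4 * (K + 1)) by rewrite divr_gt0// mulr_gt0// ltr_wpDl.
have eM : expR (- M) * K <= e / 4.
  rewrite opprK lnK ?posrE// mulrAC ler_pdivrMr; last by lra.
  by lra.
have e40 : 0 < e / 4 by rewrite divr_gt0.
move/cvgrPdist_le : (hc M) => /(_ _ e40); apply: filterS => n.
rewrite !sub0r !normrN => hn.
have := key M n; have := le_trans (ler_norm _) hn.
rewrite ger0_norm; last exact: Rintegral_ge0.
lra.
Qed.

End log_convergence.

(** * The open period, on which [expi] avoids the point [1] *)

Section open_period.
Variable R : realType.
Local Notation C := (R[i]^o).
Local Notation period := (`[0%R, (2 * pi)%R]%classic : set (measurableTypeR R)).
Local Notation operiod := (`]0%R, (2 * pi)%R[%classic : set (measurableTypeR R)).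
Local Notation leb := (@lebesgue_measure R).
Implicit Types (t : R) (h : R -> R).

Lemma expi_neq1 t : 0 < t < 2 * pi -> expi t != 1 :> C.
Proof.
move=> /andP[t0 t2]; apply/eqP => -[c1 s0].
have [tpi|pit|tpi] := ltgtP t pi.
- by have := sin_gt0_pi (introT andP (conj t0 tpi)); rewrite s0 ltxx.
- have : 0 < sin (t - pi) by apply: sin_gt0_pi; apply/andP; split; lra.
  by rewrite sinB sinpi cospi s0 mul0r mulr0 subr0 ltxx.
- by move: c1; rewrite tpi cospi; lra.
Qed.

Lemma operiod_sub : operiod `<=` period.
Proof. by move=> t /=; rewrite !in_itv/= => /andP[t0 t1]; rewrite !ltW. Qed.

Lemma measurable_operiod : measurable operiod.
Proof. exact: measurable_itv. Qed.

Lemma lebesgue_operiod : leb operiod = (2 * pi)%:E.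
Proof. by rewrite lebesgue_measure_itv/= lte_fin pi2_gt0 oppr0 addr0. Qed.

Lemma lebesgue_operiod_lty : (leb operiod < +oo)%E.
Proof. by rewrite lebesgue_operiod ltry. Qed.

Lemma Rintegral_operiod h : measurable_fun operiod h ->
  \int[leb]_(t in operiod) h t = \int[leb]_(t in period) h t.
Proof.
move=> mh; rewrite /Rintegral; congr fine; rewrite [RHS]integral_itv_bndoo//.
by apply/measurable_EFinP.
Qed.

Lemma cintegral_operiod (f : R -> C) :
  measurable_fun operiod (fun t => complex.Re (f t)) ->
  measurable_fun operiod (fun t => complex.Im (f t)) ->
  cintegral leb operiod f = cintegral leb period f.
Proof. by move=> mR mI; congr (_ +i* _); exact: Rintegral_operiod. Qed.

Lemma continuous_measurable_operiod h : continuous h -> measurable_fun operiod h.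
Proof. by move=> ch; apply: measurable_funTS; exact: continuous_measurable_fun. Qed.

Lemma continuous_integrable_operiod h : continuous h ->
  leb.-integrable operiod (EFin \o h).
Proof.
move=> ch; apply: integrableS (continuous_integrable ch).
- exact: measurable_period.
- exact: measurable_operiod.
- exact: operiod_sub.
Qed.

End open_period.

(** * Integrals of the Bernstein-Szego weights and of their limit *)

Section szego_theorem.
Variable R : realType.
Local Notation C := (R[i]^o).
Local Notation period := (`[0%R, (2 * pi)%R]%classic : set (measurableTypeR R)).
Local Notation operiod := (`]0%R, (2 * pi)%R[%classic : set (measurableTypeR R)).
Local Notation leb := (@lebesgue_measure R).
Variable F : {poly C} -> {poly C} -> C.
Hypotheses (FT : toeplitz F) (Fpos : posdef F).
Local Notation P := (opoly F).
Local Notation Q := (opolyr F).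
Local Notation N := (onorm2 F).
Local Notation al := (verb F).
Variables M1 M2 : R.
Hypothesis bv : forall n, \sum_(0 <= k < n) cmod (al k.+1 - al k) <= M1.
Hypothesis l2 : forall n, \sum_(0 <= k < n) cmod (al k) ^+ 2 <= M2.
Hypothesis F11 : F 1 1 = 1.
Implicit Types (t : R) (z : C).

Definition szego_weight t : R := onorm2_lim F / cmod (opoly_lim F (expi t)) ^+ 2.

Lemma expi_operiod t : operiod t -> cmod (expi t : C) <= 1 /\ expi t != 1 :> C.
Proof.
by rewrite /= in_itv/= => t02; rewrite cmod_expi lexx; split => //; exact: expi_neq1.
Qed.

Lemma szego_weight_gt0 t : operiod t -> 0 < szego_weight t.
Proof.
move=> /expi_operiod[e1 en1]; rewrite divr_gt0 ?(onorm2_lim_gt0 FT Fpos l2)//.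
by rewrite exprn_gt0// cmod_gt0 (opoly_lim_neq0 FT Fpos bv l2).
Qed.

Lemma bsw_cvg t : operiod t -> bsw F n t @[n --> \oo] --> szego_weight t.
Proof.
move=> /expi_operiod[e1 en1]; apply: cvgM; first exact: (onorm2_cvg FT Fpos l2).
have cv := ccvg_cmod (ccvg_opoly_lim FT Fpos bv l2 e1 en1).
apply: cvgV.
  by rewrite expf_eq0/= cmod_eq0 (opoly_lim_neq0 FT Fpos bv l2).
by under eq_fun do rewrite expr2; rewrite expr2; exact: cvgM.
Qed.

Let cbsw n := continuous_bsw FT Fpos (n := n).

Lemma int_bsw_moment n (p : {poly C}) : (size p <= n.+1)%N ->
  \int[leb]_(t in period) (cmod (p.[expi t]) ^+ 2 * bsw F n t) =
  2 * pi * complex.Re (F p p).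
Proof.
move=> sp; have := bsform_moments FT Fpos sp sp; rewrite /bsform.
have -> : (fun t => (p.[expi t])^*%C * p.[expi t] * (bsw F n t)%:C) =
    (fun t => (cmod (p.[expi t]) ^+ 2 * bsw F n t)%:C).
  by apply/funext => t; rewrite mulrC [_^*%C * _]mulrC mul_conjc -rmorphM mulrC.
rewrite /tint cintegral_real -rmorphM => /(congr1 (fun u : C => complex.Re u)) /= <-.
by rewrite mulrA mulfV ?mul1r// gt_eqF// pi2_gt0.
Qed.

Lemma int_bsw n : \int[leb]_(t in operiod) bsw F n t = 2 * pi.
Proof.
rewrite Rintegral_operiod; last exact: continuous_measurable_operiod (@cbsw n).
have := @int_bsw_moment n 1; rewrite size_poly1 F11 [X in _ * X]/= mulr1 => /(_ isT) E.
by apply: etrans E; apply: eq_Rintegral => t _; rewrite hornerC cmod1 expr1n mul1r.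
Qed.

(** On the circle [1 / w_n = |P_n|^2 / N_n], and for [m >= n] the weight [w_m] integrates [|P_n|^2]
    to [2 pi N_n]. *)
Lemma int_bsw_ratio n m : (n <= m)%N ->
  leb.-integrable operiod (EFin \o (fun t => bsw F m t / bsw F n t)) /\
  \int[leb]_(t in operiod) (bsw F m t / bsw F n t) <= fine (leb operiod).
Proof.
move=> nm; have N0 := onorm2_gt0 FT Fpos n.
have cr : continuous (fun t => bsw F m t / bsw F n t).
  move=> t; apply: cvgM; first exact: (@cbsw m).
  by apply: cvgV; [rewrite gt_eqF// bsw_gt0|exact: (@cbsw n)].
split; first exact: continuous_integrable_operiod.
rewrite Rintegral_operiod; last exact: continuous_measurable_operiod.
have E : (fun t => bsw F m t / bsw F n t) =
    (fun t => (N n)^-1 * (cmod ((P n).[expi t]) ^+ 2 * bsw F m t)).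
  apply/funext => t; rewrite (opoly_circle FT Fpos) ?cmod_expi//.
  rewrite cmodM cmodX cmod_expi expr1n mul1r cmod_conj; move: (bsw F m t) => b.
  by rewrite /bsw invfM invrK mulrCA [b * _]mulrC.
rewrite E RintegralZl.
- rewrite int_bsw_moment ?size_opoly// -/(N n) [leRHS](congr1 fine (lebesgue_operiod R))/=.
  by rewrite mulrC mulfK// gt_eqF.
- exact: measurable_period.
- apply: continuous_integrable => t; apply: cvgM; last exact: (@cbsw m).
  by apply: continuous_cmod2; apply: ccontinuous_horner; exact: ccontinuous_expi.
Qed.

(** The formula for [cexp_schwarz_bsw] at [z = 0], where the kernel is 1 and [Q_n] is 1. *)
Lemma int_ln_bsw n : \int[leb]_(t in operiod) ln (bsw F n t) = 2 * pi * ln (N n).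
Proof.
have cl := continuous_ln_bsw FT Fpos (n := n).
rewrite Rintegral_operiod; last exact: continuous_measurable_operiod.
have N0 := onorm2_gt0 FT Fpos n.
have z1 : cmod (0 : C) < 1 by rewrite cmod0.
have := cexp_schwarz_bsw FT Fpos n z1; rewrite (opolyr0 FT Fpos) divr1 /schwarz.
have -> : (fun t => skernel 0 t * (ln (bsw F n t))%:C) = (fun t => (ln (bsw F n t))%:C).
  apply/funext => t; rewrite /skernel addr0 subr0 mulfV ?mul1r//.
  exact: expi_neq0.
rewrite /tint cintegral_real -rmorphM cexp_real => -[].
move/(congr1 (@ln R)); rewrite expRK => H.
have {}H : ln (N n) = 2 * ((4 * pi)^-1 * \int[leb]_(t in period) ln (bsw F n t)).
  by rewrite H mulr_natl -lnXn ?sqrtr_gt0// sqr_sqrtr// ltW.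
rewrite H; have pi0 : pi != 0 :> R by rewrite gt_eqF// pi_gt0.
by move: pi pi0 (Rintegral _ _ _) => p p0 I; field.
Qed.

Let w_gt0 n t : operiod t -> 0 < bsw F n t.
Proof. by move=> _; exact: bsw_gt0. Qed.

Let iw n := continuous_integrable_operiod (@cbsw n).

Let ilnw n := continuous_integrable_operiod (continuous_ln_bsw FT Fpos (n := n)).

Let intw n : \int[leb]_(t in operiod) bsw F n t <= 2 * pi.
Proof. by rewrite int_bsw. Qed.

Lemma int_ln_bsw_lower : exists c, forall n,
  - c <= \int[leb]_(t in operiod) ln (bsw F n t).
Proof.
have [c c0 H] := onorm2_lower FT Fpos l2.
exists (- (2 * pi * ln c)) => n; rewrite opprK int_ln_bsw.
by rewrite ler_pM2l ?pi2_gt0// ler_ln ?posrE// onorm2_gt0.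
Qed.

Lemma integrable_szego_weight : leb.-integrable operiod (EFin \o szego_weight) /\
  \int[leb]_(t in operiod) szego_weight t <= 2 * pi.
Proof.
exact (integrable_limit_weight (@measurable_operiod R) w_gt0 iw bsw_cvg intw).
Qed.

Lemma integrable_ln_szego_weight :
  leb.-integrable operiod (EFin \o (fun t => ln (szego_weight t))).
Proof.
have [c cP] := int_ln_bsw_lower.
by apply: (integrable_ln_limit (@measurable_operiod R) w_gt0 szego_weight_gt0 iw ilnw
  bsw_cvg intw cP).
Qed.

Lemma ln_bsw_cvg :
  \int[leb]_(t in operiod) `|ln (bsw F n t) - ln (szego_weight t)| @[n --> \oo] --> (0 : R).
Proof.
have [c cP] := int_ln_bsw_lower.
exact: (ln_weight_cvg (@measurable_operiod R) (@lebesgue_operiod_lty R) w_gt0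
  szego_weight_gt0 iw ilnw bsw_cvg intw cP int_bsw_ratio).
Qed.

End szego_theorem.

(** * Passage to the limit in the Szego function and in the moments *)

Section szego_formula.
Variable R : realType.
Local Notation C := (R[i]^o).
Local Notation period := (`[0%R, (2 * pi)%R]%classic : set (measurableTypeR R)).
Local Notation operiod := (`]0%R, (2 * pi)%R[%classic : set (measurableTypeR R)).
Local Notation leb := (@lebesgue_measure R).
Implicit Types (t : R) (z : C) (h : R -> R) (f : R -> C).

Let lO := @lebesgue_operiod_lty R.
Let mO := @measurable_operiod R.

Lemma ccontinuous_measurable_operiod f : ccontinuous f ->
  measurable_fun operiod (fun t => complex.Re (f t)) /\
  measurable_fun operiod (fun t => complex.Im (f t)).
Proof. by move=> [cR cI]; split; exact: continuous_measurable_operiod. Qed.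

Lemma ccontinuous_bounded f : ccontinuous f ->
  exists2 B : R, 0 < B & forall t, operiod t -> cmod (f t) <= B.
Proof.
move=> cf; have [_ _ [B fB]] := ccontinuous_cbounded cf.
exists (`|B| + 1) => [|t /operiod_sub pt]; first by rewrite ltr_wpDl.
by rewrite (le_trans (fB t pt))// (le_trans (ler_norm B))// lerDl.
Qed.

Lemma cintegrable_mulr f h : ccontinuous f -> leb.-integrable operiod (EFin \o h) ->
  cintegrable leb operiod (fun t => f t * (h t)%:C).
Proof.
move=> cf ih; have [mR mI] := ccontinuous_measurable_operiod cf.
have [B B0 fB] := ccontinuous_bounded cf.
have mh : measurable_fun operiod h.
  by apply/measurable_EFinP; exact: measurable_int ih.
have iB : leb.-integrable operiod (EFin \o (fun t => B * `|h t|)).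
  by apply: integrableZr => //; exact: integrable_norm.
rewrite /cintegrable.
have -> : (fun t => complex.Re (f t * (h t)%:C)) = (fun t => complex.Re (f t) * h t).
  by apply/funext => t; rewrite ReM /= mulr0 subr0.
have -> : (fun t => complex.Im (f t * (h t)%:C)) = (fun t => complex.Im (f t) * h t).
  by apply/funext => t; rewrite ImM /= mulr0 add0r.
split.
- apply: (le_int_norm mO _ iB) => [|t Ot]; first exact: measurable_funM.
  rewrite normrM ler_wpM2r// (le_trans (ler_Re_cmod _))//.
  exact: fB.
- apply: (le_int_norm mO _ iB) => [|t Ot]; first exact: measurable_funM.
  rewrite normrM ler_wpM2r// (le_trans (ler_Im_cmod _))//.
  exact: fB.
Qed.

Lemma cintegral_mulr_cvg f (h_ : nat -> R -> R) h : ccontinuous f ->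
  (forall n, leb.-integrable operiod (EFin \o (h_ n))) ->
  leb.-integrable operiod (EFin \o h) ->
  \int[leb]_(t in operiod) `|h_ n t - h t| @[n --> \oo] --> (0 : R) ->
  ccvg (fun n => cintegral leb operiod (fun t => f t * (h_ n t)%:C))
    (cintegral leb operiod (fun t => f t * (h t)%:C)).
Proof.
move=> cf ih_ ih hc; have [B B0 fB] := ccontinuous_bounded cf.
apply: (@ccvg_squeeze _ _ _
  (fun n => 2 * (B * \int[leb]_(t in operiod) `|h_ n t - h t|))).
  rewrite -[X in _ --> X](mulr0 (2 * B)).
  by under eq_fun do rewrite mulrA; exact: cvgMr.
near=> n; have idiff := integrableBr mO (ih_ n) ih.
rewrite -(cintegralB mO); [|exact: cintegrable_mulr..].
have -> : (fun t => f t * (h_ n t)%:C - f t * (h t)%:C) =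
    (fun t => f t * (h_ n t - h t)%:C).
  by apply/funext => t; rewrite rmorphB mulrBr.
rewrite -(RintegralZl _ mO); last exact: integrable_norm idiff.
apply: (cmod_cintegral_le mO); first exact: cintegrable_mulr.
  by apply: (integrableZr mO); exact: integrable_norm idiff.
by move=> t Ot; rewrite cmodM cmodR ler_wpM2r// fB.
Unshelve. all: end_near. Qed.

Variable F : {poly C} -> {poly C} -> C.
Hypotheses (FT : toeplitz F) (Fpos : posdef F).
Local Notation P := (opoly F).
Local Notation Q := (opolyr F).
Local Notation N := (onorm2 F).
Local Notation al := (verb F).
Variables M1 M2 : R.
Hypothesis bv : forall n, \sum_(0 <= k < n) cmod (al k.+1 - al k) <= M1.
Hypothesis l2 : forall n, \sum_(0 <= k < n) cmod (al k) ^+ 2 <= M2.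
Hypothesis F11 : F 1 1 = 1.
Local Notation sw := (szego_weight F).

Let cbsw n := continuous_bsw FT Fpos (n := n).

Lemma szego_formula z : cmod z < 1 ->
  cexp (((4 * pi)^-1)%:C * cintegral leb operiod
    (fun t => skernel z t * (ln (sw t))%:C)) =
  (Num.sqrt (onorm2_lim F))%:C / opoly_lim F z.
Proof.
move=> z1; have cK := ccontinuous_skernel z1.
have zn1 : z != 1 by apply: contraTneq z1 => ->; rewrite cmod1 ltxx.
have il n : leb.-integrable operiod (EFin \o (fun t => ln (bsw F n t))).
  exact: continuous_integrable_operiod (continuous_ln_bsw FT Fpos (n := n)).
have H := cintegral_mulr_cvg cK il (integrable_ln_szego_weight FT Fpos bv l2 F11)
  (ln_bsw_cvg FT Fpos bv l2 F11).
have {}H := ccvg_cexp (ccvgM (ccvg_cst ((4 * pi)^-1)%:C) H).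
apply: ccvg_unique H _.
have E n : cexp (((4 * pi)^-1)%:C * cintegral leb operiod
    (fun t => skernel z t * (ln (bsw F n t))%:C)) = (Num.sqrt (N n))%:C / (Q n).[z].
  rewrite -(cexp_schwarz_bsw FT Fpos n z1) /schwarz /tint cintegral_operiod//.
    apply: (ccontinuous_measurable_operiod _).1; apply: ccontinuousM => //.
    by apply: ccontinuous_real; exact: continuous_ln_bsw.
  apply: (ccontinuous_measurable_operiod _).2; apply: ccontinuousM => //.
  by apply: ccontinuous_real; exact: continuous_ln_bsw.
under eq_fun do rewrite E.
apply: ccvgM.
  apply: ccvg_real; apply: continuous_cvg; first exact: sqrt_continuous.
  exact: (onorm2_cvg FT Fpos l2).
apply: ccvgV; first exact: (ccvg_opoly_lim FT Fpos bv l2 (ltW z1) zn1).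
exact: (opoly_lim_neq0 FT Fpos bv l2 (ltW z1) zn1).
Qed.

Lemma onorm2_le1 n : N n <= 1.
Proof.
elim: n => [|n IH]; last by rewrite (le_trans (onorm2_noninc FT Fpos n)).
by rewrite /onorm2 /= F11.
Qed.

Let a t : R := cmod (expi t - 1 : C).

Let ca : continuous a.
Proof.
apply: continuous_cmod; apply: ccontinuousD; first exact: ccontinuous_expi.
exact: ccontinuous_cst.
Qed.

Let a_le2 t : a t <= 2.
Proof. by rewrite /a (le_trans (cmodB _ _))// cmod_expi cmod1. Qed.

Let a2_le4 t : a t ^+ 2 <= 4.
Proof.
have a0 : 0 <= a t by exact: cmod_ge0.
by rewrite expr2; have := a_le2 t; nra.
Qed.

(* Mass of the Bernstein-Szego measures can only escape to the point [1], where
   the factor [|z - 1|^2] kills it. *)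
Lemma weighted_bsw_cvg :
  \int[leb]_(t in operiod) `|a t ^+ 2 * bsw F n t - a t ^+ 2 * sw t| @[n --> \oo]
    --> (0 : R).
Proof.
have [isw swpi] := integrable_szego_weight FT Fpos bv l2 F11.
have msw : measurable_fun operiod sw.
  by apply/measurable_EFinP; exact: measurable_int isw.
have mb n : measurable_fun operiod (bsw F n).
  exact: continuous_measurable_operiod (@cbsw n).
have ib n := continuous_integrable_operiod (@cbsw n).
have ma : measurable_fun operiod a by exact: continuous_measurable_operiod.
(* The cut-off vanishes within distance [d] of [1]; elsewhere both weights are at most [1 / c^2], so
   dominated convergence applies for each fixed [d]. *)
pose k (d : R) n t := Num.max (a t - d) 0 * `|bsw F n t - sw t|.
have mk d n : measurable_fun operiod (k d n).
  apply: measurable_funM.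
    by apply: measurable_maxr => //; exact: measurable_funB.
  by apply: measurableT_comp => //; exact: measurable_funB.
have kb d : 0 < d -> exists B : R, forall n t, operiod t -> `|k d n t| <= B.
  move=> d0; have [c [B0 [c0 H]]] := opolyr_bounds FT Fpos bv l2 d0.
  exists (2 * (2 / c ^+ 2)) => n t Ot; have [e1 en1] := expi_operiod Ot.
  have b1 m : d <= a t -> bsw F m t <= 1 / c ^+ 2.
    move=> da; have /andP[cQ _] := H _ e1 da m.
    rewrite /bsw ler_pM ?invr_ge0 ?exprn_ge0 ?cmod_ge0 ?onorm2_le1//.
      by rewrite ltW// onorm2_gt0.
    rewrite lef_pV2 ?posrE ?exprn_gt0// ?(lt_le_trans c0)//.
    by rewrite lerXn2r ?nnegrE ?cmod_ge0// ltW.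
  have w1 : d <= a t -> sw t <= 1 / c ^+ 2.
    move=> da; have cv := bsw_cvg FT Fpos bv l2 Ot; rewrite -(cvg_lim _ cv)//.
    by apply: limr_le; [exact: cvgP cv|near=> m; exact: b1].
  have [ad|da] := leP (a t) d.
    rewrite /k max_r ?subr_le0// mul0r normr0 mulr_ge0// divr_ge0// exprn_ge0//.
    exact: ltW.
  have := b1 n (ltW da); have := w1 (ltW da); have := bsw_gt0 FT Fpos n t.
  have := szego_weight_gt0 FT Fpos bv l2 Ot => s0 b0 s1 b2.
  rewrite /k normrM normr_id; apply: ler_pM => //.
    rewrite ger0_norm ?le_max ?lexx ?orbT// ge_max ler0n andbT.
    by have := a_le2 t; lra.
  by rewrite ler_norml; apply/andP; split; lra.
have ik d n : 0 < d -> leb.-integrable operiod (EFin \o k d n).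
  move=> d0; have [B kB] := kb d d0.
  apply: (le_int_norm mO (mk d n) _ (kB n)).
  by apply: measurable_bounded_integrable => //; exact: bounded_cst.
have kc d : 0 < d -> \int[leb]_(t in operiod) k d n t @[n --> \oo] --> (0 : R).
  move=> d0; have [B kB] := kb d d0.
  apply: (dominated_cvg0 mO (mk d) _ kB) => [|t Ot].
    by apply: measurable_bounded_integrable => //; exact: bounded_cst.
  rewrite -[X in _ --> X](mulr0 (Num.max (a t - d) 0)); apply: cvgMr.
  rewrite -[X in _ --> X](normr0 R) -(subrr (sw t)); apply: cvg_norm.
  by apply: cvgB; [exact: (bsw_cvg FT Fpos bv l2 Ot)|exact: cvg_cst].
have ig n : leb.-integrable operiod (EFin \o
    (fun t => `|a t ^+ 2 * bsw F n t - a t ^+ 2 * sw t|)).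
  apply: (le_int_norm mO _ (_ : leb.-integrable operiod (EFin \o (fun t => 4 * (bsw F n t + sw t))))).
  - apply: measurableT_comp => //; apply: measurable_funB; apply: measurable_funM => //;
    exact: measurable_funX.
  - apply: (integrableZr mO); exact: (eq_integrable mO) (integrableD mO (ib n) isw).
  move=> t Ot; rewrite normr_id -mulrBr normrM ger0_norm ?sqr_ge0//.
  have := bsw_gt0 FT Fpos n t; have := szego_weight_gt0 FT Fpos bv l2 Ot => s0 b0.
  apply: ler_pM; rewrite ?sqr_ge0//.
  by rewrite ler_norml; apply/andP; split; lra.
(* With [X = |w_n - w|], [a^2 X <= 2 a X <= 2 ((a - d)^+ + d) X]; the term [d X] is controlled by
   the total mass [4 pi] of the two weights. *)
have key d n : 0 < d -> \int[leb]_(t in operiod)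
    `|a t ^+ 2 * bsw F n t - a t ^+ 2 * sw t| <=
    2 * (\int[leb]_(t in operiod) k d n t + d * (4 * pi)).
  move=> d0.
  have iS : leb.-integrable operiod (EFin \o (fun t => bsw F n t + sw t)).
    exact: (eq_integrable mO) (integrableD mO (ib n) isw).
  have iS2 := integrableZr mO d iS.
  have iK : leb.-integrable operiod (EFin \o (fun t => k d n t + d * (bsw F n t + sw t))).
    exact: (eq_integrable mO) (integrableD mO (ik d n d0) iS2).
  apply: (@le_trans _ _ (\int[leb]_(t in operiod)
      (2 * (k d n t + d * (bsw F n t + sw t))))).
    apply: le_Rintegral => //; first exact: (integrableZr mO).
    move=> t Ot; rewrite -mulrBr normrM ger0_norm ?sqr_ge0//.
    have := bsw_gt0 FT Fpos n t; have := szego_weight_gt0 FT Fpos bv l2 Ot => s0 b0.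
    have a0 : 0 <= a t by exact: cmod_ge0.
    have D : `|bsw F n t - sw t| <= bsw F n t + sw t.
      by rewrite ler_norml; apply/andP; split; lra.
    have D0 : 0 <= `|bsw F n t - sw t| by [].
    rewrite /k; set X := `|_| in D D0 *; set m := Num.max _ _.
    have m1 : a t <= m + d by rewrite -lerBlDr le_max lexx.
    have h1 : a t * X <= (m + d) * X by rewrite ler_wpM2r.
    have h2 : d * X <= d * (bsw F n t + sw t) by rewrite ler_wpM2l// ltW.
    have h3 : a t * (a t * X) <= 2 * (a t * X).
      by rewrite ler_wpM2r ?mulr_ge0.
    by rewrite expr2 -mulrA; lra.
  rewrite (RintegralZl _ mO iK) (RintegralD mO (ik d n d0) iS2).
  rewrite (RintegralZl _ mO iS) (RintegralD mO (ib n) isw).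
  rewrite (int_bsw FT Fpos F11) ler_pM2l// lerD2l ler_pM2l//; lra.
apply/cvgrPdist_le => e e0; have pi0 := pi_gt0 R.
have [d d0 dpi] : exists2 d : R, 0 < d & d * (4 * pi) = e / 4.
  exists (e / (16 * pi)); first by rewrite divr_gt0// mulr_gt0.
  have p0 : pi != 0 :> R by rewrite gt_eqF.
  by move: pi p0 => p p0; field.
have e4 : 0 < e / 4 by rewrite divr_gt0.
move/cvgrPdist_le : (kc d d0) => /(_ _ e4); apply: filterS => n.
rewrite !sub0r !normrN => hn; have := le_trans (ler_norm _) hn.
have := key d n d0; rewrite dpi ger0_norm; last exact: Rintegral_ge0.
by move: (Rintegral _ _ _) (Rintegral _ _ _) => I J; lra.
Unshelve. all: end_near. Qed.

(** The factor [|z - 1|^2] is split between the two arguments, and ['X^n] on the left supplies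
    negative powers. The corresponding moments of the Bernstein-Szego forms are equal to those of
    [F] from some index on. *)
Lemma weighted_moment n (p : {poly C}) :
  F ('X^n * ('X - 1)) (('X - 1) * p) = ((2 * pi)^-1)%:C *
  cintegral leb operiod (fun t => ((expi t)^*%C ^+ n * p.[expi t]) * (a t ^+ 2 * sw t)%:C).
Proof.
have cg : ccontinuous (fun t => (expi t)^*%C ^+ n * p.[expi t]).
  apply: ccontinuousM; last by apply: ccontinuous_horner; exact: ccontinuous_expi.
  by apply: ccontinuousX; apply: ccontinuousJ; exact: ccontinuous_expi.
have [isw _] := integrable_szego_weight FT Fpos bv l2 F11.
have msw : measurable_fun operiod sw.
  by apply/measurable_EFinP; exact: measurable_int isw.
have ca2 : continuous (fun t => a t ^+ 2).
  by under eq_fun do rewrite expr2; move=> t; apply: cvgM; exact: ca.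
have cab m : continuous (fun t => a t ^+ 2 * bsw F m t).
  by move=> t; apply: cvgM; [exact: ca2|exact: (@cbsw m)].
have iaw : leb.-integrable operiod (EFin \o (fun t => a t ^+ 2 * sw t)).
  apply: (le_int_norm mO _ (integrableZr mO 4 isw)).
    by apply: measurable_funM => //; exact: continuous_measurable_operiod.
  move=> t Ot; have s0 := szego_weight_gt0 FT Fpos bv l2 Ot.
  rewrite ger0_norm; last by rewrite mulr_ge0 ?sqr_ge0 ?(ltW s0).
  by rewrite ler_wpM2r ?a2_le4 ?(ltW s0).
have H := cintegral_mulr_cvg cg
  (fun m => continuous_integrable_operiod (cab m)) iaw weighted_bsw_cvg.
have {}H := ccvgM (ccvg_cst ((2 * pi)^-1)%:C) H.
apply: ccvg_unique _ H; set q1 := 'X^n * _; set q2 := _ * p.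
have E m : ((2 * pi)^-1)%:C * cintegral leb operiod
    (fun t => (expi t)^*%C ^+ n * p.[expi t] * (a t ^+ 2 * bsw F m t)%:C) =
    bsform F m q1 q2.
  rewrite /bsform cintegral_operiod.
  - congr (_ * _); apply: eq_tint => t; rewrite /q1 /q2 !hornerM hornerXn.
    have aE : (a t ^+ 2 * bsw F m t)%:C =
        (expi t - 1) * (expi t - 1)^*%C * (bsw F m t)%:C :> C.
      by rewrite [LHS]rmorphM mul_conjc.
    rewrite aE hornerD hornerN hornerX hornerC; move: (bsw F m t)%:C => u.
    by rewrite !(rmorphM, rmorphXn, rmorphB, rmorph1) /=; ring.
  - apply: (ccontinuous_measurable_operiod _).1; apply: ccontinuousM => //.
    exact: ccontinuous_real.
  - apply: (ccontinuous_measurable_operiod _).2; apply: ccontinuousM => //.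
    exact: ccontinuous_real.
under eq_fun do rewrite E.
have Ev : \forall m \near \oo, bsform F m q1 q2 = F q1 q2.
  near=> m; apply: bsform_moments => //.
    apply: (@leq_trans m); last exact: leqnSn.
    by near: m; exact: nbhs_infty_ge.
  apply: (@leq_trans m); last exact: leqnSn.
  by near: m; exact: nbhs_infty_ge.
apply: (@ccvg_squeeze _ _ _ (fun=> 0)); first exact: cvg_cst.
by apply: filterS Ev => m ->; rewrite subrr cmod0.
Unshelve. all: end_near. Qed.

End szego_formula.

(** * The Toeplitz form of a measure on the circle *)

Section complex_borel.
Variable R : realType.
Local Notation C := (R[i]^o).
Implicit Types (z : C) (U : set C).

Lemma open_cmodP U : open U <->
  (forall z, U z -> exists2 e : R, 0 < e & forall w, cmod (z - w) < e -> U w).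
Proof.
split.
  move=> oU z Uz; have /nbhs_ballP[e e0 eU] : nbhs z U by exact: open_nbhs_nbhs.
  have eE : e = (complex.Re e)%:C.
    by move: e0; rewrite /= ltcE /= => /andP[/eqP e0 _]; case: e e0 {eU} => a b /= ->.
  exists (complex.Re e); first by move: e0; rewrite /= eE ltcR.
  by move=> w wz; apply: eU; rewrite /ball/= normcmod eE ltcR.
move=> H; rewrite openE => z Uz; have [e e0 eU] := H z Uz.
apply/nbhs_ballP; exists e%:C; first by rewrite /= ltcR.
by move=> w; rewrite /ball/= normcmod ltcR; exact: eU.
Qed.

Lemma open_measurableC U : open U -> measurable (U : set (borelC R)).
Proof. by move=> oU; exact: sub_sigma_algebra. Qed.

Lemma measurable_continuousC (f : C -> R) :
  (forall z (e : R), 0 < e -> exists2 d : R, 0 < d &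
     forall w, cmod (z - w) < d -> `|f z - f w| < e) ->
  measurable_fun setT (f : borelC R -> R).
Proof.
move=> cf; apply: (measurability _ (RGenOInfty.measurableE R)).
move=> _ [_ [x ->] <-]; rewrite setTI.
apply: open_measurableC; apply/open_cmodP => z /=; rewrite in_itv/= andbT => xz.
have [|d d0 dP] := cf z (f z - x); first by rewrite subr_gt0.
exists d => // w /dP; rewrite ltr_norml in_itv/= andbT; lra.
Qed.

Lemma measurable_ReC : measurable_fun setT (fun z : borelC R => complex.Re (z : C)).
Proof.
apply: measurable_continuousC => z e e0; exists e => // w.
by apply: le_lt_trans; rewrite -ReN -ReD ler_Re_cmod.
Qed.

Lemma measurable_ImC : measurable_fun setT (fun z : borelC R => complex.Im (z : C)).
Proof.
apply: measurable_continuousC => z e e0; exists e => // w.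
by apply: le_lt_trans; rewrite -ImN -ImD ler_Im_cmod.
Qed.

Lemma measurable_circle : measurable (@unit_circle R : set (borelC R)).
Proof.
have -> : (@unit_circle R : set (borelC R)) =
    setT `&` (fun z : borelC R => complex.Re (z : C) ^+ 2 + complex.Im (z : C) ^+ 2)
      @^-1` [set 1].
  rewrite setTI; apply/seteqP; split => z /=; rewrite unit_circleE.
    by move=> z1; rewrite -cmod_sqr z1 expr1n.
  rewrite -cmod_sqr => /eqP; rewrite -[X in _ == X](expr1n _ 2).
  by rewrite eqrXn2 ?cmod_ge0// => /eqP.
have mf : measurable_fun setT (fun z : borelC R =>
    complex.Re (z : C) ^+ 2 + complex.Im (z : C) ^+ 2).
  apply: measurable_funD; apply: measurable_funX;
  [exact: measurable_ReC|exact: measurable_ImC].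
by apply: mf => //; exact: measurable_set1.
Qed.

End complex_borel.

Section opuc_form.
Variable R : realType.
Local Notation C := (R[i]^o).
Local Notation circle := (@unit_circle R : set (borelC R)).
Variable mu : probability (borelC R) R.
Hypotheses (mu_circle : mu circle = 1%E) (mu_nontrivial : nontrivial mu).
Implicit Types (p q : {poly C}) (z : C).

Let mC := @measurable_circle R.

Lemma circle_lty : (mu circle < +oo)%E.
Proof. by rewrite mu_circle ltry. Qed.

Lemma cbounded_id : cbounded circle (fun z : borelC R => z : C).
Proof.
split.
- by apply: measurable_funTS; exact: measurable_ReC.
- by apply: measurable_funTS; exact: measurable_ImC.
- by exists 1 => z /unit_circleE ->.
Qed.

Lemma cbounded_poly p q : cbounded circle (fun z : borelC R => (p.[z : C])^*%C * q.[z : C]).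
Proof.
by apply: cboundedM; [apply: cboundedJ|]; apply: cbounded_horner; exact: cbounded_id.
Qed.

Definition mform p q : C := inner mu (fun z => p.[z]) (fun z => q.[z]).

Let ipq p q := cbounded_integrable mC circle_lty (cbounded_poly p q).

Lemma toeplitz_mform : toeplitz mform.
Proof.
split.
- move=> p a q r; rewrite /mform /inner -(cintegralZ mC a (ipq p q)).
  rewrite -(cintegralD mC (cintegrableZ mC a (ipq p q)) (ipq p r)).
  by apply: eq_cintegral => z _; rewrite hornerD hornerZ; ring.
- move=> p q; rewrite /mform /inner -(cintegralJ mC (ipq p q)).
  by apply: eq_cintegral => z _; rewrite rmorphM/= conjcK mulrC.
- move=> p q; rewrite /mform /inner; apply: eq_cintegral => z.
  rewrite inE => /unit_circleE z1; rewrite !hornerM !hornerX rmorphM/=.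
  have zz : z^*%C * z = 1 :> C by rewrite mulrC mul_conjc z1 expr1n.
  by rewrite mulrACA zz mul1r.
Qed.

Lemma mform11 : mform 1 1 = 1.
Proof.
rewrite /mform /inner.
rewrite (@eq_cintegral _ _ _ _ _ _ (fun=> 1)); last first.
  by move=> z _; rewrite !hornerC rmorph1 mulr1.
by rewrite cintegral_cst// [X in fine X]mu_circle mul1r.
Qed.

Lemma support_neq0 p : p != 0 -> exists2 z, msupport mu z & p.[z] != 0.
Proof.
move=> p0; apply: contrapT => H; apply: mu_nontrivial.
have [s sE] := @closed_field_poly_normal (R[i] : closedFieldType) p.
apply: (@sub_finite_set _ _ [set` s]); last exact: finite_seq.
move=> z mz; have : p.[z] = 0.
  by apply/eqP/negPn/negP => pz; apply: H; exists z.
move/eqP; rewrite -/(root p z) sE rootZ ?lead_coef_eq0//.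
by rewrite root_prod_XsubC.
Qed.

(** Infinite support contains a point where [p] does not vanish. A Lipschitz bound keeps [|p| >= e]
    on the circle near it, and that neighbourhood has positive mass because [mu] is carried by the
    circle. *)
Lemma posdef_mform : posdef mform.
Proof.
move=> p p0; have [z mz pz] := support_neq0 p0.
have mU (U : set C) : open U -> U z -> (0 < mu (U `&` circle : set (borelC R)))%E.
  move=> oU Uz; have mU := open_measurableC oU.
  have := mz U oU Uz; rewrite (measureDI mu mU mC).
  rewrite [X in (X + _)%E](_ : _ = 0%E) ?add0e//.
  apply/eqP; rewrite eq_le measure_ge0 andbT.
  rewrite (@le_trans _ _ (mu (~` circle)))//.
    apply: le_measure; [|rewrite inE; exact: measurableC|by move=> w []].
    by rewrite inE; exact: measurableD.
  by rewrite probability_setC// mu_circle subee.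
have z1 : cmod z = 1.
  apply: contrapT => z1.
  have oC : open (~` (@unit_circle R)).
    apply/open_cmodP => w /= /unit_circleE w1.
    exists `|cmod w - 1|; first by rewrite normr_gt0 subr_eq0; exact/eqP.
    move=> v wv; apply/unit_circleE => v1.
    by have := cmod_dist w v; rewrite v1 leNgt wv.
  have := mU _ oC (fun H => z1 ((unit_circleE z).1 H)).
  by rewrite setICl measure0 ltxx.
pose e := cmod p.[z] / 2; have e0 : 0 < e by rewrite divr_gt0// cmod_gt0.
have [L [L0 pL]] := horner_lipschitz p.
pose U : set C := [set w | cmod (z - w) < e / L].
have oU : open U.
  apply/open_cmodP => w Uw; exists (e / L - cmod (z - w)); first by rewrite subr_gt0.
  move=> v wv; rewrite /U/=; have -> : z - v = (z - w) + (w - v) by ring.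
  by apply: (le_lt_trans (cmodD _ _)); lra.
have Uz : U z by rewrite /U/= subrr cmod0 divr_gt0.
pose A : set (borelC R) := U `&` circle.
have muA : (0 < mu A)%E := mU U oU Uz.
have mA : measurable A by apply: measurableI => //; exact: open_measurableC.
have pA w : A w -> e ^+ 2 <= cmod p.[w] ^+ 2.
  case=> Uw /unit_circleE w1; rewrite lerXn2r ?nnegrE ?cmod_ge0 ?(ltW e0)//.
  have := pL z w; rewrite z1 w1 => /(_ (lexx _) (lexx _)).
  have : L * cmod (z - w) <= e by rewrite mulrC -ler_pdivlMr// ltW.
  have := cmodD (p.[z] - p.[w]) p.[w]; rewrite subrK /e; lra.
have E : complex.Re (mform p p) = \int[mu]_(w in circle) (cmod (p.[w]) ^+ 2).
  rewrite /mform /inner /=; apply: eq_Rintegral => w _.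
  by rewrite mulrC mul_conjc.
have [ire _] := ipq p p.
have ic : mu.-integrable circle (EFin \o (fun w => cmod (p.[w : C]) ^+ 2)).
  by apply: eq_integrable ire => // w _ /=; rewrite mulrC mul_conjc.
rewrite E -lte_fin -integrable_int//.
apply: (@lt_le_trans _ _ (\int[mu]_(w in A) (e ^+ 2)%:E)%E).
  rewrite integral_cst//; apply: mule_gt0 => //.
  by rewrite lte_fin; exact: exprn_gt0.
apply: (@le_trans _ _ (\int[mu]_(w in A) (cmod (p.[w : C]) ^+ 2)%:E)%E).
  apply: ge0_le_integral => //.
  - by move=> w _; rewrite lee_fin sqr_ge0.
  - by apply: (measurable_funS mC _ (measurable_int _ ic)) => w [].
apply: ge0_subset_integral => //.
- exact: measurable_int ic.
- by move=> w _; rewrite lee_fin sqr_ge0.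
- by move=> w [].
Qed.

Lemma mform_Xn k (p : {poly C}) :
  inner mu (fun z => z ^+ k) (fun z => p.[z]) = mform 'X^k p.
Proof. by congr (inner mu _ _); apply/funext => z; rewrite hornerXn. Qed.

Lemma monic_orthogonalE n p : monic_orthogonal mu n p <-> orth mform n p.
Proof.
split=> [[mp sp op]|[mp sp op]]; split => // k kn; first by rewrite -mform_Xn op.
by rewrite mform_Xn op.
Qed.

(** [Phi] is picked by a choice operator; existence and uniqueness of the monic orthogonal
    polynomial identify it with the recursive one. *)
Lemma PhiE n : Phi mu n = opoly mform n.
Proof.
apply: xget_unique.
  by apply/monic_orthogonalE; exact: (orth_opoly toeplitz_mform posdef_mform).
move=> q /monic_orthogonalE oq.
exact: (orth_unique toeplitz_mform posdef_mform oq (orth_opoly toeplitz_mform posdef_mform n)).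
Qed.

Lemma Phi_starE n : Phi_star mu n = opolyr mform n.
Proof. by rewrite /Phi_star PhiE. Qed.

(** The recursion determines the coefficient because the reversed polynomial, being 1 at [0], is not
    zero. *)
Lemma verblunskyE n : verblunsky mu n = verb mform n.
Proof.
have rE := opolyS mform n.
apply: xget_unique => [|a]; rewrite /= !PhiE Phi_starE// => aE.
have : (a^*%C - (verb mform n)^*%C) *: opolyr mform n = 0.
  rewrite scalerBl; move: aE; rewrite rE => /(congr1 (fun x => 'X * opoly mform n - x)).
  by rewrite !subKr => ->; rewrite subrr.
move/eqP; rewrite scaler_eq0 subr_eq0 => /orP[/eqP/(congr1 conjc)|/eqP q0].
  by rewrite !conjcK.
have := opolyr0 toeplitz_mform posdef_mform n; rewrite q0 horner0 => /eqP.
by rewrite eq_sym oner_eq0.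
Qed.

Lemma L2norm_opoly n :
  L2norm mu (fun x => (opoly mform n).[x]) = (Num.sqrt (onorm2 mform n))%:C.
Proof.
have N0 := onorm2_gt0 toeplitz_mform posdef_mform n.
rewrite /L2norm -/(mform _ _) (opoly_self toeplitz_mform).
rewrite -[X in sqrtC X%:C](sqr_sqrtr (ltW N0)) rmorphXn sqrCK//.
by rewrite lecR sqrtr_ge0.
Qed.

Lemma phi_starE n z : phi_star mu n z =
  (opolyr mform n).[z] / (Num.sqrt (onorm2 mform n))%:C.
Proof. by rewrite /phi_star Phi_starE PhiE L2norm_opoly. Qed.

End opuc_form.

(** * Identification of the density *)

Section step_polynomials.
Variable R : realType.
Implicit Types (x y u : R) (n : nat).

Lemma bernoulli_ge u n : 0 <= u -> 1 + n%:R * u <= (1 + u) ^+ n.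
Proof.
move=> u0; elim: n => [|n IH]; first by rewrite mul0r addr0.
rewrite exprS -natr1 mulrDl mul1r.
have nu : 0 <= n%:R * u by rewrite mulr_ge0.
have : (1 + u) * (1 + n%:R * u) <= (1 + u) * (1 + u) ^+ n.
  by rewrite ler_wpM2l// addr_ge0.
have : 0 <= u * (n%:R * u) by rewrite mulr_ge0.
lra.
Qed.

Lemma bernoulli_le u n : 0 <= u -> u <= 1 -> 1 - n%:R * u <= (1 - u) ^+ n.
Proof.
move=> u0 u1; elim: n => [|n IH]; first by rewrite mul0r subr0.
rewrite exprS -natr1 mulrDl mul1r.
have : (1 - u) * (1 - n%:R * u) <= (1 - u) * (1 - u) ^+ n.
  by rewrite ler_wpM2l// subr_ge0.
have : 0 <= u * (n%:R * u) by rewrite !mulr_ge0.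
lra.
Qed.

Lemma inv_nat_cvg0 : (1 + n%:R)^-1 @[n --> \oo] --> (0 : R).
Proof.
rewrite (_ : (fun _ => _) = @harmonic R); first exact: cvg_harmonic.
by apply/funext => n; rewrite /harmonic/= nat1r.
Qed.

(** With [r = sqrt q] and [1 / r = 1 + h], Bernoulli bounds [n r^n] by [1 / h], and the second
    factor [r^n] still tends to 0. *)
Lemma nat_mul_expr_cvg0 (q : R) : 0 <= q -> q < 1 ->
  n%:R * q ^+ n @[n --> \oo] --> (0 : R).
Proof.
rewrite le_eqVlt => /predU1P[<- _|q0 q1].
  apply: cvg_near_cst; near=> n; have n0 : (0 < n)%N by near: n; exists 1%N.
  by rewrite expr0n gtn_eqF// mulr0.
pose r := Num.sqrt q; have r0 : 0 < r by rewrite sqrtr_gt0.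
have r1 : r < 1 by rewrite -sqrtr1 ltr_sqrt.
pose h := r^-1 - 1; have h0 : 0 < h by rewrite subr_gt0 invf_gt1.
apply: (@squeeze_cvgr nat \oo _ R (fun=> 0) (fun n => h^-1 * r ^+ n)).
- near=> n; rewrite mulr_ge0 ?exprn_ge0 ?(ltW q0)//=.
  have rn : n%:R * h <= r ^- n.
    have hE : 1 + h = r^-1 by rewrite /h addrC subrK.
    have := bernoulli_ge n (ltW h0); rewrite hE exprVn; apply: le_trans.
    by rewrite lerDr.
  have rn0 : 0 < r ^+ n by rewrite exprn_gt0.
  have qE : q ^+ n = r ^+ n * r ^+ n by rewrite -exprMn -expr2 sqr_sqrtr// ltW.
  rewrite qE mulrA ler_wpM2r ?(ltW rn0)// -[leRHS]mul1r ler_pdivlMr// mulrAC.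
  by rewrite -ler_pdivlMr// mul1r.
- exact: cvg_cst.
- rewrite -[X in _ --> X](mulr0 h^-1); apply: cvgMr; apply: cvg_expr.
  by rewrite ger0_norm// ltW.
Unshelve. all: end_near. Qed.

(* Polynomials that converge on [[0, 1]], boundedly, to the indicator function
   of [[1/2, 1]]. *)
Definition step n y : R := 1 - (1 - y ^+ n) ^+ (n * 2 ^ n)%N.

Lemma step_bounds n y : 0 <= y -> y <= 1 -> 0 <= step n y <= 1.
Proof.
move=> y0 y1; have yn0 : 0 <= y ^+ n by rewrite exprn_ge0.
have yn1 : y ^+ n <= 1 by rewrite exprn_ile1.
apply/andP; split; first by rewrite subr_ge0 exprn_ile1 ?subr_ge0// gerBl.
by rewrite gerBl exprn_ge0// subr_ge0.
Qed.

(** The exponent [M = n 2^n] turns [M y^n] into [n (2 y)^n]. If [y >= 1/2] this is at least [n], and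
    [(1 - y^n)^M <= (1 + y^n)^(-M) <= 1 / (1 + n)]. If [y < 1/2] it tends to 0 and bounds
    [step n y]. *)
Lemma step_cvg y : 0 <= y -> y <= 1 ->
  step n y @[n --> \oo] --> (if 2^-1 <= y then 1 else 0 : R).
Proof.
move=> y0 y1; case: ifPn => [y2|]; last rewrite -ltNge => y2.
  rewrite -[X in _ --> X]subr0; apply: cvgB; first exact: cvg_cst.
  apply: (@squeeze_cvgr nat \oo _ R (fun=> 0) (fun n => (1 + n%:R)^-1)).
  - near=> n; have yn0 : 0 <= y ^+ n by rewrite exprn_ge0.
    have yn1 : y ^+ n <= 1 by rewrite exprn_ile1.
    rewrite exprn_ge0 ?subr_ge0//= -[leRHS]mul1r ler_pdivlMr ?ltr_pwDl//.
    set M := (n * 2 ^ n)%N.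
    have nM : n%:R <= M%:R * y ^+ n.
      rewrite /M natrM natrX -mulrA -exprMn ler_peMr//.
      by rewrite exprn_ege1// -ler_pdivrMl// mulr1.
    have := bernoulli_ge M yn0; have : (1 - y ^+ n) ^+ M * (1 + y ^+ n) ^+ M <= 1.
      rewrite -exprMn exprn_ile1//; nra.
    have p0 : 0 <= (1 - y ^+ n) ^+ M by rewrite exprn_ge0// subr_ge0.
    move=> h1 h2; apply: le_trans h1; rewrite ler_wpM2l//.
    by apply: le_trans h2; rewrite lerD2l.
  - exact: cvg_cst.
  - exact: inv_nat_cvg0.
apply: (@squeeze_cvgr nat \oo _ R (fun=> 0) (fun n => n%:R * (2 * y) ^+ n)).
- near=> n; have /andP[-> _] /= := step_bounds n y0 y1.
  have yn0 : 0 <= y ^+ n by rewrite exprn_ge0.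
  have yn1 : y ^+ n <= 1 by rewrite exprn_ile1.
  rewrite /step lerBlDr -lerBlDl; apply: le_trans (bernoulli_le _ yn0 yn1).
  by rewrite natrM natrX -mulrA -exprMn.
- exact: cvg_cst.
- by apply: nat_mul_expr_cvg0; lra.
Unshelve. all: end_near. Qed.

End step_polynomials.

Section trigpoly.
Variable R : realType.
Local Notation C := (R[i]^o).
Implicit Types (g h : C -> C) (z : C).

(** A Laurent polynomial, in exactly the shape that [weighted_moment] integrates. *)
Definition trigpoly g := exists n (p : {poly C}),
  forall z, cmod z = 1 -> g z = z^*%C ^+ n * p.[z].

Lemma trigpoly_cst (a : C) : trigpoly (fun=> a).
Proof. by exists 0%N, a%:P => z _; rewrite hornerC mul1r. Qed.

Lemma trigpoly_id : trigpoly id.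
Proof. by exists 0%N, 'X => z _; rewrite hornerX mul1r. Qed.

Lemma trigpoly_conj : trigpoly (fun z => z^*%C).
Proof. by exists 1%N, 1 => z _; rewrite hornerC mulr1. Qed.

Lemma trigpolyD g h : trigpoly g -> trigpoly h -> trigpoly (fun z => g z + h z).
Proof.
move=> [n [p gE]] [m [q hE]]; exists (n + m)%N, ('X^m * p + 'X^n * q) => z z1.
have zz : z^*%C * z = 1 by rewrite mulrC mul_conjc z1 expr1n.
rewrite gE// hE// hornerD !hornerM !hornerXn exprD mulrDr; congr (_ + _).
  by rewrite mulrA -[_ * _ * z ^+ m]mulrA -exprMn zz expr1n mulr1.
by rewrite mulrA -[_ * _ * z ^+ n]mulrAC -exprMn zz expr1n mul1r.
Qed.

Lemma trigpolyM g h : trigpoly g -> trigpoly h -> trigpoly (fun z => g z * h z).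
Proof.
move=> [n [p gE]] [m [q hE]]; exists (n + m)%N, (p * q) => z z1.
by rewrite gE// hE// hornerM exprD mulrACA.
Qed.

Lemma trigpolyX g n : trigpoly g -> trigpoly (fun z => g z ^+ n).
Proof.
move=> tg; elim: n => [|n IH].
  by under eq_fun do rewrite expr0; exact: trigpoly_cst.
by under eq_fun do rewrite exprS; exact: trigpolyM.
Qed.

Lemma trigpoly_sum (I : Type) (s : seq I) (f : I -> C -> C) :
  (forall i, trigpoly (f i)) -> trigpoly (fun z => \sum_(i <- s) f i z).
Proof.
move=> tf; elim: s => [|i s IH].
  by under eq_fun do rewrite big_nil; exact: trigpoly_cst.
by under eq_fun do rewrite big_cons; exact: trigpolyD.
Qed.

Definition rtrig (h : C -> R) := trigpoly (fun z => (h z)%:C).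

Lemma rtrig_cst (a : R) : rtrig (fun=> a).
Proof. exact: trigpoly_cst. Qed.

Lemma rtrigD (h k : C -> R) : rtrig h -> rtrig k -> rtrig (fun z => h z + k z).
Proof. by move=> th tk; rewrite /rtrig; under eq_fun do rewrite rmorphD; exact: trigpolyD. Qed.

Lemma rtrigM (h k : C -> R) : rtrig h -> rtrig k -> rtrig (fun z => h z * k z).
Proof. by move=> th tk; rewrite /rtrig; under eq_fun do rewrite rmorphM; exact: trigpolyM. Qed.

Lemma rtrigX (h : C -> R) n : rtrig h -> rtrig (fun z => h z ^+ n).
Proof. by move=> th; rewrite /rtrig; under eq_fun do rewrite rmorphXn; exact: trigpolyX. Qed.

Lemma rtrigB (h k : C -> R) : rtrig h -> rtrig k -> rtrig (fun z => h z - k z).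
Proof.
move=> th tk; under eq_fun do rewrite -mulN1r.
by apply: rtrigD => //; apply: rtrigM => //; exact: rtrig_cst.
Qed.

Lemma rtrig_sum (I : Type) (s : seq I) (f : I -> C -> R) :
  (forall i, rtrig (f i)) -> rtrig (fun z => \sum_(i <- s) f i z).
Proof.
by move=> tf; rewrite /rtrig; under eq_fun do rewrite rmorph_sum; exact: trigpoly_sum.
Qed.

Lemma rtrig_Re : rtrig (fun z => complex.Re z).
Proof.
rewrite /rtrig; under eq_fun do rewrite ReJ_add.
apply: trigpolyM; last exact: trigpoly_cst.
by apply: trigpolyD; [exact: trigpoly_id|exact: trigpoly_conj].
Qed.

Lemma rtrig_Im : rtrig (fun z => complex.Im z).
Proof.
rewrite /rtrig; under eq_fun do rewrite ImJ_sub -[X in _ - X]mul1r -mulNr.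
apply: trigpolyM; last exact: trigpoly_cst.
apply: trigpolyM; last exact: trigpoly_cst.
apply: trigpolyD; first exact: trigpoly_conj.
by apply: trigpolyM; [exact: trigpoly_cst|exact: trigpoly_id].
Qed.

Lemma rtrig_step (h : C -> R) n : rtrig h -> rtrig (fun z => step n (h z)).
Proof.
move=> th; apply: rtrigB; first exact: rtrig_cst.
by apply: rtrigX; apply: rtrigB; [exact: rtrig_cst|exact: rtrigX].
Qed.

End trigpoly.

(** * Measures on the circle with a density in the angle *)

Section arc_measure.
Variable R : realType.
Local Notation C := (R[i]^o).
Local Notation operiod := (`]0%R, (2 * pi)%R[%classic : set (measurableTypeR R)).
Local Notation leb := (@lebesgue_measure R).
Implicit Types (t : R) (A : set (borelC R)).

Lemma measurable_expi :
  measurable_fun setT (@expi R : measurableTypeR R -> borelC R).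
Proof.
have H := @measurability _ _ (measurableTypeR R) (borelC R) setT
  (@expi R : measurableTypeR R -> borelC R)
  (@open (complex R)^o : set (set (borelC R))) erefl.
apply: H.
move=> _ [U oU <-]; rewrite setTI; apply: open_measurable.
rewrite openE => t /= Ut; have [e e0 eU] := (open_cmodP _).1 oU _ Ut.
have ca : continuous (fun s => cmod (expi t - expi s : C)).
  apply: continuous_cmod; apply: ccontinuousD; first exact: ccontinuous_cst.
  under eq_fun do rewrite -mulN1r.
  by apply: ccontinuousM; [exact: ccontinuous_cst|exact: ccontinuous_expi].
have /cvgrPdist_lt/(_ _ e0) := ca t.
rewrite subrr cmod0; apply: filterS => s; rewrite sub0r normrN => es.
by apply: eU; rewrite (le_lt_trans _ es)// ler_norm.
Qed.

Lemma measurable_preimage_expi A : measurable A ->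
  measurable (operiod `&` (@expi R : measurableTypeR R -> borelC R) @^-1` A).
Proof.
move=> mA; apply: measurableI; first exact: measurable_operiod.
by rewrite -[X in measurable X]setTI; exact: measurable_expi.
Qed.

Variable h : R -> R.
Hypotheses (mh : measurable_fun operiod h) (h0 : forall t, operiod t -> 0 <= h t).

(** The image of [h(t) dt] under [expi]; taken over the open period, it gives no mass to the point
    [1]. *)
Definition arcm (A : set (borelC R)) : \bar R :=
  (\int[leb]_(t in operiod `&` (@expi R : measurableTypeR R -> borelC R) @^-1` A) (h t)%:E)%E.

Let arcm0 : arcm set0 = 0%E.
Proof. by rewrite /arcm preimage_set0 setI0 integral_set0. Qed.

Let arcm_ge0 A : (0 <= arcm A)%E.
Proof. by apply: integral_ge0 => t [Ot _]; rewrite lee_fin h0. Qed.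

Let arcm_sigma_additive : semi_sigma_additive arcm.
Proof.
move=> E mE tE mUE; rewrite /arcm preimage_bigcup setI_bigcupr.
have H := @ge0_integral_bigcup _ _ _ leb
  (fun k => operiod `&` (@expi R : measurableTypeR R -> borelC R) @^-1` (E k))
  (fun t => (h t)%:E) (fun k => measurable_preimage_expi (mE k)).
rewrite /= in H; rewrite H.
- apply: is_cvg_nneseries => n _ _; exact: arcm_ge0.
- apply: (measurable_funS (@measurable_operiod R)); last by apply/measurable_EFinP.
  by move=> t [k _ []].
- by move=> t [k _ [Ot _]]; rewrite lee_fin h0.
- apply/trivIsetP => i j _ _ ij; apply/seteqP; split => // t [[_ Ei] [_ Ej]].
  have : (E i `&` E j) (expi t) by [].
  by move/trivIsetP : tE => /(_ _ _ Logic.I Logic.I ij) ->.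
Qed.

HB.instance Definition _ := isMeasure.Build _ _ _ arcm
  arcm0 arcm_ge0 arcm_sigma_additive.

Definition arc_measure : {measure set (borelC R) -> \bar R} := arcm.

End arc_measure.

(** * Quadrants as a generating pi-system of the Borel sets of the plane *)

Section quadrants.
Variable R : realType.
Local Notation C := (R[i]^o).

Definition quadrant (a b : R) : set (borelC R) :=
  [set z : borelC R | a <= complex.Re (z : C) /\ b <= complex.Im (z : C)].

Definition quadrants : set (set (borelC R)) :=
  [set Q | exists a b, Q = quadrant a b].

Lemma setI_closed_quadrants : setI_closed quadrants.
Proof.
move=> _ _ [a [b ->]] [a' [b' ->]]; exists (Num.max a a'), (Num.max b b').
apply/seteqP; split => z; rewrite /quadrant/= !ge_max.
  by move=> [[-> ->] [-> ->]].
by move=> [/andP[-> ->] /andP[-> ->]].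
Qed.

Lemma measurable_quadrant a b : measurable (quadrant a b).
Proof.
have -> : quadrant a b =
    (setT `&` (fun z : borelC R => complex.Re (z : C)) @^-1` `[a, +oo[%classic) `&`
    (setT `&` (fun z : borelC R => complex.Im (z : C)) @^-1` `[b, +oo[%classic).
  rewrite !setTI; apply/seteqP; split => z; rewrite /quadrant/= !in_itv/= !andbT;
  by move=> [].
by apply: measurableI; [apply: measurable_ReC|apply: measurable_ImC].
Qed.

Let TQ := g_sigma_algebraType quadrants.

Let mhalfRe (a : R) : measurable ([set z : TQ | a <= complex.Re (z : C)]).
Proof.
have -> : [set z : TQ | a <= complex.Re (z : C)] =
    \bigcup_n (quadrant a (- n%:R) : set TQ).
  apply/seteqP; split => z /=; last by move=> [n _ []].
  move=> az; exists (Num.truncn (`|complex.Im (z : C)|)).+1 => //; split => //=.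
  rewrite lerNl (le_trans _ (ltW (truncnS_gt _)))//.
  by rewrite -normrN ler_norm.
apply: bigcup_measurable => n _; apply: sub_sigma_algebra.
by exists a, (- n%:R).
Qed.

Let mhalfIm (b : R) : measurable ([set z : TQ | b <= complex.Im (z : C)]).
Proof.
have -> : [set z : TQ | b <= complex.Im (z : C)] =
    \bigcup_n (quadrant (- n%:R) b : set TQ).
  apply/seteqP; split => z /=; last by move=> [n _ []].
  move=> az; exists (Num.truncn (`|complex.Re (z : C)|)).+1 => //; split => //=.
  rewrite lerNl (le_trans _ (ltW (truncnS_gt _)))//.
  by rewrite -normrN ler_norm.
apply: bigcup_measurable => n _; apply: sub_sigma_algebra.
by exists (- n%:R), b.
Qed.

Let box (p q r : R) : set TQ :=
  ([set z : TQ | p <= complex.Re (z : C)] `\` [set z : TQ | p + r <= complex.Re (z : C)]) `&`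
  ([set z : TQ | q <= complex.Im (z : C)] `\` [set z : TQ | q + r <= complex.Im (z : C)]).

Let mbox p q r : measurable (box p q r).
Proof. by apply: measurableI; apply: measurableD. Qed.

(** An open set is a countable union of half-open squares with rational corner and side [1 / (k+1)];
    differences of half-planes cut out each square. *)
Lemma open_quadrants (U : set C) : open U -> measurable (U : set TQ).
Proof.
move=> oU; pose B (p q : rat) (k : nat) : set TQ :=
  if `[< box (ratr p) (ratr q) k.+1%:R^-1 `<=` (U : set TQ) >]
  then box (ratr p) (ratr q) k.+1%:R^-1 else set0.
have -> : (U : set TQ) = \bigcup_p \bigcup_q \bigcup_k B p q k.
  apply/seteqP; split => z; last first.
    by move=> [p _ [q _ [k _]]]; rewrite /B; case: asboolP => // bU /bU.
  move=> Uz; have [e e0 eU] := (open_cmodP U).1 oU z Uz.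
  pose k := Num.truncn (2 / e); pose r : R := k.+1%:R^-1.
  have r0 : 0 < r by rewrite invr_gt0.
  have re : 2 * r < e.
    by rewrite ltr_pdivrMr// mulrC -ltr_pdivrMr// truncnS_gt.
  have ratb (x : R) : exists p : rat, ratr p < x < ratr p + r.
    have [|p] := @rat_in_itvoo R (x - r) x; first by rewrite gtrBl.
    by rewrite in_itv/= => /andP[p1 p2]; exists p; rewrite p2/= -ltrBlDr.
  have [p /andP[p1 p2]] := ratb (complex.Re (z : C)).
  have [q /andP[q1 q2]] := ratb (complex.Im (z : C)).
  exists p => //; exists q => //; exists k => //; rewrite /B -/r.
  have zb : box (ratr p) (ratr q) r z.
    by split; split => /=; rewrite ?(ltW p1) ?(ltW q1)//; apply/negP; rewrite -ltNge.
  case: asboolP => // nb; exfalso; apply: nb => w [[/= w1 /negP w2] [/= w3 /negP w4]].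
  rewrite -ltNge in w2; rewrite -ltNge in w4.
  apply: eU; apply: (le_lt_trans (cmod_le_ReIm _)).
  rewrite !ReD !ImD !ReN !ImN.
  have b1 : `|complex.Re (z : C) - complex.Re (w : C)| < r.
    by rewrite ltr_norml; apply/andP; split; lra.
  have b2 : `|complex.Im (z : C) - complex.Im (w : C)| < r.
    by rewrite ltr_norml; apply/andP; split; lra.
  lra.
apply: bigcupT_measurable_rat => p; apply: bigcupT_measurable_rat => q.
apply: bigcup_measurable => k _; rewrite /B; case: asboolP => _; first exact: mbox.
exact: measurable0.
Qed.

Lemma borelC_quadrants : (measurable : set (set (borelC R))) = <<s quadrants >>.
Proof.
apply/seteqP; split => A.
  apply: smallest_sub; first exact: smallest_sigma_algebra.
  by move=> U; exact: open_quadrants.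
apply: smallest_sub; first exact: sigma_algebra_measurable.
by move=> _ [a [b ->]]; exact: measurable_quadrant.
Qed.

(** Reduces equality of measures to products of two one-sided indicators in the coordinates, which
    the step polynomials approximate. *)
Lemma measure_unique_quadrants (m1 m2 : {measure set (borelC R) -> \bar R}) :
  (forall a b, m1 (quadrant a b) = m2 (quadrant a b)) ->
  (forall a b, (m1 (quadrant a b) < +oo)%E) ->
  forall A : set (borelC R), measurable A -> m1 A = m2 A.
Proof.
move=> m12 fin; apply: (@measure_unique _ _ _ quadrants
  (fun n => quadrant (- n%:R) (- n%:R)) borelC_quadrants setI_closed_quadrants).
- by move=> n; exists (- n%:R), (- n%:R).
- apply/seteqP; split => // z _.
  exists (maxn (Num.truncn (`|complex.Re (z : C)|)).+1
               (Num.truncn (`|complex.Im (z : C)|)).+1) => //.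
  have tr (x : R) n : ((Num.truncn `|x|).+1 <= n)%N -> - n%:R <= x.
    move=> xn; rewrite lerNl (le_trans (_ : - x <= `|x|))//.
      by rewrite -normrN ler_norm.
    by rewrite (le_trans (ltW (truncnS_gt _)))// ler_nat.
  by split; apply: tr; rewrite ?leq_maxl ?leq_maxr.
- by move=> _ [a [b ->]].
- by move=> n; exact: fin.
Qed.

End quadrants.

Section real_complexM.
Variable R : realType.

Lemma real_complexD (x y : R) : (x + y)%:C = x%:C + y%:C :> R[i]^o.
Proof. exact: rmorphD. Qed.

Lemma real_complexM (x y : R) : (x * y)%:C = x%:C * y%:C :> R[i]^o.
Proof. exact: rmorphM. Qed.

End real_complexM.

Section dominated_real.
Context {R : realType} {d : measure_display} {T : measurableType d}.
Variables (mu : {measure set T -> \bar R}) (D : set T).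
Hypothesis mD : measurable D.

Lemma dominated_cvg_real (g_ : nat -> T -> R) (g h : T -> R) :
  (forall n, measurable_fun D (g_ n)) ->
  mu.-integrable D (EFin \o h) ->
  (forall n x, D x -> `|g_ n x| <= h x) ->
  (forall x, D x -> g_ n x @[n --> \oo] --> g x) ->
  mu.-integrable D (EFin \o g) /\
  \int[mu]_(x in D) g_ n x @[n --> \oo] --> \int[mu]_(x in D) g x.
Proof.
move=> mg ih gh gc.
have mg' : measurable_fun D g by exact: measurable_fun_cvg gc.
have [] := @dominated_convergence _ _ _ mu D mD (fun n x => (g_ n x)%:E)
  (EFin \o g) (EFin \o h).
- by move=> n; apply/measurable_EFinP.
- exact/measurable_EFinP.
- by apply/aeW => x Dx; apply: cvg_EFin; [near=> n|exact: gc].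
- exact: ih.
- by apply/aeW => x n Dx; rewrite /= lee_fin gh.
move=> ig _ H; split => //.
by move: H; rewrite -[X in _ --> X]fineK => [/fine_cvg//|]; exact: integrable_fin_num.
Unshelve. all: end_near. Qed.

End dominated_real.

(** * Identification of the measure off the point [1] *)

Section weight_identification.
Variable R : realType.
Local Notation C := (R[i]^o).
Local Notation circle := (@unit_circle R : set (borelC R)).
Local Notation operiod := (`]0%R, (2 * pi)%R[%classic : set (measurableTypeR R)).
Local Notation leb := (@lebesgue_measure R).
Variable mu : probability (borelC R) R.
Hypotheses (mu_circle : mu circle = 1%E) (mu_nontrivial : nontrivial mu).
Local Notation F := (mform mu).
Let FT := toeplitz_mform mu_circle.
Let Fpos := posdef_mform mu_circle mu_nontrivial.
Let F11 := mform11 mu_circle.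
Local Notation al := (verb F).
Variables M1 M2 : R.
Hypothesis bv : forall n, \sum_(0 <= k < n) cmod (al k.+1 - al k) <= M1.
Hypothesis l2 : forall n, \sum_(0 <= k < n) cmod (al k) ^+ 2 <= M2.
Local Notation sw := (szego_weight F).
Implicit Types (t : R) (z : C).
Let mC := @measurable_circle R.
Let mO := @measurable_operiod R.

Let isw := (integrable_szego_weight FT Fpos bv l2 F11).1.

Let msw : measurable_fun operiod sw.
Proof. by apply/measurable_EFinP; exact: measurable_int isw. Qed.

Let sw0 t : operiod t -> 0 < sw t.
Proof. by move=> Ot; exact: (szego_weight_gt0 FT Fpos bv l2 Ot). Qed.

Lemma real_moment (h : C -> R) : rtrig h ->
  \int[mu]_(z in circle) (h z * cmod (z - 1 : C) ^+ 2) =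
  (2 * pi)^-1 * \int[leb]_(t in operiod) (h (expi t) * (cmod (expi t - 1 : C) ^+ 2 * sw t)).
Proof.
move=> [n [p hE]]; have := weighted_moment FT Fpos bv l2 F11 n p.
have -> : mform mu ('X^n * ('X - 1)) (('X - 1) * p) =
    (\int[mu]_(z in circle) (h z * cmod (z - 1 : C) ^+ 2))%:C.
  rewrite -cintegral_real /mform /inner; apply: eq_cintegral => z.
  rewrite inE => /unit_circleE z1; rewrite [RHS]real_complexM hE// -mul_conjc.
  rewrite !hornerM hornerXn hornerD hornerN hornerX hornerC.
  by rewrite rmorphM rmorphXn/=; ring.
have -> : (fun t => (expi t)^*%C ^+ n * p.[expi t] *
      (cmod (expi t - 1 : C) ^+ 2 * sw t)%:C) =
    (fun t => (h (expi t) * (cmod (expi t - 1 : C) ^+ 2 * sw t))%:C).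
  by apply/funext => t; rewrite [RHS]real_complexM hE// cmod_expi.
by rewrite cintegral_real -rmorphM => -[].
Qed.

(** The affine map that sends [[-1, 1]] into [[0, 1]] and [a] to 1/2, the threshold of the step
    polynomials. *)
Let qx (a x : R) := 2^-1 + (x - a) / (2 * (1 + `|a|)).

Let qx_bounds a x : -1 <= x <= 1 -> 0 <= qx a x <= 1.
Proof.
move=> /andP[x1 x2]; have a0 : 0 <= `|a| by [].
have c0 : 0 < 2 * (1 + `|a|) by lra.
have xa : `|x - a| <= 1 + `|a|.
  by rewrite (le_trans (ler_normB _ _))// lerD2r ler_norml x1.
have : `|(x - a) / (2 * (1 + `|a|))| <= 2^-1.
  rewrite normrM normfV (gtr0_norm c0) ler_pdivrMr//.
  by rewrite mulrA mulVf ?mul1r.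
by rewrite ler_norml /qx => /andP[]; lra.
Qed.

Let qx_ge a x : (2^-1 <= qx a x) = (a <= x).
Proof.
have c0 : 0 < 2 * (1 + `|a|) by rewrite mulr_gt0// ltr_pwDl.
by rewrite /qx lerDl pmulr_lge0 ?invr_gt0// subr_ge0.
Qed.

(** Partial geometric sums of [1 / (2 - 2 x)], which is [1 / |z - 1|^2] for [x = Re z] on the
    circle. They undo the factor [|z - 1|^2] of the known moments; the remainder stays equal to 1
    only at [z = 1]. *)
Let geo N x : R := 4^-1 * \sum_(k < N.+1) ((1 + x) / 2) ^+ k.

Let geoE N x : geo N x * (2 - 2 * x) = 1 - ((1 + x) / 2) ^+ N.+1.
Proof.
have -> : 2 - 2 * x = 4 * (1 - (1 + x) / 2) by field.
rewrite /geo mulrACA mulVf// mul1r mulrC.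
by rewrite -[1 - (1 + x) / 2]opprB mulNr -subrX1 opprB.
Qed.

Let hN a b N z := step N (qx a (complex.Re z)) * step N (qx b (complex.Im z)) *
  geo N (complex.Re z).

Let rtrig_hN a b N : rtrig (hN a b N).
Proof.
have raff (c : R) (k : C -> R) : rtrig k -> rtrig (fun z => qx c (k z)).
  move=> rk; rewrite /qx; apply: rtrigD; first exact: rtrig_cst.
  by apply: rtrigM; [apply: rtrigB => //; exact: rtrig_cst|exact: rtrig_cst].
apply: rtrigM.
  by apply: rtrigM; apply: rtrig_step; apply: raff; [exact: rtrig_Re|exact: rtrig_Im].
rewrite /geo; apply: rtrigM; first exact: rtrig_cst.
apply: rtrig_sum => k; apply: rtrigX; apply: rtrigM; last exact: rtrig_cst.
by apply: rtrigD; [exact: rtrig_cst|exact: rtrig_Re].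
Qed.

Let gN a b N z := step N (qx a (complex.Re z)) * step N (qx b (complex.Im z)) *
  (1 - ((1 + complex.Re z) / 2) ^+ N.+1).

Let hgN a b N z : cmod z = 1 -> hN a b N z * cmod (z - 1) ^+ 2 = gN a b N z.
Proof.
move=> z1; have -> : cmod (z - 1) ^+ 2 = 2 - 2 * complex.Re z.
  have := cmod_sqr z; rewrite z1 expr1n => E.
  rewrite cmod_sqr ReD ImD ReN ImN /= oppr0 addr0 sqrrB expr1n.
  by move: E; rewrite mulr1 mulr_natl => E; lra.
by rewrite /hN /gN -mulrA geoE.
Qed.

Let ReIm_bounds z : cmod z = 1 ->
  -1 <= complex.Re z <= 1 /\ -1 <= complex.Im z <= 1.
Proof.
by move=> z1; split; rewrite -ler_norml -z1; [exact: ler_Re_cmod|exact: ler_Im_cmod].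
Qed.

Let gN_bound a b N z : cmod z = 1 -> `|gN a b N z| <= 1.
Proof.
move=> z1; have [x1 y1] := ReIm_bounds z1.
have /andP[a0 a1] := qx_bounds a x1; have /andP[b0 b1] := qx_bounds b y1.
have /andP[s0 s1] := step_bounds N a0 a1; have /andP[s2 s3] := step_bounds N b0 b1.
have q0 : 0 <= (1 + complex.Re z) / 2 by case/andP: x1; lra.
have q1 : (1 + complex.Re z) / 2 <= 1 by case/andP: x1; lra.
have p0 : 0 <= ((1 + complex.Re z) / 2) ^+ N.+1 by rewrite exprn_ge0.
have p1 : ((1 + complex.Re z) / 2) ^+ N.+1 <= 1 by rewrite exprn_ile1.
have r0 : 0 <= 1 - ((1 + complex.Re z) / 2) ^+ N.+1 by rewrite subr_ge0.
have r1 : 1 - ((1 + complex.Re z) / 2) ^+ N.+1 <= 1 by rewrite gerBl.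
have s4 := mulr_ge0 s0 s2; have s5 := mulr_ile1 s0 s2 s1 s3.
by rewrite /gN ger0_norm; [exact: mulr_ile1|exact: mulr_ge0].
Qed.

Let ind a b z : R := (if a <= complex.Re z then 1 else 0) *
  (if b <= complex.Im z then 1 else 0) * (if z == 1 then 0 else 1).

Let gN_cvg a b z : cmod z = 1 -> gN a b N z @[N --> \oo] --> ind a b z.
Proof.
move=> z1; have [x1 y1] := ReIm_bounds z1.
have /andP[a0 a1] := qx_bounds a x1; have /andP[b0 b1] := qx_bounds b y1.
apply: cvgM.
  apply: cvgM; [have := step_cvg a0 a1|have := step_cvg b0 b1]; by rewrite qx_ge.
have [->|zn1] := eqVneq z 1.
  have -> : (fun N => 1 - ((1 + complex.Re (1 : C)) / 2) ^+ N.+1 : R) = (fun=> 0).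
    by apply/funext => N /=; rewrite mulfV ?expr1n ?subrr.
  exact: cvg_cst.
rewrite -[X in _ --> X]subr0; apply: cvgB; first exact: cvg_cst.
have q0 : 0 <= (1 + complex.Re z) / 2 by case/andP: x1; lra.
have q1 : (1 + complex.Re z) / 2 < 1.
  suff : complex.Re z != 1 by case/andP: x1 => _; rewrite le_eqVlt => /orP[->//|]; lra.
  apply: contra zn1 => /eqP re1; have := cmod_sqr z; rewrite z1 re1 !expr1n => /eqP.
  rewrite -subr_eq0 opprD addrA subrr sub0r oppr_eq0 sqrf_eq0 => /eqP im0.
  by rewrite eq_complex re1 im0 !eqxx.
rewrite (cvg_shiftS (fun N => ((1 + complex.Re z) / 2) ^+ N)).
by apply: cvg_expr; rewrite ger0_norm.
Qed.

(** Dominated convergence on both sides of [real_moment] for [hN a b N]: the functions [gN] are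
    bounded by 1, so the dominating functions are 1 and [sw]. The limit excludes [1], where every
    [gN] is 0. *)
Lemma quadrant_moment a b : \int[mu]_(z in circle) ind a b z =
  (2 * pi)^-1 * \int[leb]_(t in operiod) (ind a b (expi t) * sw t).
Proof.
have cN a' b' N : cbounded circle (fun z : borelC R => (hN a' b' N z * cmod ((z : C) - 1) ^+ 2)%:C).
  have [n [p hE]] := rtrig_hN a' b' N.
  have := cbounded_poly ('X^n * ('X - 1)) (('X - 1) * p).
  apply: eq_cbounded => z; rewrite inE => /unit_circleE z1.
  rewrite [RHS]real_complexM hE// -mul_conjc.
  rewrite !hornerM hornerXn hornerD hornerN hornerX hornerC.
  by rewrite rmorphM rmorphXn/=; ring.
have mgN N : measurable_fun circle (fun z : borelC R => gN a b N z).
  have [mR _ _] := cN a b N; apply: eq_measurable_fun mR => z.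
  by rewrite inE => /unit_circleE z1 /=; rewrite hgN.
have i1 : mu.-integrable circle (EFin \o (fun=> 1)).
  apply: measurable_bounded_integrable => //; last exact: bounded_cst.
  by rewrite [X in (X < _)%E]mu_circle ltry.
have [_ L] := @dominated_cvg_real _ _ _ mu circle mC (fun N z => gN a b N z)
  (ind a b) (fun=> 1) mgN i1 (fun N z zc => gN_bound a b N ((unit_circleE z).1 zc))
  (fun z zc => gN_cvg ((unit_circleE z).1 zc)).
have mgR N : measurable_fun operiod (fun t => gN a b N (expi t) * sw t).
  apply: measurable_funM => //.
  have [n [p hE]] := rtrig_hN a b N.
  have cg : ccontinuous (fun t => (expi t)^*%C ^+ n * p.[expi t] * ((expi t - 1) * (expi t - 1)^*%C)).
    have c1 : ccontinuous (fun t => expi t - 1 : C).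
      by apply: ccontinuousD; [exact: ccontinuous_expi|exact: ccontinuous_cst].
    apply: ccontinuousM; last by apply: ccontinuousM => //; exact: ccontinuousJ.
    apply: ccontinuousM; last by apply: ccontinuous_horner; exact: ccontinuous_expi.
    by apply: ccontinuousX; apply: ccontinuousJ; exact: ccontinuous_expi.
  have [cR _] := cg; have -> : (fun t => gN a b N (expi t)) = (fun t => complex.Re
      ((expi t)^*%C ^+ n * p.[expi t] * ((expi t - 1) * (expi t - 1)^*%C))).
    apply/funext => t; rewrite -hgN ?cmod_expi// mul_conjc -hE ?cmod_expi//.
    by rewrite -rmorphM.
  exact: continuous_measurable_operiod.
have gB N t : operiod t -> `|gN a b N (expi t) * sw t| <= sw t.
  move=> Ot; rewrite normrM (gtr0_norm (sw0 Ot)) ler_piMl ?(ltW (sw0 Ot))//.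
  by rewrite gN_bound ?cmod_expi.
have gL t : operiod t ->
    gN a b N (expi t) * sw t @[N --> \oo] --> ind a b (expi t) * sw t.
  by move=> Ot; apply: cvgM; [apply: gN_cvg; rewrite cmod_expi|exact: cvg_cst].
have [_ L'] := @dominated_cvg_real _ _ _ leb operiod mO
  (fun N t => gN a b N (expi t) * sw t) (fun t => ind a b (expi t) * sw t) sw
  mgR isw gB gL.
have {}L' : (2 * pi)^-1 * \int[leb]_(t in operiod) (gN a b N (expi t) * sw t)
    @[N --> \oo] --> (2 * pi)^-1 * \int[leb]_(t in operiod) (ind a b (expi t) * sw t).
  exact: cvgMr.
have E : (fun N => (2 * pi)^-1 * \int[leb]_(t in operiod) (gN a b N (expi t) * sw t)) =
    (fun N => \int[mu]_(z in circle) gN a b N z).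
  apply/funext => N; rewrite (_ : \int[mu]_(z in circle) gN a b N z =
    \int[mu]_(z in circle) (hN a b N z * cmod (z - 1 : C) ^+ 2)); last first.
    by apply: eq_Rintegral => z; rewrite inE => /unit_circleE z1; rewrite hgN.
  rewrite real_moment//; congr (_ * _); apply: eq_Rintegral => t _.
  by rewrite mulrA hgN// cmod_expi.
rewrite E in L'; exact: (cvg_unique _ L L').
Qed.

Lemma measurable_set1C (z : C) : measurable ([set z] : set (borelC R)).
Proof.
rewrite -[X in measurable X]setCK; apply: measurableC; apply: open_measurableC.
apply/open_cmodP => w /= /eqP wz; exists (cmod (w - z)).
  by rewrite cmod_gt0 subr_eq0.
by move=> v wv; apply/eqP; apply: contraTneq wv => ->; rewrite ltxx.
Qed.

Let pcircle : set (borelC R) := circle `\` [set (1 : C)].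

Let mpcircle : measurable pcircle.
Proof. by apply: measurableD => //; exact: measurable_set1C. Qed.

Let hw t := sw t / (2 * pi).

Let mhw : measurable_fun operiod hw.
Proof. by apply: measurable_funM => //; exact: measurable_cst. Qed.

Let hw0 t : operiod t -> 0 <= hw t.
Proof. by move=> Ot; rewrite /hw divr_ge0 ?(ltW (sw0 Ot))// ltW// pi2_gt0. Qed.

Lemma quadrant_arcm a b :
  mrestr mu mpcircle (quadrant a b) = arc_measure mhw hw0 (quadrant a b).
Proof.
have mQ := measurable_quadrant (R:=R) a b.
have indE z : cmod z = 1 -> ind a b z = \1_(quadrant a b `&` pcircle) (z : borelC R).
  move=> z1; have zc := (unit_circleE z).2 z1.
  rewrite /ind indicE; have [->|zn1] := eqVneq z 1.
    by rewrite mulr0 memNset// => -[_ [_]]; apply.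
  rewrite mulr1; case: (leP a) => az; last first.
    by rewrite mul0r memNset// => -[[/= H]]; move: H; rewrite leNgt az.
  case: (leP b) => bz; last first.
    by rewrite mulr0 memNset// => -[[/= _ H]]; move: H; rewrite leNgt bz.
  by rewrite mulr1 mem_set//; split => //; split => //; exact/eqP.
have mB : measurable (quadrant a b `&` pcircle) by exact: measurableI.
have -> : mrestr mu mpcircle (quadrant a b) = (\int[mu]_(z in circle) ind a b z)%:E.
  have ii : mu.-integrable circle (EFin \o (\1_(quadrant a b `&` pcircle) : borelC R -> R)).
    apply: (measurable_bounded_integrable mC); first by rewrite [X in (X < _)%E]mu_circle ltry.
      exact: measurable_indic.
    exists 1; split => // N N1 z _ /=; rewrite indicE; case: (_ \in _) => /=;
    by rewrite ?normr1 ?normr0 ltW// (lt_trans _ N1).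
  have -> : \int[mu]_(z in circle) ind a b z =
      \int[mu]_(z in circle) \1_(quadrant a b `&` pcircle) z.
    by apply: eq_Rintegral => z; rewrite inE => /unit_circleE /indE.
  rewrite -(integrable_int mC ii) integral_indic// /mrestr; congr (mu _).
  apply/seteqP; split => z /=; first by move=> [Qz pz]; split => //; case: pz.
  by move=> [].
have iw : leb.-integrable operiod (EFin \o (fun t => ind a b (expi t) * sw t)).
  apply: (le_int_norm mO _ isw) => [|t Ot]; last first.
    rewrite normrM (gtr0_norm (sw0 Ot)) ler_piMl ?(ltW (sw0 Ot))//.
    rewrite indE ?cmod_expi// indicE; case: (_ \in _) => /=; by rewrite ?normr1 ?normr0.
  have mpre := measurable_preimage_expi mB.
  apply: (@eq_measurable_fun _ _ _ _ operiod (fun t =>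
    \1_(operiod `&` (@expi R : measurableTypeR R -> borelC R) @^-1` (quadrant a b `&` pcircle)) t * sw t)).
    move=> t; rewrite inE => Ot; rewrite indE ?cmod_expi// !indicE; congr (_%:R * _).
    apply: (congr1 nat_of_bool); apply/idP/idP; rewrite !inE; first by move=> [].
    by move=> H; split.
  by apply: measurable_funM => //; exact: measurable_indic.
rewrite quadrant_moment /arc_measure /= /arcm integral_mkcondr.
rewrite EFinM -(integrable_int mO iw) -integralZl//.
apply: eq_integral => t; rewrite inE => Ot; rewrite patchE -EFinM.
have [e1 en1] := expi_operiod Ot.
have -> : (t \in @expi R @^-1` quadrant a b) =
    (a <= complex.Re (expi t : C)) && (b <= complex.Im (expi t : C)).
  by apply/idP/andP => [/set_mem -[]|H] //; apply: mem_set.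
rewrite /ind (negbTE en1) mulr1; case: (leP a) => az; last by rewrite !mul0r mulr0.
case: (leP b) => bz; last by rewrite mulr0 mul0r mulr0.
by rewrite !mul1r mulrC.
Qed.

(** The finite measures [mu] off the point [1] and [arcm hw] agree on quadrants; only an atom at [1]
    escapes. *)
Lemma mu_arcm (A : set (borelC R)) : measurable A ->
  (mu A = arcm hw A + mu (A `&` [set (1%R : C)]))%E.
Proof.
move=> mA; have <- : mrestr mu mpcircle A = arcm hw A.
  apply: (measure_unique_quadrants (m1 := mrestr mu mpcircle)
    (m2 := arc_measure mhw hw0)) => //; first exact: quadrant_arcm.
  move=> a b; apply: (@le_lt_trans _ _ 1%E); last by rewrite ltry.
  apply: probability_le1; apply: measurableI => //; exact: measurable_quadrant.
have m1 := measurable_set1C 1.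
have mAc : measurable (A `&` circle) by exact: measurableI.
have -> : mu A = mu (A `&` circle).
  rewrite (measureDI mu mA mC) [X in (X + _)%E](_ : _ = 0%E) ?add0e//.
  apply/eqP; rewrite eq_le measure_ge0 andbT.
  rewrite (@le_trans _ _ (mu (~` circle)))//.
    apply: le_measure; [|rewrite inE; exact: measurableC|by move=> w []].
    by rewrite inE; exact: measurableD.
  by rewrite probability_setC// mu_circle subee.
rewrite (measureDI mu mAc m1) /mrestr; congr (mu _ + mu _)%E.
  by rewrite /pcircle setIDA.
apply/seteqP; split => z /= [H1 H2]; first by split => //; case: H1.
by split => //; split => //; rewrite H2; apply/unit_circleE; rewrite cmod1.
Qed.

End weight_identification.

(** * Almost everywhere uniqueness of the density *)

Section density_uniqueness.
Variable R : realType.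
Local Notation C := (R[i]^o).
Local Notation period := (`[0%R, (2 * pi)%R]%classic : set (measurableTypeR R)).
Local Notation operiod := (`]0%R, (2 * pi)%R[%classic : set (measurableTypeR R)).
Local Notation leb := (@lebesgue_measure R).
Local Notation circle := (@unit_circle R : set (borelC R)).
Local Notation preim A := ((@expi R : measurableTypeR R -> borelC R) @^-1` A).
Variable mu : probability (borelC R) R.
Implicit Types (w : R -> R) (t : R).

Lemma measurable_period_expi (A : set (borelC R)) : measurable A ->
  measurable (period `&` preim A).
Proof.
move=> mA; apply: measurableI; first exact: measurable_period.
by rewrite -[X in measurable X]setTI; exact: measurable_expi.
Qed.

(** A measurable inverse of [expi] on the open period; the sign of the imaginary part selects the
    half circle. *)
Let angle (z : borelC R) : R :=
  if 0 <= complex.Im (z : C) then acos (complex.Re (z : C))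
  else 2 * pi - acos (complex.Re (z : C)).

Let angle_expi t : operiod t -> angle (expi t) = t.
Proof.
rewrite /= in_itv/= /angle /expi /= => /andP[t0 t2]; case: ifPn => [st|].
  by rewrite cosK// in_itv/= (ltW t0)/= leNgt; apply: contraL st => tp;
    rewrite -ltNge -[t](subrK pi) sinDpi oppr_lt0 sin_gt0_pi//; lra.
rewrite -ltNge => st.
have tp : pi < t.
  by rewrite ltNge; apply: contraTN st => tp; rewrite -leNgt sin_ge0_pi// ltW.
have -> : cos t = cos (2 * pi - t).
  by rewrite mulr_natl cosB cos2pi sin2pi mul1r mul0r addr0.
by rewrite cosK ?in_itv/=; [lra|apply/andP; split; lra].
Qed.

Let measurable_angle (E : set (measurableTypeR R)) : measurable E ->
  measurable (circle `&` angle @^-1` E).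
Proof.
move=> mE; have mC := measurable_circle (R:=R).
have ma : measurable_fun circle (fun z => acos (complex.Re (z : C))).
  apply: (measurable_comp (F := `[(-1 : R), 1]%classic)) => //.
  - move=> _ [z zc <-] /=; have := ler_Re_cmod (z : C).
    by rewrite ((unit_circleE z).1 zc) in_itv/= ler_norml.
  - apply: (@measurable_fun_itv_cc _ _ _ false true).
    apply: open_continuous_measurable_fun; first exact: interval_open.
    by move=> x; rewrite inE/= in_itv/= => x1; exact: continuous_acos.
  - by apply: measurable_funTS; exact: measurable_ReC.
have mI : measurable_fun circle (fun z : borelC R => 0 <= complex.Im (z : C)).
  apply: measurable_fun_ler; first exact: measurable_cst.
  by apply: measurable_funTS; exact: measurable_ImC.
have mang : measurable_fun circle angle.
  apply: measurable_fun_if => //; apply: (measurable_funS mC) => //.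
  by apply: measurable_funB => //; exact: measurable_cst.
exact: mang.
Qed.

(** A decomposition tests the density only on preimages of Borel sets of the plane; this makes every
    Borel set of angles such a preimage. *)
Lemma borel_operiod (E : set (measurableTypeR R)) : measurable E -> E `<=` operiod ->
  exists2 A : set (borelC R), measurable A & E = period `&` preim A.
Proof.
move=> mE EO; exists ((circle `&` angle @^-1` E) `\` [set (1 : C)]).
  by apply: measurableD; [exact: measurable_angle|exact: measurable_set1C].
have pO t : period t -> expi t != 1 :> C -> operiod t.
  rewrite /= !in_itv/= => /andP[t0 t2] en1; rewrite !lt_neqAle t0 t2 !andbT.
  apply/andP; split; apply: contra_neqN en1 => /eqP; first by move=> <-; rewrite expi0.
  by move=> ->; rewrite /expi mulr_natl cos2pi sin2pi.
apply/seteqP; split => t.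
  move=> Et; have Ot := EO _ Et; split; first exact: operiod_sub.
  split; first split => /=; last by have [_ /eqP] := expi_operiod Ot.
    by apply/unit_circleE; rewrite cmod_expi.
  by rewrite angle_expi.
move=> [pt [[_ /= Et] /= /eqP en1]]; have Ot := pO _ pt en1.
by rewrite angle_expi in Et.
Qed.

(** Let [N] unite the null carriers of the two singular parts. Both densities integrate over the
    preimage of [A] to [2 pi mu (A \ N)], hence agree almost everywhere. *)
Lemma lebesgue_decomposition_density w1 w2 (mu1 mu2 : {measure set (borelC R) -> \bar R}) :
  lebesgue_decomposition mu w1 mu1 -> lebesgue_decomposition mu w2 mu2 ->
  ae_eq leb operiod (EFin \o w1) (EFin \o w2).
Proof.
move=> [mw1 w10 [N1 [mN1 N1mu N1leb]] d1] [mw2 w20 [N2 [mN2 N2mu N2leb]] d2].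
pose N := N1 `|` N2; have mN : measurable N by exact: measurableU.
have Nleb : leb (period `&` preim N) = 0%E.
  apply/eqP; rewrite eq_le measure_ge0 andbT /N preimage_setU setIUr.
  have le := @measureU2 _ _ _ leb _ _ (measurable_period_expi mN1) (measurable_period_expi mN2).
  by apply: (le_trans le); rewrite -[leRHS]adde0; apply: leeD; [rewrite le_eqVlt; apply/orP; left; apply/eqP; exact: N1leb|rewrite le_eqVlt; apply/orP; left; apply/eqP; exact: N2leb].
have key (A : set (borelC R)) : measurable A -> forall w (nu : {measure set (borelC R) -> \bar R}),
    measurable_fun period w -> (forall t, 0 <= w t) -> nu (~` N) = 0%E ->
    (forall A : set (borelC R), measurable A ->
      (mu A = \int[leb]_(t in period `&` preim A) (w t / (2 * pi))%:E + nu A)%E) ->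
    (\int[leb]_(t in period `&` preim A) (w t / (2 * pi))%:E = mu (A `\` N))%E.
  move=> mA w nu mw w0 nuN d; rewrite (d (A `\` N)); last exact: measurableD.
  have -> : nu (A `\` N) = 0%E.
    apply/eqP; rewrite eq_le measure_ge0 andbT -nuN; apply: le_measure.
    - by rewrite inE; exact: measurableD.
    - by rewrite inE; exact: measurableC.
    - by move=> z [].
  rewrite adde0 (ge0_negligible_integral (measurable_period_expi mN)) //.
  - congr (integral leb _ _); apply/seteqP; split => t.
      by move=> [[pt At] nN]; split => //; split => // Nt; apply: nN.
    by move=> [pt [At Nt]]; split => //; move=> [].
  - exact: measurable_period_expi.
  - apply/measurable_EFinP; apply: measurable_funM; last exact: measurable_cst.
    by apply: measurable_funS mw => //; exact: measurable_period.
  - by move=> t _; rewrite lee_fin divr_ge0// ltW// pi2_gt0.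
have nu0 (nu : {measure set (borelC R) -> \bar R}) M : measurable M -> M `<=` N ->
    nu (~` M) = 0%E -> nu (~` N) = 0%E.
  move=> mM MN nM; apply/eqP; rewrite eq_le measure_ge0 andbT -nM; apply: le_measure.
  - by rewrite inE; exact: measurableC.
  - by rewrite inE; exact: measurableC.
  - exact: subsetC.
have k1 A (mA : measurable A) := key A mA _ _ mw1 w10 (nu0 mu1 N1 mN1 (@subsetUl _ _ _) N1mu) d1.
have k2 A (mA : measurable A) := key A mA _ _ mw2 w20 (nu0 mu2 N2 mN2 (@subsetUr _ _ _) N2mu) d2.
have mO := @measurable_operiod R.
have mw1' : measurable_fun operiod (fun t => w1 t / (2 * pi)).
  apply: measurable_funM; last exact: measurable_cst.
  by apply: measurable_funS mw1; [exact: measurable_period|exact: operiod_sub].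
have mw2' : measurable_fun operiod (fun t => w2 t / (2 * pi)).
  apply: measurable_funM; last exact: measurable_cst.
  by apply: measurable_funS mw2; [exact: measurable_period|exact: operiod_sub].
have /(_ _ _) ae := @integral_ae_eq _ _ _ leb operiod mO
  (fun t => (w2 t / (2 * pi))%:E) (fun t => (w1 t / (2 * pi))%:E).
have {}ae : ae_eq leb operiod (fun t => (w1 t / (2 * pi))%:E) (fun t => (w2 t / (2 * pi))%:E).
  apply: ae.
  - apply/integrableP; split; first exact/measurable_EFinP.
    have [A mA AO] := borel_operiod mO (@subset_refl _ _).
    have -> : (\int[leb]_(t in operiod) `|(w1 t / (2 * pi))%:E| =
        \int[leb]_(t in operiod) (w1 t / (2 * pi))%:E)%E.
      apply: eq_integral => t _; rewrite gee0_abs// lee_fin.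
      by rewrite divr_ge0// ltW// pi2_gt0.
    by rewrite AO k1// (le_lt_trans (probability_le1 _ _)) ?ltry//; exact: measurableD.
  - exact/measurable_EFinP.
  - by move=> E EO mE; have [A mA ->] := borel_operiod mE EO; rewrite k1// k2.
apply: filterS ae => t /[apply] -[] /(congr1 (fun x => x * (2 * pi))).
by rewrite !divfK ?gt_eqF ?pi2_gt0//= => ->.
Qed.

End density_uniqueness.

(** * The Szego function *)

Section complex_limits.
Variable R : realType.
Local Notation C := (R[i]^o).

Lemma cvg_cmodP T (G : set_system T) {FG : Filter G} (f : T -> C) (l : C) :
  f x @[x --> G] --> l <->
  (forall e : R, 0 < e -> \forall x \near G, cmod (l - f x) < e).
Proof.
split=> [/cvgrPdist_lt H e e0|H].
  have := H e%:C; rewrite ltcR => /(_ e0); apply: filterS => x.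
  by rewrite normcmod ltcR.
apply/cvgrPdist_lt => e e0.
have eE : e = (complex.Re e)%:C.
  by move: e0; rewrite ltcE /= => /andP[/eqP e0 _]; case: e e0 => a b /= ->.
have e0' : 0 < complex.Re e by move: e0; rewrite eE ltcR.
by apply: filterS (H _ e0') => x; rewrite normcmod eE ltcR.
Qed.

Lemma ccvg_cmodP (u : nat -> C) (l : C) : u n @[n --> \oo] --> l <-> ccvg u l.
Proof.
split=> [/cvg_cmodP H|[uR uI]].
  split; apply/cvgrPdist_lt => e e0; apply: filterS (H _ e0) => n; apply: le_lt_trans.
    by rewrite -ReN -ReD ler_Re_cmod.
  by rewrite -ImN -ImD ler_Im_cmod.
apply/cvg_cmodP => e e0; have e2 : 0 < e / 2 by rewrite divr_gt0.
have /cvgrPdist_lt/(_ _ e2) HR := uR; have /cvgrPdist_lt/(_ _ e2) HI := uI.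
near=> n; rewrite (le_lt_trans (cmod_le_ReIm _))// [ltRHS]splitr ReD ImD ReN ImN ltrD//;
  by near: n.
Unshelve. all: end_near. Qed.

End complex_limits.

Section szego_function.
Variable R : realType.
Local Notation C := (R[i]^o).
Local Notation period := (`[0%R, (2 * pi)%R]%classic : set (measurableTypeR R)).
Local Notation operiod := (`]0%R, (2 * pi)%R[%classic : set (measurableTypeR R)).
Local Notation leb := (@lebesgue_measure R).
Local Notation preim A := ((@expi R : measurableTypeR R -> borelC R) @^-1` A).
Variable mu : probability (borelC R) R.
Hypothesis mu_circle : mu (@unit_circle R) = 1%E.
Hypothesis mu_nontrivial : nontrivial mu.
Local Notation F := (mform mu).
Local Notation sw := (szego_weight F).
Let FT := toeplitz_mform mu_circle.
Let Fpos := posdef_mform mu_circle mu_nontrivial.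
Let F11 := mform11 mu_circle.
Variables M1 M2 : R.
Hypothesis bv : forall n, \sum_(0 <= k < n) cmod (verb F k.+1 - verb F k) <= M1.
Hypothesis l2 : forall n, \sum_(0 <= k < n) cmod (verb F k) ^+ 2 <= M2.

Let isw := (integrable_szego_weight FT Fpos bv l2 F11).1.

Let msw : measurable_fun operiod sw.
Proof. by case/integrableP : isw => /measurable_EFinP. Qed.

Let msw_period : measurable_fun period sw.
Proof. exact: measurable_fun_itv_cc msw. Qed.

Let sw_ge0 t : 0 <= sw t.
Proof. by rewrite divr_ge0// ?exprn_ge0 ?cmod_ge0// ltW// (onorm2_lim_gt0 FT Fpos l2). Qed.

Let endpoints : set (measurableTypeR R) := [set 0; 2 * pi].

Let measurable_endpoints : measurable endpoints.
Proof. by apply: measurableU; exact: measurable_set1. Qed.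

Let lebesgue_endpoints : leb endpoints = 0%E.
Proof. by apply: countable_lebesgue_measure0; apply: finite_set_countable; exact: finite_set2. Qed.

Let period_endpoints t : period t -> ~ endpoints t -> operiod t.
Proof.
rewrite /= !in_itv/= !lt_neqAle => /andP[-> ->] nt; rewrite !andbT.
by apply/andP; split; apply/eqP => te; apply: nt; [left|right].
Qed.

(** The singular part is the restriction of [mu] to [{1}]. Open and closed period differ by the two
    endpoints, a null set. *)
Lemma lebesgue_decomposition_szego_weight :
  lebesgue_decomposition mu sw (mrestr mu (measurable_set1C (1 : C))).
Proof.
split => //.
- exists [set (1 : C)]; split; first exact: measurable_set1C.
    by rewrite -[RHS](measure0 mu); congr (mu _); exact: setICl.
  apply/eqP; rewrite eq_le measure_ge0 andbT -lebesgue_endpoints; apply: le_measure.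
  + by rewrite inE; apply: measurable_period_expi; exact: measurable_set1C.
  + by rewrite inE.
  + move=> t [pt /= e1]; apply: contrapT => nt.
    by have [_ /eqP] := expi_operiod (period_endpoints pt nt).
- move=> A mA; apply: (etrans (mu_arcm mu_circle mu_nontrivial bv l2 mA)).
  congr (_ + _)%E; rewrite /arcm.
  rewrite [RHS](ge0_negligible_integral measurable_endpoints) //.
  + congr (integral leb _ _); apply/seteqP; split => t.
      move=> [Ot At]; split; first by split => //; exact: operiod_sub.
      move=> te; move: Ot; rewrite /= in_itv/= => /andP[]; case: te => ->; by rewrite ltxx.
    by move=> [[pt At] nt]; split => //; exact: period_endpoints.
  + exact: measurable_period_expi.
  + apply/measurable_EFinP; apply: measurable_funM; last exact: measurable_cst.
    by apply: measurable_funS msw_period => //; exact: measurable_period.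
  + by move=> t _; rewrite lee_fin divr_ge0// ltW// pi2_gt0.
Qed.

(** [ac_density] is a chosen version of the density, so equality can only be almost everywhere;
    integrals against the Schwarz kernel do not see the difference. *)
Lemma ac_density_szego_weight : ae_eq leb operiod (EFin \o ac_density mu) (EFin \o sw).
Proof.
have ex : exists w, [set w | exists mus, lebesgue_decomposition mu w mus] w.
  by exists sw; exists (mrestr mu (measurable_set1C (1 : C))); exact: lebesgue_decomposition_szego_weight.
have [w ew] := ex; have [mus d] := xgetPex (fun=> 0) ex.
exact: lebesgue_decomposition_density d lebesgue_decomposition_szego_weight.
Qed.

Let measurable_ac_density : measurable_fun period (ac_density mu).
Proof.
have ex : exists w, [set w | exists mus, lebesgue_decomposition mu w mus] w.
  by exists sw; exists (mrestr mu (measurable_set1C (1 : C))); exact: lebesgue_decomposition_szego_weight.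
by have [mus []] := xgetPex (fun=> 0) ex.
Qed.

Lemma szegoE z : cmod z < 1 ->
  szego mu z = (Num.sqrt (onorm2_lim F))%:C / opoly_lim F z.
Proof.
move=> z1; rewrite -(szego_formula FT Fpos bv l2 F11 z1) /szego; congr (cexp (_ * _)).
have mO := @measurable_operiod R.
have [cR cI] : ccontinuous (skernel z) by exact: ccontinuous_skernel.
have mln w : measurable_fun operiod w -> measurable_fun operiod (fun t => ln (w t)).
  by move=> mw; apply: measurableT_comp => //; exact: measurable_ln.
have mac : measurable_fun operiod (ac_density mu).
  by apply: measurable_funS measurable_ac_density; [exact: measurable_period|exact: operiod_sub].
have ReE (w : R -> R) : (fun t => complex.Re (skernel z t * (ln (w t))%:C)) =
    (fun t => complex.Re (skernel z t) * ln (w t)).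
  by apply/funext => t; rewrite ReM/= mulr0 subr0.
have ImE (w : R -> R) : (fun t => complex.Im (skernel z t * (ln (w t))%:C)) =
    (fun t => complex.Im (skernel z t) * ln (w t)).
  by apply/funext => t; rewrite ImM/= mulr0 add0r.
have mR w : measurable_fun operiod w ->
    measurable_fun operiod (fun t => complex.Re (skernel z t * (ln (w t))%:C)).
  by move=> mw; rewrite ReE; apply: measurable_funM; [exact: continuous_measurable_operiod|exact: mln].
have mI w : measurable_fun operiod w ->
    measurable_fun operiod (fun t => complex.Im (skernel z t * (ln (w t))%:C)).
  by move=> mw; rewrite ImE; apply: measurable_funM; [exact: continuous_measurable_operiod|exact: mln].
rewrite -cintegral_operiod; [|exact: mR|exact: mI].
have aeI : ae_eq leb operiod (EFin \o ac_density mu) (EFin \o sw) := ac_density_szego_weight.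
congr (_ +i* _); congr fine; apply: ae_eq_integral => //.
- by apply/measurable_EFinP; exact: mR.
- by apply/measurable_EFinP; exact: mR.
- by apply: filterS aeI => t /[apply] -[<-].
- by apply/measurable_EFinP; exact: mI.
- by apply/measurable_EFinP; exact: mI.
- by apply: filterS aeI => t /[apply] -[<-].
Qed.

(** [Q] is continuous and zero-free in the closed disk off [1], so the formula of [szegoE] passes to
    the radial limit. *)
Lemma szego_boundaryE z : unit_circle z -> z != 1 ->
  szego_boundary mu z = (Num.sqrt (onorm2_lim F))%:C / opoly_lim F z.
Proof.
move=> /unit_circleE zc zn1; have z1 : cmod z <= 1 by rewrite zc.
apply: cvg_lim => //.
have q0 := opoly_lim_neq0 FT Fpos bv l2 z1 zn1.
have cq : opoly_lim F (r%:C * z) @[r --> (1 : R)^'-] --> opoly_lim F z.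
  apply/cvg_cmodP => e e0.
  have e20 : 0 < e / 2 by rewrite divr_gt0.
  have [d d0 H] := opoly_lim_continuous FT Fpos bv l2 z1 zn1 e20.
  near=> r.
  have r0 : 0 < r by near: r; exact: nbhs_left_gt.
  have r1 : r < 1 by near: r; exact: nbhs_left_lt.
  have rd : 1 - d < r by near: r; apply: nbhs_left_gt; rewrite gtrBl.
  rewrite cmod_distC (le_lt_trans (H _ _ _))//.
  - by rewrite cmodM zc mulr1 cmodR gtr0_norm// ltW.
  - rewrite -[X in _ - X]mul1r -mulrBl cmodM zc mulr1 -rmorphB cmodR.
    by rewrite distrC ger0_norm ?subr_ge0 ?lerBlDl -?lerBlDr ltW.
  - by rewrite ltr_pdivrMr// ltr_pMr// ltr1n.
have cs : (Num.sqrt (onorm2_lim F))%:C / opoly_lim F (r%:C * z) @[r --> (1 : R)^'-] -->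
    ((Num.sqrt (onorm2_lim F))%:C / opoly_lim F z : C).
  by apply: cvgM; [exact: cvg_cst|exact: cvgV].
apply: cvg_trans cs; apply: near_eq_cvg; near=> r.
have r0 : 0 < r by near: r; exact: nbhs_left_gt.
have r1 : r < 1 by near: r; exact: nbhs_left_lt.
by rewrite szegoE// cmodM zc mulr1 cmodR gtr0_norm.
Unshelve. all: end_near. Qed.

End szego_function.

(** * Adding point masses *)

Section conjugation.
Variable R : realType.
Implicit Types x y : R[i]^o.

Lemma conjM x y : (x * y)^*%C = x^*%C * y^*%C.
Proof. exact: rmorphM. Qed.

Lemma conjD x y : (x + y)^*%C = x^*%C + y^*%C.
Proof. exact: rmorphD. Qed.

Lemma conjB x y : (x - y)^*%C = x^*%C - y^*%C.
Proof. exact: rmorphB. Qed.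

Lemma conjX x n : (x ^+ n)^*%C = x^*%C ^+ n.
Proof. exact: rmorphXn. Qed.

Lemma conjV x : (x^-1)^*%C = x^*%C^-1.
Proof. exact: fmorphV. Qed.

Lemma conjR (r : R) : (r%:C : R[i]^o)^*%C = r%:C.
Proof. exact: conjc_real. Qed.

Lemma conj_sum I (r : seq I) (G : I -> R[i]^o) :
  (\sum_(i <- r) G i)^*%C = \sum_(i <- r) (G i)^*%C.
Proof. exact: rmorph_sum. Qed.

Lemma real_complex_nat n : (n%:R : R)%:C = n%:R :> R[i]^o.
Proof. exact: rmorph_nat. Qed.

Lemma real_complexV (r : R) : (r^-1)%:C = r%:C^-1 :> R[i]^o.
Proof. exact: fmorphV. Qed.

End conjugation.

Section null_sequences.
Variable R : realType.
Local Notation C := (R[i]^o).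

Lemma ccvg_sum0 m (f : nat -> 'I_m -> C) :
  (forall j, ccvg (fun n => f n j) 0) -> ccvg (fun n => \sum_j f n j) 0.
Proof.
move=> f0; have H s : ccvg (fun n => \sum_(j <- s) f n j) 0; last exact: H.
elim: s => [|j s IH].
  by under eq_fun do rewrite big_nil; exact: ccvg_cst.
under eq_fun do rewrite big_cons.
by have := ccvgD (f0 j) IH; rewrite addr0.
Qed.

Lemma ccvg0M (f h : nat -> C) (M : R) :
  (forall n, cmod (f n) <= M) -> ccvg h 0 -> ccvg (fun n => f n * h n) 0.
Proof.
move=> fM h0; apply: (ccvg_squeeze (h := fun n => M * cmod (h n))).
  rewrite -[X in _ --> X](mulr0 M); apply: cvgMr; have := ccvg_cmod h0.
  by rewrite cmod0.
by near=> n; rewrite subr0 cmodM ler_wpM2r ?cmod_ge0.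
Unshelve. all: end_near. Qed.

End null_sequences.

Section kernel_bound.
Variable R : realType.
Local Notation C := (R[i]^o).
Variable F : {poly C} -> {poly C} -> C.
Hypotheses (FT : toeplitz F) (Fpos : posdef F).

(** Off the diagonal the Christoffel-Darboux formula bounds the kernel independently of [n], since
    [|P_n| = |Q_n|] on the circle; on the diagonal it grows like [n]. *)
Lemma cdker_circle_bound n x w (A B nu d : R) : cmod x = 1 -> cmod w = 1 ->
  cmod (opolyr F n).[x] <= A -> cmod (opolyr F n).[w] <= B ->
  0 < nu -> nu <= onorm2 F n -> 0 < d -> d <= cmod (1 - x * w^*%C) ->
  cmod (cdker F n w).[x] <= 2 * A * B / nu / d.
Proof.
move=> x1 w1 QA QB nu0 nuN d0 dx; have N0 := onorm2_gt0 FT Fpos n.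
have Pc y : cmod y = 1 -> cmod (opoly F n).[y] = cmod (opolyr F n).[y].
  by move=> y1; rewrite (opoly_circle FT Fpos)// cmodM cmodX y1 expr1n mul1r cmod_conj.
rewrite ler_pdivlMr// (le_trans (ler_wpM2l (cmod_ge0 _) dx))//.
rewrite -cmodM (christoffel_darboux FT Fpos) cmodM cmodV cmodR gtr0_norm//.
apply: ler_pM; rewrite ?cmod_ge0 ?invr_ge0 ?(ltW N0)//; last by rewrite lef_pV2 ?posrE.
rewrite (le_trans (cmodB _ _))// !cmodM !cmod_conj !Pc//.
have -> : 2 * A * B = A * B + A * B by ring.
by apply: lerD; apply: ler_pM; rewrite ?cmod_ge0.
Qed.

End kernel_bound.

(** * Asymptotics of the perturbed polynomials at the masses *)

Section point_mass_asymptotics.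
Variable R : realType.
Local Notation C := (R[i]^o).
Variables (F F1 : {poly C} -> {poly C} -> C) (m : nat) (z : 'I_m -> C).
Variables (c : R) (gamma : 'I_m -> R).
Hypotheses (FT : toeplitz F) (Fpos : posdef F) (F1T : toeplitz F1) (F1pos : posdef F1).
Hypothesis c0 : 0 < c.
Hypothesis gamma0 : forall j, 0 < gamma j.
Hypothesis F1E : forall p q, F1 p q =
  c%:C * F p q + \sum_(j < m) (gamma j)%:C * ((p.[z j])^*%C * q.[z j]).
Hypothesis z1 : forall j, cmod (z j) = 1.
Variables a B L nu : R.
Hypotheses (a0 : 0 < a) (nu0 : 0 < nu) (L0 : 0 <= L).
Hypothesis Qb : forall n j, a <= cmod (opolyr F n).[z j] <= B.
Hypothesis Nb : forall n, nu <= onorm2 F n <= 1.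
Hypothesis Kb : forall n j k, j != k -> cmod (cdker F n (z j)).[z k] <= L.
Local Notation P := (opoly F).
Local Notation Q := (opolyr F).
Local Notation N := (onorm2 F).
Local Notation al := (verb F).

Let g j := gamma j / c.
Let u n j := (opoly F1 n).[z j].
Let kap n j := \sum_(k < n) cmod (P k).[z j] ^+ 2 / N k.

Let g0 j : 0 < g j. Proof. by rewrite divr_gt0. Qed.

Let N0 n : 0 < N n. Proof. exact: onorm2_gt0. Qed.

Let cmodP n j : cmod (P n).[z j] = cmod (Q n).[z j].
Proof. by rewrite (opoly_circle FT Fpos)// cmodM cmodX z1 expr1n mul1r cmod_conj. Qed.

Let B0 : (0 < m)%N -> 0 < B.
Proof. by move=> m0; have /andP[/(lt_le_trans a0)/lt_le_trans] := Qb 0 (Ordinal m0); apply. Qed.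

Let Pb n j : cmod (P n).[z j] <= B.
Proof. by rewrite cmodP; case/andP: (Qb n j). Qed.

Let kap_ge n j : n%:R * a ^+ 2 <= kap n j.
Proof.
rewrite -[n in n%:R]card_ord -sum1_card natr_sum mulr_suml; apply: ler_sum => k _.
have /andP[aQ _] := Qb k j; have /andP[_ N1] := Nb k.
rewrite mul1r cmodP ler_pdivlMr// (le_trans _ (_ : a ^+ 2 <= _))//.
  by rewrite ler_piMr// exprn_ge0// ltW.
by rewrite lerXn2r ?nnegrE ?cmod_ge0// ltW.
Qed.

Let kapS n j : kap n.+1 j = kap n j + cmod (P n).[z j] ^+ 2 / N n.
Proof. by rewrite /kap big_ord_recr. Qed.

(** [kap 0 j] is an empty sum, hence the shift of index in what divides by it. *)
Let kap_gt0 n j : 0 < kap n.+1 j.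
Proof. by rewrite (lt_le_trans _ (kap_ge _ _))// mulr_gt0// exprn_gt0. Qed.

Lemma opoly_at_mass n k : u n k * (1 + g k * kap n k)%:C =
  (P n).[z k] - \sum_(j | j != k) (g j)%:C * u n j * (cdker F n (z j)).[z k].
Proof.
have := perturbed_opoly FT Fpos F1T F1pos c0 F1E n (z k).
rewrite (bigD1 k)//= cdker_diag -/(kap n k) -/(u n k) => E.
rewrite real_complexD mulrDr mulr1 [X in X + _ = _]E /g /u real_complexM; ring.
Qed.

(** The mass at [z_k] alone contributes [gamma_k |u_k|^2] to the squared norm of [opoly F1 n], which
    decreases in [n]. This a priori bound starts the bootstrap. *)
Lemma opoly_at_mass_bounded : exists2 U, 0 <= U & forall n k, cmod (u n k) <= U.
Proof.
have t0 k : 0 <= onorm2 F1 0 / gamma k by rewrite divr_ge0// ltW// onorm2_gt0.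
exists (1 + \sum_k onorm2 F1 0 / gamma k); first by rewrite addr_ge0// sumr_ge0.
move=> n k; have F1p : 0 < complex.Re (F (opoly F1 n) (opoly F1 n)).
  by apply: Fpos; rewrite -size_poly_gt0 size_opoly.
have le1 : gamma k * cmod (u n k) ^+ 2 <= onorm2 F1 n.
  have -> : onorm2 F1 n = c * complex.Re (F (opoly F1 n) (opoly F1 n)) +
      \sum_(j < m) gamma j * cmod (u n j) ^+ 2.
    have := opoly_self F1T n; rewrite F1E => /(congr1 (fun x : C => complex.Re x)) /= <-.
    rewrite ReD Re_sum ReM/= mul0r subr0; congr (_ + _); apply: eq_bigr => j _.
    by rewrite mulrC [_^*%C * _]mulrC mul_conjc -/(u n j) mulrC -rmorphM.
  rewrite (bigD1 k)//= addrCA lerDl addr_ge0//.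
    rewrite mulr_ge0 ?(ltW c0)//.
    exact: ltW.
  by rewrite sumr_ge0// => j _; rewrite mulr_ge0 ?(ltW (gamma0 _))// exprn_ge0// cmod_ge0.
have le0 : onorm2 F1 n <= onorm2 F1 0.
  by elim: n {le1 F1p} => // n; apply: le_trans; exact: onorm2_noninc.
have {le1} le1 : cmod (u n k) ^+ 2 <= onorm2 F1 0 / gamma k.
  by rewrite ler_pdivlMr// mulrC (le_trans le1).
have le2 : onorm2 F1 0 / gamma k <= \sum_k onorm2 F1 0 / gamma k.
  by rewrite (bigD1 k)//= lerDl sumr_ge0.
have x0 := cmod_ge0 (u n k).
move: (cmod (u n k)) x0 (le_trans le1 le2) => x x0; move: (\sum_k _) => s xs.
by nra.
Qed.

(** With bounded [u_j] and bounded off-diagonal kernels, the right side of [opoly_at_mass] is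
    bounded, while the diagonal coefficient is at least [g_k n a^2]. *)
Lemma opoly_at_mass_decay : exists2 U, 0 <= U & forall n k, n%:R * cmod (u n k) <= U.
Proof.
have [U0 U00 HU0] := opoly_at_mass_bounded.
pose T := B + \sum_j g j * U0 * L.
have s0 : 0 <= \sum_j g j * U0 * L.
  by apply: sumr_ge0 => j _; rewrite mulr_ge0// mulr_ge0// ltW// g0.
(* The sign of [B] is known only in the presence of a mass, hence the argument [k]. *)
have T0 (k : 'I_m) : 0 <= T.
  by rewrite addr_ge0// ltW// B0//; case: k => i; apply: leq_ltn_trans.
exists (\sum_k T / (g k * a ^+ 2)).
  by apply: sumr_ge0 => k _; rewrite divr_ge0 ?(T0 k)// mulr_ge0 ?exprn_ge0// ltW// g0.
move=> n k; rewrite (bigD1 k)//= (le_trans _ (_ : T / (g k * a ^+ 2) <= _))//; last first.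
  by rewrite lerDl; apply: sumr_ge0 => j _; rewrite divr_ge0 ?(T0 k)// mulr_ge0 ?exprn_ge0// ltW// g0.
rewrite ler_pdivlMr; last by rewrite (mulr_gt0 (g0 k))// exprn_gt0.
have H : cmod (u n k) * (1 + g k * kap n k) <= T.
  have kp : 0 <= 1 + g k * kap n k.
    rewrite addr_ge0// mulr_ge0 ?(ltW (g0 _))// (le_trans _ (kap_ge _ _))//.
    by rewrite mulr_ge0// exprn_ge0// ltW.
  rewrite -[X in _ * X]ger0_norm// -cmodR -cmodM opoly_at_mass (le_trans (cmodB _ _))// lerD//.
  rewrite (le_trans (cmod_sum _ _ _))//.
  rewrite [leRHS](bigID (fun j => j != k))/= ler_wpDr//.
    by apply: sumr_ge0 => j _; rewrite mulr_ge0// mulr_ge0// ltW// g0.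
  apply: ler_sum => j jk; rewrite !cmodM cmodR gtr0_norm ?g0//.
  apply: ler_pM; rewrite ?cmod_ge0 ?Kb//.
    by rewrite mulr_ge0 ?cmod_ge0// ltW// g0.
  by rewrite ler_wpM2l// ltW// g0.
apply: le_trans H; rewrite -mulrA mulrCA ler_wpM2l ?cmod_ge0//.
by rewrite mulrCA ler_wpDl// ler_pM2l ?g0.
Qed.

(** Second round: [u_k] and the off-diagonal sum are now [O(1/n)], and division by [kap], of order
    [n], makes the error [O(1/n^2)]. *)
Lemma opoly_at_mass_leading : exists2 U, 0 <= U & forall n k,
  cmod ((g k)%:C * u n.+1 k - (P n.+1).[z k] / (kap n.+1 k)%:C) <= U / n.+1%:R ^+ 2.
Proof.
have [U U0 HU] := opoly_at_mass_decay.
have s0 : 0 <= \sum_j g j * U * L.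
  by apply: sumr_ge0 => j _; rewrite mulr_ge0// mulr_ge0// ltW// g0.
exists ((U + \sum_j g j * U * L) / a ^+ 2).
  by rewrite divr_ge0 ?addr_ge0// exprn_ge0// ltW.
move=> n k; have kp := kap_gt0 n k; have n0 : 0 < n.+1%:R :> R by [].
set d := _ - _.
have dE : d * (kap n.+1 k)%:C = - (u n.+1 k + \sum_(j | j != k) (g j)%:C * u n.+1 j *
    (cdker F n.+1 (z j)).[z k]).
  have kC : (kap n.+1 k)%:C != 0 :> C by rewrite -cmod_eq0 cmodR normr_eq0 gt_eqF.
  rewrite /d mulrBl divfK// opprD addrC; have := opoly_at_mass n.+1 k.
  rewrite rmorphD rmorphM /= mulrDr mulr1 => /eqP; rewrite addrC eq_sym subr_eq => /eqP ->.
  ring.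
have dU : n.+1%:R * (cmod d * kap n.+1 k) <= U + \sum_j g j * U * L.
  rewrite -(ger0_norm (ltW kp)) -cmodR -cmodM dE cmodN.
  rewrite (le_trans (ler_wpM2l (ltW n0) (cmodD _ _)))// mulrDr lerD//.
  rewrite (le_trans (ler_wpM2l (ltW n0) (cmod_sum _ _ _)))//.
  rewrite mulr_sumr [leRHS](bigID (fun j => j != k))/= ler_wpDr//.
    by apply: sumr_ge0 => j _; rewrite mulr_ge0// mulr_ge0// ltW// g0.
  apply: ler_sum => j jk; rewrite !cmodM cmodR gtr0_norm ?g0// mulrA.
  apply: ler_pM; rewrite ?cmod_ge0 ?Kb//.
    by rewrite mulr_ge0// mulr_ge0 ?cmod_ge0// ltW// g0.
  by rewrite mulrCA ler_wpM2l// ltW// g0.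
rewrite ler_pdivlMr ?exprn_gt0// ler_pdivlMr ?exprn_gt0//; apply: le_trans dU.
have -> : cmod d * n.+1%:R ^+ 2 * a ^+ 2 = n.+1%:R * (cmod d * (n.+1%:R * a ^+ 2)).
  by rewrite [n.+1%:R ^+ 2]expr2 mulrA [cmod d * _]mulrC -!mulrA.
by rewrite ler_pM2l// ler_wpM2l ?cmod_ge0 ?kap_ge.
Qed.

Definition mass_coef n j : C :=
  (gamma j / c)%:C * ((opoly F1 n.+1).[z j])^*%C * (Q n).[z j] / (N n)%:C.

Lemma verb_mass n : verb F1 n = al n + \sum_(j < m) mass_coef n j.
Proof.
have := perturbed_opoly FT Fpos F1T F1pos c0 F1E n.+1 0.
rewrite !opoly0// -opprD => /oppr_inj/(congr1 (fun x : C => x^*%C)).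
rewrite conjcK conjD conjcK => ->; congr (_ + _).
rewrite conj_sum; apply: eq_bigr => j _.
by rewrite (cdker_at0 FT Fpos) /mass_coef !conjM conjR conjV conjR conjcK mulrA.
Qed.

Let lead n j : C := ((P n.+1).[z j])^*%C * (Q n).[z j] / (N n)%:C / (kap n.+1 j)%:C.

Let cmodQN n j : cmod ((Q n).[z j] / (N n)%:C) <= B / nu.
Proof.
have /andP[_ QB] := Qb n j; have /andP[nuN _] := Nb n.
rewrite cmodM cmodV cmodR gtr0_norm//; apply: ler_pM; rewrite ?cmod_ge0 ?invr_ge0 ?(ltW (N0 n))//.
by rewrite lef_pV2 ?posrE ?N0.
Qed.

Lemma mass_coef_leading : exists2 U, 0 <= U & forall n j,
  cmod (mass_coef n j - lead n j) <= U / n.+1%:R ^+ 2.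
Proof.
have [U U0 HU] := opoly_at_mass_leading.
exists (U * `|B / nu|) => [|n j]; first by rewrite mulr_ge0.
have -> : mass_coef n j - lead n j =
    ((g j)%:C * u n.+1 j - (P n.+1).[z j] / (kap n.+1 j)%:C)^*%C * ((Q n).[z j] / (N n)%:C).
  rewrite conjB !conjM conjV !conjR /mass_coef /lead -/(g j) -/(u n.+1 j).
  ring.
rewrite cmodM cmod_conj mulrAC; apply: ler_pM; rewrite ?cmod_ge0//.
by rewrite (le_trans (cmodQN n j))// ler_norm.
Qed.

Let v n j : C := (Q n.+1).[z j] * ((Q n).[z j] / (N n)%:C).

(** Isolates the oscillation, which the twist by [z_j] in the bounded variation condition removes;
    the other factors vary slowly. *)
Let leadE n j : lead n j = (z j)^*%C ^+ n.+1 * (v n j * (kap n.+1 j)^-1%:C).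
Proof.
rewrite /lead (opoly_circle FT Fpos)// conjM conjcK conjX [(_^-1)%:C]fmorphV /v.
by rewrite !mulrA.
Qed.

Let v_bound n j : cmod (v n j) <= B * (B / nu).
Proof.
by rewrite cmodM; apply: ler_pM; rewrite ?cmod_ge0 ?cmodQN//; case/andP: (Qb n.+1 j).
Qed.

Let Q_step n j : cmod ((Q n.+1).[z j] - (Q n).[z j]) <= B * cmod (al n).
Proof.
rewrite (opolyrS FT Fpos) hornerD hornerN hornerZ hornerM hornerX addrAC subrr sub0r cmodN.
by rewrite !cmodM z1 mul1r mulrC ler_wpM2r ?cmod_ge0.
Qed.

Let NV_step n : cmod ((N n.+1)%:C^-1 - (N n)%:C^-1) <= cmod (al n) / nu.
Proof.
have N1 : (N n.+1)%:C != 0 :> C by rewrite -cmod_eq0 cmodR normr_eq0 gt_eqF.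
have Nn : (N n)%:C != 0 :> C by rewrite -cmod_eq0 cmodR normr_eq0 gt_eqF.
have -> : (N n.+1)%:C^-1 - (N n)%:C^-1 = (al n * (al n)^*%C) / (N n.+1)%:C :> C.
  apply: (mulfI N1); rewrite mulrBr mulfV// [RHS]mulrC divfK//.
  apply: (mulIf Nn); rewrite mulrBl -mulrA mulVf// mulr1 mul1r (onorm2SC FT Fpos).
  by ring.
rewrite !cmodM cmodV cmod_conj cmodR gtr0_norm//; apply: ler_pM.
- by rewrite mulr_ge0 ?cmod_ge0.
- by rewrite invr_ge0 ltW.
- by rewrite ler_piMr ?cmod_ge0// ltW// verb_lt1.
- by rewrite lef_pV2 ?posrE ?N0//; case/andP: (Nb n.+1).
Qed.

Let v_step n j : cmod (v n.+1 j - v n j) <= B * (B / nu) * 2 * (cmod (al n) + cmod (al n.+1)).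
Proof.
have -> : v n.+1 j - v n j = (Q n.+1).[z j] *
  (((Q n.+2).[z j] - (Q n.+1).[z j]) / (N n.+1)%:C +
   ((Q n.+1).[z j] - (Q n).[z j]) / (N n.+1)%:C +
   (Q n).[z j] * ((N n.+1)%:C^-1 - (N n)%:C^-1)) by rewrite /v; ring.
have /andP[_ QB] := Qb n.+1 j; have /andP[_ QB'] := Qb n j.
have NV : cmod (N n.+1)%:C^-1 <= nu^-1.
  by rewrite cmodV cmodR gtr0_norm ?N0// lef_pV2 ?posrE ?N0//; case/andP: (Nb n.+1).
have a1 := cmod_ge0 (al n); have a2 := cmod_ge0 (al n.+1).
have B0' : 0 <= B by apply: le_trans QB; exact: cmod_ge0.
have nV : 0 <= nu^-1 by rewrite invr_ge0 ltW.
rewrite cmodM -!mulrA; apply: ler_pM; rewrite ?cmod_ge0//.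
rewrite (le_trans (cmodD _ _))// (le_trans (lerD (cmodD _ _) (lexx _)))// !cmodM.
have h1 := ler_pM (cmod_ge0 _) (cmod_ge0 _) (Q_step n.+1 j) NV.
have h2 := ler_pM (cmod_ge0 _) (cmod_ge0 _) (Q_step n j) NV.
have h3 := ler_pM (cmod_ge0 _) (cmod_ge0 _) QB' (NV_step n).
rewrite (le_trans (lerD (lerD h1 h2) h3))//.
have -> : B * cmod (al n.+1) / nu + B * cmod (al n) / nu + B * (cmod (al n) / nu) =
  B * (nu^-1 * (2 * cmod (al n) + cmod (al n.+1))) by ring.
by rewrite ler_wpM2l// ler_wpM2l// mulrDr lerD2l ler_peMl// ler1n.
Qed.

Let kV n j : (kap n.+1 j)^-1 <= a ^- 2 / n.+1%:R.
Proof.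
by rewrite -invfM lef_pV2 ?posrE ?mulr_gt0 ?exprn_gt0// mulrC kap_ge.
Qed.

(** The increments of [kap] are bounded and [kap] is at least of order [n]. *)
Let kV_step n j : `|(kap n.+2 j)^-1 - (kap n.+1 j)^-1| <= B ^+ 2 / nu * a ^- 4 / n.+1%:R ^+ 2.
Proof.
have k1 := kap_gt0 n j; have k2 := kap_gt0 n.+1 j.
have -> : (kap n.+2 j)^-1 - (kap n.+1 j)^-1 =
    - (cmod (P n.+1).[z j] ^+ 2 / N n.+1 * ((kap n.+2 j)^-1 * (kap n.+1 j)^-1)).
  rewrite [in RHS](_ : _ / N n.+1 = kap n.+2 j - kap n.+1 j); last by rewrite (kapS n.+1) addrC addKr.
  by field; rewrite !gt_eqF.
have p0 : 0 <= cmod (P n.+1).[z j] ^+ 2 / N n.+1.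
  by rewrite divr_ge0 ?exprn_ge0 ?cmod_ge0// ltW// N0.
have kk0 : 0 <= (kap n.+2 j)^-1 * (kap n.+1 j)^-1 by rewrite mulr_ge0// invr_ge0 ltW.
have /andP[nuN _] := Nb n.+1.
rewrite normrN (ger0_norm (mulr_ge0 p0 kk0)).
have -> : B ^+ 2 / nu * a ^- 4 / n.+1%:R ^+ 2 =
    B ^+ 2 / nu * ((a ^- 2 / n.+1%:R) * (a ^- 2 / n.+1%:R)).
  have n0 : n.+1%:R != 0 :> R by [].
  by move: (n.+1%:R) n0 => t t0; field; rewrite t0 !gt_eqF.
apply: ler_pM => //.
  apply: ler_pM; rewrite ?exprn_ge0 ?cmod_ge0 ?invr_ge0 ?(ltW (N0 _))//.
    by rewrite lerXn2r ?nnegrE ?cmod_ge0// (le_trans (cmod_ge0 _) (Pb n.+1 j)).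
  by rewrite lef_pV2 ?posrE ?N0.
apply: ler_pM; rewrite ?invr_ge0 ?(ltW k1) ?(ltW k2)//.
apply: (le_trans _ (kV n j)); rewrite lef_pV2 ?posrE// (kapS n.+1) lerDl.
by rewrite divr_ge0 ?exprn_ge0 ?cmod_ge0// ltW// N0.
Qed.

(** The increments of [v] are [O(|al_n| + |al_{n+1}|)], which need not be summable. The factor
    [1 / kap = O(1/n)] saves them: [|al| / n] is at most a sum of squares, and [al] is square
    summable. *)
Lemma leading_variation : exists2 U, 0 <= U & forall n j,
  cmod (z j * lead n.+1 j - lead n j) <=
  U * (cmod (al n) ^+ 2 + cmod (al n.+1) ^+ 2 + n.+1%:R ^- 2).
Proof.
pose V := `|B * (B / nu)|; pose W := `|B ^+ 2 / nu * a ^- 4|.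
have V0 : 0 <= V by exact: normr_ge0. have W0 : 0 <= W by exact: normr_ge0.
have a2 : 0 <= a ^- 2 by rewrite invr_ge0 exprn_ge0// ltW.
exists (V * 2 * a ^- 2 + V * W).
  by rewrite addr_ge0 ?mulr_ge0.
move=> n j; have zz : z j * (z j)^*%C = 1 by rewrite mul_conjc z1 expr1n.
have -> : z j * lead n.+1 j - lead n j = (z j)^*%C ^+ n.+1 *
    ((v n.+1 j - v n j) * (kap n.+2 j)^-1%:C +
     v n j * ((kap n.+2 j)^-1 - (kap n.+1 j)^-1)%:C).
  rewrite !leadE [_ ^+ n.+2]exprS -[in LHS]mulrA [z j * _]mulrA zz mul1r real_complexD rmorphN.
  by ring.
rewrite cmodM cmodX cmod_conj z1 expr1n mul1r (le_trans (cmodD _ _))//.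
rewrite [cmod (_ * (_^-1)%:C)]cmodM [cmod (_ * (_ - _)%:C)]cmodM !cmodR.
have k2 : `|(kap n.+2 j)^-1| <= a ^- 2 / n.+1%:R.
  rewrite gtr0_norm ?invr_gt0// (le_trans _ (kV n j))// lef_pV2 ?posrE// (kapS n.+1) lerDl.
  by rewrite divr_ge0 ?exprn_ge0 ?cmod_ge0// ltW// N0.
have h1 := ler_pM (cmod_ge0 _) (normr_ge0 _) (v_step n j) k2.
have h2 := ler_pM (cmod_ge0 _) (normr_ge0 _) (v_bound n j) (kV_step n j).
apply: (le_trans (lerD h1 h2)).
have VB : B * (B / nu) <= V by exact: ler_norm.
have WB : B ^+ 2 / nu * a ^- 4 <= W by exact: ler_norm.
set x := cmod (al n); set y := cmod (al n.+1).
have x0 : 0 <= x := cmod_ge0 _; have y0 : 0 <= y := cmod_ge0 _.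
rewrite -!exprVn; have : 0 <= n.+1%:R^-1 :> R by rewrite invr_ge0.
rewrite -exprVn in WB; rewrite -exprVn in a2.
have p0 : 0 <= B * (B / nu) := le_trans (cmod_ge0 _) (v_bound n j).
have q0 : 0 <= B ^+ 2 / nu by rewrite expr2 -mulrA.
move: (n.+1%:R^-1) (a^-1) (B * (B / nu)) (B ^+ 2 / nu) V W VB WB V0 W0 x y x0 y0 a2 p0 q0.
move=> t b p q V W VB WB V0 W0 x y x0 y0 b0 p0 q0 t0.
have xyt : (x + y) * t <= x ^+ 2 + y ^+ 2 + t ^+ 2.
  have := sqr_ge0 (x - t); have := sqr_ge0 (y - t); nra.
have s0 : 0 <= (x + y) * t by rewrite mulr_ge0// addr_ge0.
have h : p * (2 * b ^+ 2 * ((x + y) * t)) <= V * (2 * b ^+ 2 * (x ^+ 2 + y ^+ 2 + t ^+ 2)).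
  apply: ler_pM => //; first by rewrite mulr_ge0// mulr_ge0.
  by rewrite ler_wpM2l// mulr_ge0.
have h' : p * (q * b ^+ 4 * t ^+ 2) <= V * (W * (x ^+ 2 + y ^+ 2 + t ^+ 2)).
  apply: ler_pM => //; first by rewrite mulr_ge0 ?sqr_ge0// mulr_ge0// (exprM b 2 2) sqr_ge0.
  apply: ler_pM => //; rewrite ?sqr_ge0//.
    by rewrite mulr_ge0// (exprM b 2 2) sqr_ge0.
  by rewrite lerDr addr_ge0 ?sqr_ge0.
have -> : p * 2 * (x + y) * (b ^+ 2 * t) + p * (q * b ^+ 4 * t ^+ 2) =
  p * (2 * b ^+ 2 * ((x + y) * t)) + p * (q * b ^+ 4 * t ^+ 2) by ring.
have -> : (V * 2 * b ^+ 2 + V * W) * (x ^+ 2 + y ^+ 2 + t ^+ 2) =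
  V * (2 * b ^+ 2 * (x ^+ 2 + y ^+ 2 + t ^+ 2)) + V * (W * (x ^+ 2 + y ^+ 2 + t ^+ 2)) by ring.
exact: lerD.
Qed.

Lemma mass_coef_variation M2 : (forall n, \sum_(0 <= k < n) cmod (al k) ^+ 2 <= M2) ->
  exists M, forall j n,
    \sum_(0 <= k < n) cmod (z j * mass_coef k.+1 j - mass_coef k j) <= M.
Proof.
move=> l2; have [U U0 HU] := mass_coef_leading; have [V V0 HV] := leading_variation.
exists (V * (M2 + M2 + 2) + 2 * U * 2) => j n.
(* The telescoping bound for the sum of inverse squares. *)
have sq k : \sum_(0 <= k0 < k.+1) (k0.+1%:R ^- 2 : R) <= 2 - k.+1%:R^-1.
  elim: k => [|k IH]; first by rewrite big_nat1 expr1n invr1; lra.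
  rewrite big_nat_recr//= (le_trans (lerD IH (lexx _)))//.
  have k0 : 0 < k.+1%:R :> R by [].
  have -> : k.+2%:R = k.+1%:R + 1 :> R by rewrite -natr1.
  move: (k.+1%:R) k0 => t t0; have t1 : 0 < t + 1 by rewrite addr_gt0.
  rewrite -subr_ge0 (_ : _ - _ = (t * (t + 1) ^+ 2)^-1).
    by rewrite invr_ge0 mulr_ge0 ?exprn_ge0// ltW.
  by field; rewrite !gt_eqF.
have sum2 k : \sum_(0 <= k0 < k) (k0.+1%:R ^- 2 : R) <= 2.
  by case: k => [|k]; [rewrite big_geq|rewrite (le_trans (sq k))// gerBl invr_ge0].
have l2' : \sum_(0 <= k < n) cmod (al k.+1) ^+ 2 <= M2.
  by apply: le_trans (l2 n.+1); rewrite [leRHS]big_nat_recl//= lerDr exprn_ge0// cmod_ge0.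
apply: (@le_trans _ _ (\sum_(0 <= k < n) (V * (cmod (al k) ^+ 2 + cmod (al k.+1) ^+ 2 + k.+1%:R ^- 2)
   + 2 * U * k.+1%:R ^- 2))).
  apply: ler_sum => k _.
  have -> : z j * mass_coef k.+1 j - mass_coef k j = z j * lead k.+1 j - lead k j +
    (z j * (mass_coef k.+1 j - lead k.+1 j) - (mass_coef k j - lead k j)).
    by rewrite mulrBr; ring.
  rewrite (le_trans (cmodD _ _))// lerD// (le_trans (cmodB _ _))//.
  rewrite cmodM z1 mul1r -mulrA mulrDl mul1r lerD//.
  rewrite (le_trans (HU k.+1 j))// ler_wpM2l// lef_pV2 ?posrE ?exprn_gt0//.
  by rewrite lerXn2r ?nnegrE// ler_nat.
rewrite big_split/= -!mulr_sumr lerD//.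
  by rewrite ler_wpM2l// !big_split/= !lerD.
by rewrite ler_wpM2l ?mulr_ge0.
Qed.

(** By Cesaro [kap_n / n] tends to [|q|^2 / Noo], so [Noo] cancels against the factor [1 / N_n] of
    [v]; the weight has already disappeared from [lead]. *)
Lemma mass_coef_cvg j q Noo : ccvg (fun n => (Q n).[z j]) q -> q != 0 ->
  N n @[n --> \oo] --> Noo -> 0 < Noo ->
  ccvg (fun n => n%:R * mass_coef n j * z j ^+ n) ((z j)^*%C * (q ^+ 2 / (cmod q ^+ 2)%:C)).
Proof.
move=> Qq q0 NN Noo0; have [U U0 HU] := mass_coef_leading.
have zz n : (z j)^*%C ^+ n * z j ^+ n = 1 by rewrite -exprMn mulrC mul_conjc z1 expr1n expr1n.
have kcv : kap n.+1 j / n.+1%:R @[n --> \oo] --> cmod q ^+ 2 / Noo.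
  have H : cmod (P n).[z j] ^+ 2 / N n @[n --> \oo] --> cmod q ^+ 2 / Noo.
    under eq_fun do rewrite cmodP.
    apply: cvgM; last by apply: cvgV => //; rewrite gt_eqF.
    by under eq_fun do rewrite expr2; rewrite expr2; apply: cvgM; exact: ccvg_cmod.
  have := cesaro H; rewrite /arithmetic_mean /series /=.
  by under eq_fun do rewrite mulrC big_mkord.
have hcv : n%:R / kap n.+1 j @[n --> \oo] --> Noo / cmod q ^+ 2.
  have -> : (fun n => n%:R / kap n.+1 j) = (fun n => (1 - n.+1%:R^-1) * (kap n.+1 j / n.+1%:R)^-1).
    apply/funext => n; rewrite invf_div mulrBl mul1r mulrA mulVf// -mulrBl.
    by rewrite -natr1 addrK.
  rewrite -[Noo / _]mul1r -[X in X * _]subr0 -invf_div; apply: cvgM.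
    by apply: cvgB; [exact: cvg_cst|exact: cvg_harmonic].
  by apply: cvgV => //; rewrite gt_eqF// divr_gt0 ?exprn_gt0 ?cmod_gt0.
have vcv : ccvg (fun n => v n j) (q * (q / Noo%:C)).
  have NC : Noo%:C != 0 :> C by rewrite -cmod_eq0 cmodR normr_eq0 gt_eqF.
  exact: (ccvgM (ccvg_shift Qq) (ccvgM Qq (ccvgV (ccvg_real NN) NC))).
have lcv : ccvg (fun n => n%:R * lead n j * z j ^+ n)
    ((z j)^*%C * (q * (q / Noo%:C) * (Noo / cmod q ^+ 2)%:C)).
  have -> : (fun n => n%:R * lead n j * z j ^+ n) =
     (fun n => (z j)^*%C * (v n j * (n%:R / kap n.+1 j)%:C)).
    apply/funext => n; rewrite leadE exprS real_complexM real_complex_nat.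
    rewrite -[RHS]mul1r -(zz n); ring.
  apply: ccvgM; first exact: ccvg_cst.
  by apply: ccvgM => //; exact: ccvg_real.
have dcv : ccvg (fun n => n%:R * (mass_coef n j - lead n j) * z j ^+ n) 0.
  apply: (ccvg_squeeze (h := fun n => U * n.+1%:R^-1)).
    by rewrite -[0](mulr0 U); apply: cvgMr; exact: cvg_harmonic.
  near=> n; rewrite subr0 !cmodM cmodX z1 expr1n mulr1 cmod_nat.
  rewrite (le_trans (ler_wpM2l _ (HU n j)))// mulrCA ler_wpM2l//.
  rewrite ler_pdivrMr ?exprn_gt0// expr2 mulrA mulVf// mul1r ler_nat//.
have -> : (fun n => n%:R * mass_coef n j * z j ^+ n) = (fun n =>
   n%:R * lead n j * z j ^+ n + n%:R * (mass_coef n j - lead n j) * z j ^+ n).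
  by apply/funext => n; ring.
have -> : (z j)^*%C * (q ^+ 2 / (cmod q ^+ 2)%:C) =
    (z j)^*%C * (q * (q / Noo%:C) * (Noo / cmod q ^+ 2)%:C) + 0.
  have NC : Noo%:C != 0 :> C by rewrite -cmod_eq0 cmodR normr_eq0 gt_eqF.
  rewrite addr0 real_complexM real_complexV.
  by move: ((cmod q ^+ 2)%:C)^-1 (Noo%:C) NC => k Nc NC; field.
exact: ccvgD.
Unshelve. all: end_near. Qed.

Lemma opoly_at_mass_cvg0 j : ccvg (fun n => u n j) 0.
Proof.
have [U U0 HU] := opoly_at_mass_decay; have [V V0 HV] := opoly_at_mass_bounded.
apply: (ccvg_squeeze (h := fun n => (U + V) * n.+1%:R^-1)).
  by rewrite -[0](mulr0 (U + V)); apply: cvgMr; exact: cvg_harmonic.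
near=> n; rewrite subr0 ler_pdivlMr// mulrC -natr1 mulrDl mul1r lerD//.
Unshelve. all: end_near. Qed.

(** Pairing [opoly F n] with [opoly F1 n] computes both norms, as each is monic and orthogonal for
    its own form. In [F1E] the mass terms carry a factor [u n j], which tends to 0. *)
Lemma onorm2_mass_cvg Noo : N n @[n --> \oo] --> Noo ->
  onorm2 F1 n @[n --> \oo] --> c * Noo.
Proof.
move=> NN.
have E n : (onorm2 F1 n)%:C = c%:C * (N n)%:C +
    \sum_j ((gamma j)%:C * ((P n).[z j])^*%C) * u n j.
  rewrite -(opoly_self F1T n) -(orth_monic F1T (orth_opoly F1T F1pos n) (monic_opoly FT Fpos n)
    (size_opoly FT Fpos n)) F1E; congr (_ * _ + _).
    rewrite (form_conj FT) (orth_monic FT (orth_opoly FT Fpos n) (monic_opoly F1T F1pos n)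
      (size_opoly F1T F1pos n)).
    by rewrite (opoly_self FT) conjR.
  by apply: eq_bigr => j _; rewrite mulrA.
have [] : ccvg (fun n => (onorm2 F1 n)%:C) (c * Noo)%:C => //.
have -> : (c * Noo)%:C = c%:C * Noo%:C + 0 :> C by rewrite addr0 real_complexM.
under eq_fun do rewrite E.
apply: ccvgD; first by apply: ccvgM; [exact: ccvg_cst|exact: ccvg_real].
apply: ccvg_sum0 => j; apply: (ccvg0M (M := gamma j * B)) (opoly_at_mass_cvg0 j) => n.
by rewrite cmodM cmod_conj cmodR gtr0_norm// ler_wpM2l// ltW.
Qed.

(** Away from the masses the kernels stay bounded and the coefficients [u n j] tend to 0, so the
    perturbation vanishes in the limit. *)
Lemma opolyr_mass_cvg x q B' : cmod x = 1 -> (forall j, x != z j) ->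
  (forall n, cmod (Q n).[x] <= B') ->
  ccvg (fun n => (Q n).[x]) q -> ccvg (fun n => (opolyr F1 n).[x]) q.
Proof.
move=> x1 xz QB' Qq.
pose r n := \sum_j ((gamma j / c)%:C * (cdker F n (z j)).[x]) * u n j.
have E n : (opolyr F1 n).[x] = (Q n).[x] + (- x ^+ n * (r n)^*%C).
  rewrite (opolyr_circle F1T F1pos)// (opolyr_circle FT Fpos)//.
  rewrite (perturbed_opoly FT Fpos F1T F1pos c0 F1E) conjB mulrBr mulNr.
  by congr (_ - _ * _^*%C); apply: eq_bigr => j _; rewrite mulrAC.
have r0 : ccvg r 0.
  apply: ccvg_sum0 => j.
  have d0 : 0 < cmod (1 - x * (z j)^*%C).
    rewrite cmod_gt0 subr_eq0; apply: contraNneq (xz j) => e.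
    have zz : (z j)^*%C * z j = 1 by rewrite mulrC mul_conjc z1 expr1n.
    by rewrite -[x]mulr1 -zz mulrA -e mul1r.
  apply: (ccvg0M (M := gamma j / c * (2 * B' * B / nu / cmod (1 - x * (z j)^*%C))))
    (opoly_at_mass_cvg0 j) => n.
  rewrite cmodM cmodR gtr0_norm ?divr_gt0// ler_wpM2l ?divr_ge0 ?(ltW c0) ?(ltW (gamma0 j))//.
  have /andP[_ QB] := Qb n j; have /andP[nuN _] := Nb n.
  exact: cdker_circle_bound.
rewrite -[q]addr0; under eq_fun do rewrite E; apply: ccvgD => //.
apply: (ccvg0M (M := 1)); first by move=> n; rewrite cmodN cmodX x1 expr1n.
have [rR rI] := r0; split => /=.
  by under eq_fun do rewrite ReJ.
by under eq_fun do rewrite ImJ; rewrite -[0]oppr0; exact: cvgN.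
Qed.

End point_mass_asymptotics.

(** * The Toeplitz form of the measure with added masses *)

Section point_masses.
Variable R : realType.
Local Notation C := (R[i]^o).
Local Notation circle := (@unit_circle R : set (borelC R)).
Variables mu0 mum : probability (borelC R) R.
Variables (m : nat) (z : 'I_m -> C) (gamma : 'I_m -> R).
Hypothesis mu0_circle : mu0 circle = 1%E.
Hypothesis mu0_nontrivial : nontrivial mu0.
Hypothesis z_circle : forall j, unit_circle (z j).
Hypothesis gamma_gt0 : forall j, 0 < gamma j.
Hypothesis gamma_lt1 : \sum_(j < m) gamma j < 1.
Hypothesis mumE : forall A : set (borelC R), measurable A ->
  (mum A = (1 - \sum_(j < m) gamma j)%R%:E * mu0 A
           + \sum_(j < m) (gamma j)%:E * @dirac _ (borelC R) (z j) R A)%E.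

Let c := 1 - \sum_(j < m) gamma j.
Let c0 : 0 < c. Proof. by rewrite subr_gt0. Qed.
Let mC := @measurable_circle R.

Lemma point_masses_circle : mum circle = 1%E.
Proof.
apply: (etrans (mumE mC)); rewrite [X in (_ * X + _)%E]mu0_circle mule1 (eq_bigr (fun j => (gamma j)%:E)).
  by rewrite sumEFin -EFinD subrK.
by move=> j _; rewrite diracE mem_set ?mule1//; exact: z_circle.
Qed.

Lemma point_masses_nontrivial : nontrivial mum.
Proof.
apply: sub_infinite_set mu0_nontrivial => w sw U oU Uw.
apply: (eq_ind_r (fun x => (0 < x)%E) _ (mumE (open_measurableC oU))).
have u0 := sw U oU Uw; rewrite (@lt_le_trans _ _ (c%:E * mu0 U)%E)//.
  by rewrite mule_gt0// lte_fin.
rewrite leeDl// sume_ge0// => j _; rewrite mule_ge0// lee_fin ltW//.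
Qed.

(** The family of masses is padded with zero measures, since [msum] takes a sequence indexed by
    [nat]. *)
Let mass (n : nat) : {measure set (borelC R) -> \bar R} :=
  if insub n is Some j then mscale (NngNum (ltW (gamma_gt0 j))) (@dirac _ (borelC R) (z j) R)
  else mzero.

Let ge0_integral_mum (f : borelC R -> \bar R) : measurable_fun circle f ->
  (forall w, circle w -> 0 <= f w)%E ->
  (\int[mum]_(w in circle) f w =
   c%:E * \int[mu0]_(w in circle) f w + \sum_(j < m) (gamma j)%:E * f (z j))%E.
Proof.
move=> mf f0.
rewrite (eq_measure_integral (measure_add (mscale (NngNum (ltW c0)) mu0) (msum mass m))); last first.
  move=> A mA _; apply: (etrans (mumE mA)).
  apply/esym/(etrans (measure_addE _ _ _)); rewrite /mscale/= /msum; congr (_ + _)%E.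
  by apply: eq_bigr => j _; rewrite /mass valK.
rewrite ge0_integral_measure_add// ge0_integral_mscale//; congr (_ + _)%E.
rewrite ge0_integral_measure_sum//; apply: eq_bigr => j _.
rewrite /mass valK ge0_integral_mscale// integral_dirac// diracE mem_set ?mul1e//.
Qed.

(** Adding the bound [M] makes the integrand nonnegative, where additivity in the measure is
    available; the constant cancels because both measures have mass 1. *)
Lemma Rintegral_point_masses (f : borelC R -> R) (M : R) : measurable_fun circle f ->
  (forall w, circle w -> `|f w| <= M) ->
  \int[mum]_(w in circle) f w =
  c * \int[mu0]_(w in circle) f w + \sum_(j < m) gamma j * f (z j).
Proof.
move=> mf fM; pose h w := f w + M.
have mh : measurable_fun circle h by apply: measurable_funD => //; exact: measurable_cst.
have h0 w : circle w -> 0 <= h w.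
  by move=> /fM; rewrite /h ler_norml -lerBlDr sub0r => /andP[].
have bnd (mu : probability (borelC R) R) : mu circle = 1%E ->
    mu.-integrable circle (EFin \o f) /\ \int[mu]_(w in circle) h w = \int[mu]_(w in circle) f w + M.
  move=> mu1; have ifl : mu.-integrable circle (EFin \o f).
    apply: (measurable_bounded_integrable mC) => //; first by rewrite [X in (X < _)%E]mu1 ltry.
    by exists M; split; [exact: num_real|move=> N N1 w wc /=; rewrite (le_trans (fM w wc))// ltW].
  have icst : mu.-integrable circle (EFin \o (fun=> M)).
    apply: (measurable_bounded_integrable mC) => //; first by rewrite [X in (X < _)%E]mu1 ltry.
    by exists `|M|; split; [exact: num_real|move=> N N1 w wc /=; rewrite ltW].
  split => //; rewrite /h RintegralD//; congr (_ + _).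
  by rewrite Rintegral_cst// [X in fine X]mu1 mulr1.
have [if0 E0] := bnd _ mu0_circle; have [ifm Em] := bnd _ point_masses_circle.
have ih (mu : probability (borelC R) R) : mu circle = 1%E -> mu.-integrable circle (EFin \o h).
  move=> mu1; apply: (measurable_bounded_integrable mC) => //; first by rewrite [X in (X < _)%E]mu1 ltry.
  exists (M + M); split; [exact: num_real|move=> N N1 w wc /=].
  rewrite (le_trans (ler_normD _ _))//.
  have fw := fM w wc; have M0 : 0 <= M := le_trans (normr_ge0 _) fw.
  by rewrite (le_trans _ (ltW N1))// lerD// ger0_norm.
have H : \int[mum]_(w in circle) h w =
    c * \int[mu0]_(w in circle) h w + \sum_(j < m) gamma j * h (z j).
  apply: EFin_inj; rewrite EFinD EFinM -(integrable_int mC (ih _ mu0_circle)).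
  rewrite -(integrable_int mC (ih _ point_masses_circle)) -sumEFin.
  rewrite (ge0_integral_mum (f := EFin \o h))//.
    exact/measurable_EFinP.
move: H; rewrite Em E0 => H; apply: (addIr M); rewrite H /h.
rewrite (eq_bigr (fun j => gamma j * f (z j) + gamma j * M)); last by move=> j _; rewrite mulrDr.
rewrite big_split/= -mulr_suml /c; ring.
Qed.

Lemma mform_point_masses p q : mform mum p q =
  c%:C * mform mu0 p q + \sum_(j < m) (gamma j)%:C * ((p.[z j])^*%C * q.[z j]).
Proof.
have [mR mI [M HM]] := cbounded_poly p q.
have HR := @Rintegral_point_masses _ M mR (fun w wc => le_trans (ler_Re_cmod _) (HM w wc)).
have HI := @Rintegral_point_masses _ M mI (fun w wc => le_trans (ler_Im_cmod _) (HM w wc)).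
rewrite /mform /inner /cintegral HR HI.
apply/eqP; rewrite eq_complex; apply/andP; split; apply/eqP.
  rewrite ReD Re_sum ReM/= mul0r subr0; congr (_ + _); apply: eq_bigr => j _.
  by rewrite [in RHS]ReM/= mul0r subr0.
rewrite ImD Im_sum ImM/= mul0r addr0; congr (_ + _); apply: eq_bigr => j _.
by rewrite [in RHS]ImM/= mul0r addr0.
Qed.

End point_masses.

(** A smooth substitute for the minimum that also makes sense for an empty index type. *)
Lemma finite_lower_bound (R : realType) (I : finType) (f : I -> R) :
  (forall i, 0 < f i) -> exists2 d, 0 < d & forall i, d <= f i.
Proof.
move=> f0; have s0 : 0 <= \sum_i (f i)^-1 by apply: sumr_ge0 => i _; rewrite invr_ge0 ltW.
have s1 : 0 < 1 + \sum_i (f i)^-1 by rewrite ltr_pwDl.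
exists (1 + \sum_i (f i)^-1)^-1 => [|i]; first by rewrite invr_gt0.
rewrite -[leRHS]invrK lef_pV2 ?posrE ?invr_gt0// (bigD1 i)//= addrCA lerDl.
by rewrite addr_ge0// sumr_ge0// => j _; rewrite invr_ge0 ltW.
Qed.

Section insertion_of_point_masses.
Variable R : realType.
Local Notation C := (R[i]^o).
Local Notation circle := (@unit_circle R : set (borelC R)).
Variable mu0 mum : probability (borelC R) R.
Hypothesis mu0_circle : mu0 circle = 1%E.
Hypothesis mu0_nontrivial : nontrivial mu0.
Variables (m : nat) (z : 'I_m -> C).
Hypothesis z_circle : forall j, unit_circle (z j).
Hypothesis z_distinct : forall j k, j != k -> z j != z k.
Hypothesis z_neq1 : forall j, z j != 1.
Variable gamma : 'I_m -> R.
Hypothesis gamma_gt0 : forall j, 0 < gamma j.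
Hypothesis gamma_lt1 : \sum_(j < m) gamma j < 1.
Hypothesis mumE : forall A : set (borelC R), measurable A ->
  (mum A = (1 - \sum_(j < m) gamma j)%R%:E * mu0 A
           + \sum_(j < m) (gamma j)%:E * @dirac _ (borelC R) (z j) R A)%E.
Local Notation F := (mform mu0).
Local Notation F1 := (mform mum).
Variables M1 M2 : R.
Hypothesis bv : forall n, \sum_(0 <= k < n) cmod (verb F k.+1 - verb F k) <= M1.
Hypothesis l2 : forall n, \sum_(0 <= k < n) cmod (verb F k) ^+ 2 <= M2.

Let c := 1 - \sum_(j < m) gamma j.
Let c0 : 0 < c. Proof. by rewrite subr_gt0. Qed.
Let z1 j : cmod (z j) = 1. Proof. exact/unit_circleE. Qed.
Let FT := toeplitz_mform mu0_circle.
Let Fpos := posdef_mform mu0_circle mu0_nontrivial.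
Let F11 := mform11 mu0_circle.
Let mum_circle := point_masses_circle mu0_circle z_circle mumE.
Let mum_nontrivial := point_masses_nontrivial mu0_nontrivial gamma_gt0 gamma_lt1 mumE.
Let F1T := toeplitz_mform mum_circle.
Let F1pos := posdef_mform mum_circle mum_nontrivial.
Let F1E : forall p q, F1 p q =
  c%:C * F p q + \sum_(j < m) (gamma j)%:C * ((p.[z j])^*%C * q.[z j]) :=
  mform_point_masses mu0_circle z_circle gamma_gt0 gamma_lt1 mumE.
Let Noo := onorm2_lim F.
Let NN : onorm2 F n @[n --> \oo] --> Noo := onorm2_cvg FT Fpos l2.
Let Noo0 : 0 < Noo := onorm2_lim_gt0 FT Fpos l2.
Let beta := mass_coef F F1 z c gamma.

(** The masses keep a positive distance from [1], where [Q_n] is not controlled, and from each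
    other, where the kernel grows. *)
Let bounds : exists a B L nu : R, [/\ 0 < a /\ 0 < nu, 0 <= L,
  forall n j, a <= cmod (opolyr F n).[z j] <= B,
  forall n, nu <= onorm2 F n <= 1 &
  forall n j k, j != k -> cmod (cdker F n (z j)).[z k] <= L].
Proof.
have [|d d0 Hd] := @finite_lower_bound R 'I_m (fun j => cmod (z j - 1)) _.
  by move=> j; rewrite cmod_gt0 subr_eq0.
have [|e e0 He] := @finite_lower_bound R ('I_m * 'I_m)%type
  (fun jk => if jk.1 == jk.2 then 1 else cmod (1 - z jk.2 * (z jk.1)^*%C)) _.
  move=> [j k] /=; case: eqVneq => // jk; rewrite cmod_gt0 subr_eq0.
  apply: contraNneq (z_distinct jk) => E.
  have zz : (z j)^*%C * z j = 1 by rewrite mulrC mul_conjc z1 expr1n.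
  by rewrite -[z k]mulr1 -zz mulrA -E mul1r.
have [a [B [a0 Qb]]] := opolyr_bounds FT Fpos bv l2 d0.
have [nu nu0 Nb] := onorm2_lower FT Fpos l2.
have Qb' n j : a <= cmod (opolyr F n).[z j] <= B by apply: Qb; rewrite ?z1.
exists a, B, `|2 * B * B / nu / e|, nu; split => //.
  by move=> n; rewrite Nb (onorm2_le1 FT Fpos F11).
move=> n j k jk; have /andP[_ Qj] := Qb' n j; have /andP[_ Qk] := Qb' n k.
apply: le_trans (ler_norm _); apply: (cdker_circle_bound FT Fpos (z1 k) (z1 j) Qk Qj nu0 (Nb n) e0).
by have := He (j, k); rewrite /= (negbTE jk).
Qed.

Lemma verblunsky_mass n :
  verblunsky mum n = verblunsky mu0 n + \sum_(j < m) beta n j.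
Proof. by rewrite !verblunskyE// (verb_mass FT Fpos F1T F1pos c0 F1E). Qed.

Lemma mass_coef_summable : exists M, forall j n,
  \sum_(0 <= k < n) cmod (z j * beta k.+1 j - beta k j) <= M.
Proof.
have [a [B [L [nu [[a0 nu0] L0 Qb Nb Kb]]]]] := bounds.
exact: (mass_coef_variation FT Fpos F1T F1pos c0 gamma_gt0 F1E z1 a0 nu0 L0 Qb Nb Kb l2).
Qed.

Lemma mass_coef_limit j :
  ccvg (fun n => n%:R * beta n j * z j ^+ n)
    ((z j)^*%C * (opoly_lim F (z j) ^+ 2 / (cmod (opoly_lim F (z j)) ^+ 2)%:C)).
Proof.
have [a [B [L [nu [[a0 nu0] L0 Qb Nb Kb]]]]] := bounds.
have zj1 : cmod (z j) <= 1 by rewrite z1.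
exact: (mass_coef_cvg FT Fpos F1T F1pos c0 gamma_gt0 F1E z1 a0 nu0 L0 Qb Nb Kb
  (ccvg_opoly_lim FT Fpos bv l2 zj1 (z_neq1 j)) (opoly_lim_neq0 FT Fpos bv l2 zj1 (z_neq1 j)) NN Noo0).
Qed.

Lemma phi_star_mass_cvg x : unit_circle x -> x != 1 -> (forall j, x != z j) ->
  phi_star mum n x @[n --> \oo] --> opoly_lim F x / (Num.sqrt (c * Noo))%:C.
Proof.
move=> /unit_circleE xc xn1 xz; have x1 : cmod x <= 1 by rewrite xc.
have [a [B [L [nu [[a0 nu0] L0 Qb Nb Kb]]]]] := bounds.
have d0 : 0 < cmod (x - 1) by rewrite cmod_gt0 subr_eq0.
have [a' [B' [a'0 Qb']]] := opolyr_bounds FT Fpos bv l2 d0.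
have QB' n : cmod (opolyr F n).[x] <= B' by case/andP: (Qb' x x1 (lexx _) n).
have Qx := opolyr_mass_cvg FT Fpos F1T F1pos c0 gamma_gt0 F1E z1 a0 nu0 L0 Qb Nb Kb xc xz QB'
  (ccvg_opoly_lim FT Fpos bv l2 x1 xn1).
have Ncv := onorm2_mass_cvg FT Fpos F1T F1pos c0 gamma_gt0 F1E z1 a0 L0 Qb Nb Kb NN.
apply/ccvg_cmodP; under eq_fun do rewrite (phi_starE mum_circle mum_nontrivial).
apply: ccvgM => //; apply: ccvgV.
  by apply: ccvg_real; apply: continuous_cvg Ncv; exact: sqrt_continuous.
by rewrite -cmod_eq0 cmodR normr_eq0 gt_eqF// sqrtr_gt0 mulr_gt0.
Qed.

Lemma opoly_lim_within (S : set C) :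
  (forall x, S x -> unit_circle x /\ x != 1) -> {within S, continuous (opoly_lim F)}.
Proof.
move=> Sc; apply/subspace_continuousP => x Sx; have [/unit_circleE xc xn1] := Sc x Sx.
apply/cvg_cmodP => e e0; have e2 : 0 < e / 2 by rewrite divr_gt0.
have x1 : cmod x <= 1 by rewrite xc.
have [d d0 Hd] := opoly_lim_continuous FT Fpos bv l2 x1 xn1 e2.
have := nbhsx_ballx x d%:C; rewrite ltcR => /(_ d0); apply: filterS => y.
rewrite /ball /= normcmod ltcR => xy Sy; have [/unit_circleE yc _] := Sc y Sy.
rewrite cmod_distC (le_lt_trans (Hd y _ _))// ?yc//.
  by rewrite cmod_distC ltW.
by rewrite ltr_pdivrMr// ltr_pMr// ltr1n.
Qed.

End insertion_of_point_masses.

Theorem theorem2p3 (R : realType)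
  (mu0 : probability (borelC R) R)
  (mu0_circle : mu0 (@unit_circle R) = 1%E)
  (mu0_nontrivial : nontrivial mu0)
  (mu0_bv : abs_summable (fun n => verblunsky mu0 n.+1 - verblunsky mu0 n))
  (mu0_l2 : square_summable (verblunsky mu0))
  (m : nat) (m_ge1 : (1 <= m)%N)
  (z : m.-tuple R[i]^o)
  (z_circle : forall j, unit_circle (tnth z j))
  (z_distinct : forall j k, j != k -> tnth z j != tnth z k)
  (z_neq1 : forall j, tnth z j != 1)
  (gamma : 'I_m -> R)
  (gamma_gt0 : forall j, 0 < gamma j)
  (gamma_lt1 : \sum_(j < m) gamma j < 1)
  (mum : probability (borelC R) R)
  (mumE : forall A : set (borelC R), measurable A ->
    (mum A = (1 - \sum_(j < m) gamma j)%R%:E * mu0 A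
             + \sum_(j < m) (gamma j)%:E * @dirac _ (borelC R) (tnth z j) R A)%E) :
  let c (j : 'I_m) : R[i]^o :=
    (tnth z j)^*%C * `|szego_boundary mu0 (tnth z j)| ^+ 2
      * szego_boundary mu0 (tnth z j) ^- 2 in
  let S : set R[i]^o :=
    [set x | [/\ unit_circle x, x != 1 & forall j, x != tnth z j]] in
  [/\ gen_bounded_variation [tuple of 1 :: z] (verblunsky mum),
      (exists E : nat -> R[i]^o,
         (forall n, (1 <= n)%N ->
            verblunsky mum n = verblunsky mu0 n
              + \sum_(j < m) (tnth z j)^*%C ^+ n * c j / n%:R + E n) /\
         E =o_\oo (fun n => n%:R^-1 : R[i]^o)),
      (forall x, S x -> cvg (phi_star mum n x @[n --> \oo])),
      {within S, continuous (phi_star_oo mum)} &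
      (forall x, S x ->
         phi_star_oo mum x
         = ((Num.sqrt (1 - \sum_(j < m) gamma j))^-1)%:C
             * (szego_boundary mu0 x)^-1)].
Proof.
move=> c S; pose zj j := tnth z j.
have [M1 bv] := @summable_bounded _ (fun n => cmod (verblunsky mu0 n.+1 - verblunsky mu0 n))
  (fun n => cmod_ge0 _) mu0_bv.
have [M2 l2] := @summable_bounded _ (fun n => cmod (verblunsky mu0 n) ^+ 2)
  (fun n => exprn_ge0 2 (cmod_ge0 _)) mu0_l2.
have bv' n : \sum_(0 <= k < n) cmod (verb (mform mu0) k.+1 - verb (mform mu0) k) <= M1.
  by apply: le_trans (bv n); apply: ler_sum => k _; rewrite !verblunskyE.
have l2' n : \sum_(0 <= k < n) cmod (verb (mform mu0) k) ^+ 2 <= M2.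
  by apply: le_trans (l2 n); apply: ler_sum => k _; rewrite !verblunskyE.
have FT := toeplitz_mform mu0_circle.
have Fpos := posdef_mform mu0_circle mu0_nontrivial.
pose g0 := 1 - \sum_(j < m) gamma j; have g00 : 0 < g0 by rewrite subr_gt0.
pose Noo := onorm2_lim (mform mu0); have Noo0 : 0 < Noo := onorm2_lim_gt0 FT Fpos l2'.
pose q := opoly_lim (mform mu0).
pose beta := mass_coef (mform mu0) (mform mum) zj g0 gamma.
have verbE n : verblunsky mum n = verblunsky mu0 n + \sum_(j < m) beta n j.
  exact: (verblunsky_mass mu0_circle mu0_nontrivial z_circle gamma_gt0 gamma_lt1 mumE).
have szE x : unit_circle x -> x != 1 -> szego_boundary mu0 x = (Num.sqrt Noo)%:C / q x.
  exact: (szego_boundaryE mu0_circle mu0_nontrivial bv' l2').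
have q0 x : unit_circle x -> x != 1 -> q x != 0.
  move=> /unit_circleE x1; apply: (opoly_lim_neq0 FT Fpos bv' l2'); by rewrite x1.
have sN : (Num.sqrt Noo)%:C != 0 :> R[i]^o.
  by rewrite -cmod_eq0 cmodR normr_eq0 gt_eqF// sqrtr_gt0.
(* Only the phase of [D = sqrt Noo / q] matters in [|D|^2 / D^2]. *)
have cE j : c j = (zj j)^*%C * (q (zj j) ^+ 2 / (cmod (q (zj j)) ^+ 2)%:C).
  have qz := q0 _ (z_circle j) (z_neq1 j).
  have qc : (q (zj j))^*%C != 0 by rewrite -cmod_eq0 cmod_conj cmod_eq0.
  rewrite /c szE// normcmod -mulrA; congr (_ * _).
  rewrite -[_%:C ^+ 2]real_complexM -expr2 -!mul_conjc conjM conjV conjR.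
  move: (q (zj j)) qc qz ((Num.sqrt Noo)%:C) sN => x y0 x0 s s0.
  by field; rewrite x0 s0 !andbT; exact: y0.
have phicv x : S x -> phi_star mum n x @[n --> \oo] --> q x / (Num.sqrt (g0 * Noo))%:C.
  move=> [xc xn1 xz].
  exact: (phi_star_mass_cvg mu0_circle mu0_nontrivial z_circle z_distinct z_neq1 gamma_gt0
    gamma_lt1 mumE bv' l2').
have phiE x : S x -> phi_star_oo mum x = q x / (Num.sqrt (g0 * Noo))%:C.
  by move=> Sx; apply: cvg_lim (phicv x Sx).
split.
- have [M HM] := mass_coef_summable mu0_circle mu0_nontrivial z_circle z_distinct z_neq1 gamma_gt0
    gamma_lt1 mumE bv' l2'.
  (* The component of [1] carries the coefficients of [mu0]; that of [z_j] carries the exact term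
     [beta n j], not just its leading part. *)
  exists (fun n k => if unlift ord0 k is Some j then beta n j else verblunsky mu0 n); split.
    move=> n; rewrite verbE big_ord_recl unlift_none; congr (_ + _).
    by apply: eq_bigr => j _; rewrite liftK.
  move=> k; rewrite /abs_summable; case: (unliftP ord0 k) => [j ->|->].
    rewrite (tnth_nth 0) /= -(tnth_nth 0 z j).
    apply: (@bounded_summable _ (fun n => cmod (zj j * beta n.+1 j - beta n j)) M) => // n.
    exact: cmod_ge0.
  have -> : tnth [tuple of 1 :: z] ord0 = 1 by [].
  apply: (@bounded_summable _ (fun n => cmod (1 * verblunsky mu0 n.+1 - verblunsky mu0 n)) M1) => n.
    exact: cmod_ge0.
  by under eq_bigr do rewrite mul1r; exact: bv.
- exists (fun n => \sum_(j < m) beta n j - \sum_(j < m) (zj j)^*%C ^+ n * c j / n%:R); split.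
    by move=> n _; rewrite verbE -addrA; congr (_ + _); rewrite addrC subrK.
  (* For positive [n] this sum is [n * E n], because [conj(z_j)^n z_j^n = 1]. *)
  have G0 : ccvg (fun n => \sum_(j < m) (zj j)^*%C ^+ n * (n%:R * beta n j * zj j ^+ n - c j)) 0.
    apply: ccvg_sum0 => j; apply: (ccvg0M (M := 1)).
      by move=> n; rewrite cmodX cmod_conj (unit_circleE _).1// expr1n.
    rewrite -(subrr (c j)); apply: ccvgD; last exact: ccvg_cst.
    rewrite cE; exact: (mass_coef_limit mu0_circle mu0_nontrivial z_circle z_distinct z_neq1 gamma_gt0
      gamma_lt1 mumE bv' l2').
  apply/eqoP => e e0.
  have eE : e = (complex.Re e)%:C.
    by move: e0; rewrite ltcE /= => /andP[/eqP ei _]; case: e ei => a b /= ->.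
  have e0' : 0 < complex.Re e by move: e0; rewrite eE ltcR.
  have /cvg_cmodP/(_ _ e0') G1 := (ccvg_cmodP _ _).2 G0.
  near=> n; have n0 : 0 < n%:R :> R by rewrite ltr0n; near: n; exact: nbhs_infty_gt.
  have nC : n%:R != 0 :> R[i]^o by rewrite -cmod_eq0 cmod_nat gt_eqF.
  have Gn : cmod (\sum_(j < m) (zj j)^*%C ^+ n * (n%:R * beta n j * zj j ^+ n - c j)) < complex.Re e.
    by rewrite -[X in cmod X]opprK cmodN -[- _]add0r; near: n.
  rewrite !normcmod eE -real_complexM lecR cmodV cmod_nat ler_pdivlMr// -cmod_nat -cmodM.
  apply: ltW; apply: le_lt_trans Gn; rewrite le_eqVlt; apply/orP; left; apply/eqP; congr cmod.
  rewrite mulrBl !mulr_suml -sumrB; apply: eq_bigr => j _.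
  have zz : (zj j)^*%C ^+ n * zj j ^+ n = 1.
    by rewrite -exprMn mulrC mul_conjc (unit_circleE _).1// expr1n expr1n.
  by rewrite divfK// mulrBr [X in _ = X - _]mulrCA zz mulr1 mulrC.
- by move=> x Sx; apply: cvgP (phicv x Sx).
- apply/subspace_continuousP => x Sx.
  apply: (eq_ind_r (fun l => phi_star_oo mum y @[y --> within S (nbhs x)] --> l) _ (phiE x Sx)).
  have Sc y : S y -> unit_circle y /\ y != 1 by case.
  have /subspace_continuousP/(_ x Sx) qc := opoly_lim_within mu0_circle mu0_nontrivial bv' l2' Sc.
  have H : q y / (Num.sqrt (g0 * Noo))%:C @[y --> within S (nbhs x)] --> q x / (Num.sqrt (g0 * Noo))%:C.
    by apply: cvgM; [exact: qc|exact: cvg_cst].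
  apply: cvg_trans H; apply: near_eq_cvg; near=> y.
  have Sy : S y by near: y; exact: withinT.
  by rewrite (phiE y Sy).
- move=> x Sx; have [xc xn1 _] := Sx; rewrite phiE// szE// invf_div mulrCA; congr (_ * _).
  by rewrite sqrtrM ?(ltW g00)// real_complexM invfM real_complexV.
Unshelve. all: end_near. Qed.
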